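(* Let $K$ be a field with $\mathrm{char}(K)\ne 2$ and let $E$ be an elliptic curve over $K$. (1) Let $a$ be a nonzero element of $K$. The following conditions are equivalent: (4i) $E(K)$ contains exactly one point of order $2$ and a point of order $4$; (4ii) there exists a nonzero $b\in K$ such that $a^2+4b$ is not a square in $K$ and $E$ is $K$-isomorphic to the elliptic curve $$\mathcal{E}^{(4)}_{a,b}: y^2=\left(x^2+(a^2+2b)x+b^2\right)x.$$ (2) The following conditions are equivalent: (8i) $E(K)$ contains exactly one point of order $2$ and a point of order $8$; (8ii) there exists $t\in K\setminus\{0,\pm1\}$ such that $2t^2-1$ is not a square in $K$ and $E$ is $K$-isomorphic to the elliptic curve $$\mathcal{E}^{(8)}_t: y^2=\left(x^2+2\frac{t^4+2t^2-1}{(t^2-1)^2}x+1\right)x.$$ (3) The following conditions are equivalent: (6i) $E(K)$ contains exactly one point of order $2$ and a point of order $6$; (6ii) there exists $t\in K\setminus\{0,-4,1/2\}$ such that $t^2+4t$ is not a square in $K$ and $E$ is $K$-isomorphic to the elliptic curve $$\mathcal{E}^{(6)}_t: y^2=(x^2+(t^2+2t)x+t^2)(x+1).$$ (4) The following conditions are equivalent: (12i) $E(K)$ contains exactly one point of order $2$ and a point of order $12$; (12ii) there exists $t\in K\setminus\{0,\pm1,\pm\sqrt{-1}\}$ such that $(t^2+1)(3t^2-1)$ is not a square in $K$, $3t^2+1\ne0$, and $E$ is $K$-isomorphic to the elliptic curve $$\mathcal{E}^{(12)}_t: y^2=(x+1)\left(x^2+\frac{8t^2(t^2+1)(t^4+4t^2-1)}{(t^2-1)^4}x+\frac{16t^4(t^2+1)^2}{(t^2-1)^4}\right).$$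 (5) The following conditions are equivalent: (10i) $E(K)$ contains exactly one point of order $2$ and a point of order $10$; (10ii) there exists $t\in K\setminus\{0,\pm1,(-1\pm\sqrt5)/2,2\pm\sqrt5\}$ such that $t(t^2+t-1)$ is not a square in $K$ and $E$ is $K$-isomorphic to the elliptic curve $$\mathcal{E}^{(10)}_t: y^2=(x+1)\left(x^2+\frac{8t^2(t^3+t^2-t+1)}{(t-1)^2(t+1)^4}x+\frac{16t^4}{(t-1)^2(t+1)^4}\right).$$
   Context: The zero of the group law on an elliptic curve given by a Weierstrass equation $y^2=f(x)$ is its unique point at infinity. $K$-isomorphic means isomorphic over $K$ as elliptic curves. The symbols $\sqrt{-1}$ and $\sqrt5$ denote square roots in an algebraic closure $\bar K$ of $K$; excluding an element of $\bar K$ not lying in $K$ imposes no condition. *)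

(* Defs.v *)
From HB Require Import structures.
From mathcomp Require Import all_boot all_order all_algebra.
From mathcomp Require Import ring.
From mathcomp.multinomials Require Import mpoly.

Set Implicit Arguments.
Unset Strict Implicit.
Unset Printing Implicit Defensive.

Import GRing.Theory.
Local Open Scope ring_scope.

(* The plane cubic y^2 + a1 xy + a3 y = x^3 + a2 x^2 + a4 x + a6. *)
Record weierstrass (K : fieldType) := Weierstrass {
  a1 : K; a2 : K; a3 : K; a4 : K; a6 : K }.

(* [None] is the point at infinity (0 : 1 : 0) and [Some (x, y)] is the
   affine point (x : y : 1). *)
Definition point (K : fieldType) := option (K * K).

Definition base_change (K L : fieldType) (iota : {rmorphism K -> L})
    (E : weierstrass K) : weierstrass L :=
  Weierstrass (iota (a1 E)) (iota (a2 E)) (iota (a3 E)) (iota (a4 E))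
    (iota (a6 E)).

Section Curve.
Variables (K : fieldType) (E : weierstrass K).

Definition disc : K :=
  let b2 := a1 E ^+ 2 + 4 * a2 E in
  let b4 := 2 * a4 E + a1 E * a3 E in
  let b6 := a3 E ^+ 2 + 4 * a6 E in
  let b8 := a1 E ^+ 2 * a6 E + 4 * a2 E * a6 E - a1 E * a3 E * a4 E
            + a2 E * a3 E ^+ 2 - a4 E ^+ 2 in
  - b2 ^+ 2 * b8 - 8 * b4 ^+ 3 - 27 * b6 ^+ 2 + 9 * b2 * b4 * b6.

Definition elliptic : bool := disc != 0.

Definition on_curve (P : point K) : bool :=
  if P is Some (x, y) then
    y ^+ 2 + a1 E * x * y + a3 E * y
      == x ^+ 3 + a2 E * x ^+ 2 + a4 E * x + a6 E
  else true.

(* The chord-tangent law; only meaningful on points of the curve, where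
   x1 = x2 forces P = Q or P = - Q. *)
Definition ec_add (P Q : point K) : point K :=
  match P, Q with
  | None, _ => Q
  | _, None => P
  | Some (x1, y1), Some (x2, y2) =>
      if (x1 == x2) && (y1 == - y2 - a1 E * x2 - a3 E) then None else
      let l :=
        if x1 == x2 then
          (3 * x1 ^+ 2 + 2 * a2 E * x1 + a4 E - a1 E * y1)
            / (2 * y1 + a1 E * x1 + a3 E)
        else (y2 - y1) / (x2 - x1) in
      let x3 := l ^+ 2 + a1 E * l - a2 E - x1 - x2 in
      Some (x3, l * (x1 - x3) - y1 - a1 E * x3 - a3 E)
  end.

Definition ec_mul (n : nat) (P : point K) : point K :=
  iter n (ec_add P) None.

Definition point_of_order (n : nat) (P : point K) : Prop :=
  [/\ on_curve P, (0 < n)%N, ec_mul n P = None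
    & forall m : nat, (0 < m < n)%N -> ec_mul m P <> None].

End Curve.

(* Morphisms of projective plane curves over K, in terms of their action on
   L-points for all field extensions L of K: near each point they are given
   by three forms of the same degree with coefficients in K. *)
Definition hcoord (K : fieldType) (P : point K) (i : 'I_3) : K :=
  if P is Some (x, y) then [tuple x; y; 1]`_i else [tuple 0; 1; 0]`_i.

Definition forms (K : fieldType) := 'I_3 -> {mpoly K[3]}.

Definition forms_eval (K : fieldType) (F : forms K) (L : fieldType)
    (iota : {rmorphism K -> L}) (P : point L) (i : 'I_3) : L :=
  (map_mpoly iota (F i)).@[hcoord P].

Definition point_map (K : fieldType) :=
  forall L : fieldType, {rmorphism K -> L} -> point L -> point L.

Definition defined_at (K : fieldType) (F : forms K) (L : fieldType)
    (iota : {rmorphism K -> L}) (P : point L) : Prop :=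
  exists i : 'I_3, forms_eval F iota P i != 0.

(* The forms F give phi at every point of E at which they do not all
   vanish. *)
Definition represents (K : fieldType) (E : weierstrass K) (F : forms K)
    (phi : point_map K) : Prop :=
  forall (L : fieldType) (iota : {rmorphism K -> L}) (P : point L),
    on_curve (base_change iota E) P -> defined_at F iota P ->
    exists2 c : L, c != 0 &
      forall i : 'I_3, forms_eval F iota P i = c * hcoord (phi L iota P) i.

Definition morphism (K : fieldType) (E E' : weierstrass K)
    (phi : point_map K) : Prop :=
  forall (L : fieldType) (iota : {rmorphism K -> L}) (P : point L),
    on_curve (base_change iota E) P ->
    on_curve (base_change iota E') (phi L iota P) /\
    exists (d : nat) (F : forms K),
      [/\ forall i : 'I_3, F i \is d.-homog,
          represents E F phi & defined_at F iota P].

(* Isomorphic over K as elliptic curves: there is an isomorphism of curves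
   over K that takes zero to zero. *)
Definition isomorphic (K : fieldType) (E E' : weierstrass K) : Prop :=
  exists phi psi : point_map K,
    [/\ morphism E E' phi, morphism E' E psi,
        forall (L : fieldType) (iota : {rmorphism K -> L}) (P : point L),
          on_curve (base_change iota E) P ->
          psi L iota (phi L iota P) = P,
        forall (L : fieldType) (iota : {rmorphism K -> L}) (P : point L),
          on_curve (base_change iota E') P ->
          phi L iota (psi L iota P) = P
      & forall (L : fieldType) (iota : {rmorphism K -> L}),
          phi L iota None = None].

Definition is_square (K : fieldType) (x : K) : Prop :=
  exists y : K, x = y ^+ 2.

Definition one_point_of_order_2_and_point_of_order (K : fieldType)
    (E : weierstrass K) (n : nat) : Prop :=
  (exists! P : point K, point_of_order E 2 P) /\
  (exists P : point K, point_of_order E n P).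

(* The curve y^2 = f(x), for f a monic cubic. *)
Definition curve_of_cubic (K : fieldType) (f : {poly K}) : weierstrass K :=
  Weierstrass 0 f`_2 0 f`_1 f`_0.

Section Families.
Variable K : fieldType.
Implicit Types a b t : K.

Definition E4 a b : weierstrass K :=
  curve_of_cubic (('X^2 + (a ^+ 2 + 2 * b) *: 'X + (b ^+ 2)%:P) * 'X).

Definition E8 t : weierstrass K :=
  curve_of_cubic
    (('X^2
      + (2 * ((t ^+ 4 + 2 * t ^+ 2 - 1) / (t ^+ 2 - 1) ^+ 2)) *: 'X
      + 1) * 'X).

Definition E6 t : weierstrass K :=
  curve_of_cubic
    (('X^2 + (t ^+ 2 + 2 * t) *: 'X + (t ^+ 2)%:P) * ('X + 1)).

Definition E12 t : weierstrass K :=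
  curve_of_cubic
    (('X + 1) *
     ('X^2
      + (8 * t ^+ 2 * (t ^+ 2 + 1) * (t ^+ 4 + 4 * t ^+ 2 - 1)
           / (t ^+ 2 - 1) ^+ 4) *: 'X
      + (16 * t ^+ 4 * (t ^+ 2 + 1) ^+ 2 / (t ^+ 2 - 1) ^+ 4)%:P)).

Definition E10 t : weierstrass K :=
  curve_of_cubic
    (('X + 1) *
     ('X^2
      + (8 * t ^+ 2 * (t ^+ 3 + t ^+ 2 - t + 1)
           / ((t - 1) ^+ 2 * (t + 1) ^+ 4)) *: 'X
      + (16 * t ^+ 4 / ((t - 1) ^+ 2 * (t + 1) ^+ 4))%:P)).

End Families.

(* Under the conditions imposed on the parameters the members of the families
   are elliptic curves. *)
Section FamiliesElliptic.
Variable K : fieldType.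
Hypothesis charK : 2%N \notin [pchar K].
Implicit Types a b t e p q : K.

Lemma two_neq0 : (2 : K) != 0.
Proof. by apply: contra charK => h; rewrite inE /= h. Qed.

Lemma curve_quadXlinear e p q :
  curve_of_cubic (('X^2 + p *: 'X + q%:P) * ('X + e%:P)) =
    Weierstrass 0 (p + e) 0 (q + e * p) (e * q).
Proof.
rewrite /curve_of_cubic [_ * ('X + _)]mulrDr !(coefD, coefMX, coefMC).
rewrite !(coefZ, coefXn, coefX, coefC) /=.
by congr Weierstrass; ring.
Qed.

Lemma disc_quadXlinear e p q :
  disc (curve_of_cubic (('X^2 + p *: 'X + q%:P) * ('X + e%:P))) =
    2 ^+ 4 * ((e ^+ 2 - p * e + q) ^+ 2 * (p ^+ 2 - 4 * q)).
Proof. by rewrite curve_quadXlinear /disc /=; ring. Qed.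

Lemma elliptic_quadXlinear e p q :
  e ^+ 2 - p * e + q != 0 -> p ^+ 2 - 4 * q != 0 ->
  elliptic (curve_of_cubic (('X^2 + p *: 'X + q%:P) * ('X + e%:P))).
Proof.
move=> h1 h2; rewrite /elliptic disc_quadXlinear.
by rewrite !mulf_neq0 ?expf_neq0 // two_neq0.
Qed.

Lemma nonsquare_neq0 (x : K) : ~ is_square x -> x != 0.
Proof. by move=> h; apply/eqP => x0; apply: h; exists 0; rewrite x0 expr0n. Qed.

Lemma E4_elliptic a b :
  a != 0 -> b != 0 -> ~ is_square (a ^+ 2 + 4 * b) -> elliptic (E4 a b).
Proof.
move=> a0 b0 /nonsquare_neq0 h; rewrite /E4 -[X in _ * X]addr0 -polyC0.
apply: elliptic_quadXlinear.
  by rewrite expr0n mulr0 subr0 add0r expf_neq0.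
have ->: (a ^+ 2 + 2 * b) ^+ 2 - 4 * b ^+ 2 = a ^+ 2 * (a ^+ 2 + 4 * b) by ring.
by rewrite mulf_neq0 ?expf_neq0.
Qed.

Lemma E8_elliptic t :
  t \notin [:: 0; 1; -1] -> ~ is_square (2 * t ^+ 2 - 1) -> elliptic (E8 t).
Proof.
rewrite !inE !negb_or => /and3P[t0 t1 t2] /nonsquare_neq0 h.
have d0 : t ^+ 2 - 1 != 0 by rewrite subr_sqr_1 mulf_neq0 ?subr_eq0 // addr_eq0.
rewrite /E8 -[X in _ * X]addr0 -polyC0 -[X in (_ + X) * _]polyC1.
apply: elliptic_quadXlinear.
  by rewrite expr0n mulr0 subr0 add0r oner_neq0.
set p := 2 * _.
have ->: p ^+ 2 - 4 * 1
    = 2 ^+ 4 * (t ^+ 4 * (2 * t ^+ 2 - 1)) / (t ^+ 2 - 1) ^+ 4.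
  by rewrite /p; field.
by rewrite !mulf_neq0 ?invr_eq0 ?expf_neq0 // two_neq0.
Qed.

Lemma E6_elliptic t :
  t \notin [:: 0; -4; 1 / 2] -> ~ is_square (t ^+ 2 + 4 * t) ->
  elliptic (E6 t).
Proof.
rewrite !inE !negb_or => /and3P[t0 t1 t2] /nonsquare_neq0 h.
rewrite /E6 -[X in _ * (_ + X)]polyC1.
apply: elliptic_quadXlinear.
  have ->: 1 ^+ 2 - (t ^+ 2 + 2 * t) * 1 + t ^+ 2 = 2 * (1 / 2 - t).
    by field; apply: two_neq0.
  by rewrite mulf_neq0 ?two_neq0 // subr_eq0 eq_sym.
have ->: (t ^+ 2 + 2 * t) ^+ 2 - 4 * t ^+ 2 = t ^+ 2 * (t ^+ 2 + 4 * t) by ring.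
by rewrite mulf_neq0 ?expf_neq0.
Qed.

Lemma E12_elliptic t :
  t \notin [:: 0; 1; -1] -> (forall i : K, i ^+ 2 = -1 -> t \notin [:: i; - i]) ->
  ~ is_square ((t ^+ 2 + 1) * (3 * t ^+ 2 - 1)) -> 3 * t ^+ 2 + 1 != 0 ->
  elliptic (E12 t).
Proof.
rewrite !inE !negb_or => /and3P[t0 t1 t2] _ /nonsquare_neq0 h h3.
have d0 : t ^+ 2 - 1 != 0 by rewrite subr_sqr_1 mulf_neq0 ?subr_eq0 // addr_eq0.
have [i0 _] : t ^+ 2 + 1 != 0 /\ 3 * t ^+ 2 - 1 != 0.
  by apply/andP; rewrite -negb_or -mulf_eq0.
rewrite /E12 [X in curve_of_cubic X]mulrC -[X in _ * ('X + X)]polyC1.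
apply: elliptic_quadXlinear.
  set x := (X in X != 0).
  have ->: x = ((3 * t ^+ 2 + 1) * (t ^+ 2 - 1)) ^+ 2 / (t ^+ 2 - 1) ^+ 4.
    by rewrite /x; field.
  by rewrite !mulf_neq0 ?invr_eq0 ?expf_neq0 // mulf_neq0.
set x := (X in X != 0).
have ->: x = 2 ^+ 8 * (t ^+ 6 * (t ^+ 2 + 1) ^+ 2)
    * ((t ^+ 2 + 1) * (3 * t ^+ 2 - 1)) / (t ^+ 2 - 1) ^+ 8.
  by rewrite /x; field.
by do ?[exact: h | exact: two_neq0 | apply: mulf_neq0 | apply: invr_neq0
          | apply: expf_neq0].
Qed.

Lemma E10_elliptic t :
  t \notin [:: 0; 1; -1] ->
  (forall s : K, s ^+ 2 = 5 ->
     t \notin [:: (-1 + s) / 2; (-1 - s) / 2; 2 + s; 2 - s]) ->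
  ~ is_square (t * (t ^+ 2 + t - 1)) ->
  elliptic (E10 t).
Proof.
rewrite !inE !negb_or => /and3P[t0 t1 t2] h5 /nonsquare_neq0 h.
have d1 : t - 1 != 0 by rewrite subr_eq0.
have d2 : t + 1 != 0 by rewrite addr_eq0.
have h4 : t ^+ 2 - 4 * t - 1 != 0.
  apply/eqP => h4.
  have /h5 : (t - 2) ^+ 2 = 5.
    have ->: (t - 2) ^+ 2 = t ^+ 2 - 4 * t - 1 + 5 by ring.
    by rewrite h4 add0r.
  have e : 2 + (t - 2) = t by ring.
  by rewrite !inE e eqxx !orbT.
rewrite /E10 [X in curve_of_cubic X]mulrC -[X in _ * ('X + X)]polyC1.
apply: elliptic_quadXlinear.
  set x := (X in X != 0).
  have ->: x = (t ^+ 2 - 4 * t - 1) * ((t - 1) ^+ 3 * (t + 1))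
      / ((t - 1) ^+ 2 * (t + 1) ^+ 4).
    by rewrite /x; field; rewrite d1 d2.
  by do ?[apply: mulf_neq0 | apply: invr_neq0 | apply: expf_neq0].
set x := (X in X != 0).
have ->: x = 2 ^+ 8 * t ^+ 4 * (t * (t ^+ 2 + t - 1))
    / ((t - 1) ^+ 4 * (t + 1) ^+ 8).
  by rewrite /x; field; rewrite d1 d2.
by do ?[exact: h | exact: two_neq0 | apply: mulf_neq0 | apply: invr_neq0
          | apply: expf_neq0].
Qed.

End FamiliesElliptic.

(* Main.v *)
(* An isomorphism of pointed Weierstrass curves is a substitution
   (x, y) |-> (u^2 x + r, u^3 y + s x + t): at the generic point its coordinates
   are functions regular at every affine point, hence polynomials in x and y.
   By the Weierstrass equation their pole orders at infinity are 2 k and 3 k, and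
   since x and y are in turn polynomials in these coordinates, k divides 2 and 3.
   The group law is associative because sending a point to the class of its
   maximal ideal in the coordinate ring turns the chord-tangent law into the
   product of ideal classes, and this map is injective: the pole orders of the
   elements of such an ideal determine the point.
   A curve with exactly one point of order 2 is, up to isomorphism,
   y^2 = x (x^2 + p x + q) with p^2 - 4 q not a square.  A point of order 3 or 5
   determines p and q in terms of slopes of its tangents, and a point of order 4
   doubles to (0, 0), so that q is a square and p is determined by its slope; for
   the orders 8 and 12 one quadratic condition is left, which is parametrized
   rationally. *)
Require Import Defs.
From Stdlib Require Import Classical FunctionalExtensionality PropExtensionality.
From mathcomp Require Import all_boot all_order all_algebra all_field.
From mathcomp Require Import zify ring.
From mathcomp.multinomials Require Import mpoly.

Set Implicit Arguments.
Unset Strict Implicit.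
Unset Printing Implicit Defensive.

Import GRing.Theory.
Local Open Scope ring_scope.

(** An isomorphism is given as a bare map on points, described by forms only near each point, so
    everything algebraic has to come from evaluation. As it acts over every extension of [K], it can
    be evaluated at the tautological point over the function field, and identities found there
    specialize to all points. Passing from local quotients of forms to polynomials needs a
    Nullstellensatz; its zeros are found in finite extensions built for the ideal at hand, so no
    algebraic closure occurs. Places and divisors are replaced by one device: the pole order at
    infinity of [A + B y], with [A] and [B] in [K[x]], is the degree of its norm. The orders of [A]
    and of [B y] differ in parity, so they never cancel, and norms are multiplicative. The group law
    is studied for [a1 = a3 = 0] only, which is enough in characteristic other than 2. With a point
    of order 2 at the origin, the abscissa of a double is a square. Its root supplies the parameter
    for order 5 and the scaling for order 8; for order 3 the tangent at a flex plays this part. *)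

(** * Weierstrass substitutions *)

(* The curve which the substitution (x, y) |-> (u^2 x + r, u^3 y + s x + t) maps
   onto [E]. *)
Definition wpull (K : fieldType) (u r s t : K) (E : weierstrass K) :
    weierstrass K :=
  Weierstrass
    ((2 * s + a1 E * u ^+ 2) / u ^+ 3)
    ((a2 E * u ^+ 4 + 3 * u ^+ 4 * r - s ^+ 2 - a1 E * u ^+ 2 * s) / u ^+ 6)
    ((2 * t + a1 E * r + a3 E) / u ^+ 3)
    ((a4 E * u ^+ 2 + 3 * u ^+ 2 * r ^+ 2 + 2 * a2 E * u ^+ 2 * r
      - 2 * s * t - a1 E * (u ^+ 2 * t + r * s) - a3 E * s) / u ^+ 6)
    ((a6 E + a4 E * r + a2 E * r ^+ 2 + r ^+ 3 - t ^+ 2 - a1 E * r * t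
      - a3 E * t) / u ^+ 6).

Definition wmap (K : fieldType) (u r s t : K) (P : point K) : point K :=
  if P is Some (x, y) then Some (u ^+ 2 * x + r, u ^+ 3 * y + s * x + t)
  else None.

Section Addition.
Variables (K : fieldType) (E : weierstrass K).

(** The value of [ec_add] away from opposite points depends on the points only through the slope,
    [(x1, y1)] and [x2]; tangents and secants thus share the later computations. *)
Definition chord (l x1 y1 x2 : K) : point K :=
  let x3 := l ^+ 2 + a1 E * l - a2 E - x1 - x2 in
  Some (x3, l * (x1 - x3) - y1 - a1 E * x3 - a3 E).

Lemma ec_add_opp x y1 y2 :
  y1 = - y2 - a1 E * x - a3 E -> ec_add E (Some (x, y1)) (Some (x, y2)) = None.
Proof. by move=> e; rewrite /= eqxx /= e eqxx. Qed.

Lemma ec_add_tangent x y : 2 * y + a1 E * x + a3 E != 0 ->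
  ec_add E (Some (x, y)) (Some (x, y)) =
    chord ((3 * x ^+ 2 + 2 * a2 E * x + a4 E - a1 E * y)
             / (2 * y + a1 E * x + a3 E)) x y x.
Proof.
move=> d0; rewrite /= eqxx /=; case: eqP => // e.
by case/eqP: d0; rewrite mulr2n mulrDl mul1r {1}e; ring.
Qed.

Lemma ec_add_secant x1 y1 x2 y2 : x1 != x2 ->
  ec_add E (Some (x1, y1)) (Some (x2, y2)) =
    chord ((y2 - y1) / (x2 - x1)) x1 y1 x2.
Proof. by move=> /negPf ne; rewrite /= ne. Qed.

(** Over a fixed abscissa the Weierstrass equation is quadratic in the ordinate, with roots [y2] and
    [- y2 - a1 E * x2 - a3 E]. *)
Lemma ec_add_cases x1 y1 x2 y2 :
  on_curve E (Some (x1, y1)) -> on_curve E (Some (x2, y2)) ->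
  [\/ x1 = x2 /\ y1 = - y2 - a1 E * x2 - a3 E,
      [/\ x1 = x2, y1 = y2 & 2 * y1 + a1 E * x1 + a3 E != 0]
    | x1 != x2].
Proof.
rewrite /= => /eqP e1 /eqP e2; case: (eqVneq x1 x2) => [ex|]; last by constructor 3.
case: (eqVneq y1 (- y2 - a1 E * x2 - a3 E)) => [|ny]; first by constructor 1.
have ey : y1 = y2.
  have : (y1 - y2) * (y1 - (- y2 - a1 E * x2 - a3 E)) = 0.
    have -> : (y1 - y2) * (y1 - (- y2 - a1 E * x2 - a3 E)) =
      (y1 ^+ 2 + a1 E * x1 * y1 + a3 E * y1)
      - (y2 ^+ 2 + a1 E * x2 * y2 + a3 E * y2) by rewrite ex; ring.
    by rewrite e1 e2 ex subrr.
  by move=> /eqP; rewrite mulf_eq0 !subr_eq0 (negPf ny) orbF => /eqP.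
constructor 2; split=> //; apply: contraNneq ny => z.
by rewrite -subr_eq0 -z ex ey; apply/eqP; ring.
Qed.

End Addition.

Section Change.
Variables (K : fieldType) (u r s t : K).
Hypothesis u0 : u != 0.
Implicit Types (E : weierstrass K) (P Q : point K).

Lemma wpull_wpull E u' r' s' t' : u' != 0 ->
  wpull u' r' s' t' (wpull u r s t E) =
  wpull (u * u') (u ^+ 2 * r' + r) (u ^+ 3 * s' + s * u' ^+ 2)
    (u ^+ 3 * t' + s * r' + t) E.
Proof.
by move=> u'0; rewrite /wpull /=; congr Weierstrass; field; rewrite u0 u'0.
Qed.

Lemma wpull1 E : wpull 1 0 0 0 E = E.
Proof. by case: E => *; rewrite /wpull /=; congr Weierstrass; field; rewrite oner_neq0. Qed.

(** Solving the substitution for the old coordinates gives these four coefficients. *)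
Lemma wpullK E :
  wpull u^-1 (- r / u ^+ 2) (- s / u ^+ 5) ((r * s - t * u ^+ 2) / u ^+ 5)
    (wpull u r s t E) = E.
Proof.
rewrite wpull_wpull ?invr_eq0 // -[RHS]wpull1 mulfV //.
by congr wpull; field.
Qed.

Lemma wmapK : cancel (wmap u r s t)
  (wmap u^-1 (- r / u ^+ 2) (- s / u ^+ 5) ((r * s - t * u ^+ 2) / u ^+ 5)).
Proof. by case=> [[x y]|] //=; congr (Some (_, _)); field. Qed.

Lemma wmapVK : cancel
  (wmap u^-1 (- r / u ^+ 2) (- s / u ^+ 5) ((r * s - t * u ^+ 2) / u ^+ 5))
  (wmap u r s t).
Proof. by case=> [[x y]|] //=; congr (Some (_, _)); field. Qed.

Lemma wmap_inj : injective (wmap u r s t).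
Proof. exact: can_inj wmapK. Qed.

Lemma on_curve_wmap E P :
  on_curve E (wmap u r s t P) = on_curve (wpull u r s t E) P.
Proof.
case: P => [[x y]|] //=.
rewrite -[LHS]subr_eq0 -[RHS]subr_eq0.
set lhs := (X in X == 0); set rhs := (X in _ = (X == 0)).
have -> : lhs = u ^+ 6 * rhs by rewrite /lhs /rhs; field.
by rewrite mulf_eq0 expf_eq0 (negPf u0).
Qed.

(** Ordinates are stretched by [u ^+ 3] and sheared by [s], abscissas stretched by [u ^+ 2], so a
    slope [l] becomes [(u ^+ 3 * l + s) / u ^+ 2]. *)
Lemma wmap_chord E l x1 y1 x2 :
  wmap u r s t (chord (wpull u r s t E) l x1 y1 x2) =
  chord E (u * l + s / u ^+ 2) (u ^+ 2 * x1 + r) (u ^+ 3 * y1 + s * x1 + t)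
    (u ^+ 2 * x2 + r).
Proof. by rewrite /chord /=; congr (Some (_, _)); field. Qed.

Lemma wmap_add E P Q :
  on_curve (wpull u r s t E) P -> on_curve (wpull u r s t E) Q ->
  wmap u r s t (ec_add (wpull u r s t E) P Q) =
  ec_add E (wmap u r s t P) (wmap u r s t Q).
Proof.
case: P => [[x1 y1]|] //; case: Q => [[x2 y2]|] // onP onQ.
have wE x y : wmap u r s t (Some (x, y)) =
  Some (u ^+ 2 * x + r, u ^+ 3 * y + s * x + t) by [].
case: (ec_add_cases onP onQ) => [[-> e]|[<- <- d0]|ne].
- by rewrite !wE !ec_add_opp //= e /=; field.
- have d1 : 2 * (u ^+ 3 * y1 + s * x1 + t) + a1 E * (u ^+ 2 * x1 + r) + a3 E
      = u ^+ 3 * (2 * y1 + a1 (wpull u r s t E) * x1 + a3 (wpull u r s t E)).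
    by rewrite /=; field.
  rewrite ec_add_tangent // wmap_chord !wE ec_add_tangent; last first.
    by rewrite d1 mulf_neq0 ?expf_neq0.
  congr chord; rewrite d1.
  set d := (X in X != 0) in d0; rewrite -/d.
  have -> : a1 E = (a1 (wpull u r s t E) * u ^+ 3 - 2 * s) / u ^+ 2.
    by rewrite /=; field.
  apply: (mulIf (mulf_neq0 (expf_neq0 3 u0) d0)); rewrite divfK ?mulf_neq0 ?expf_neq0 //.
  set n := (X in u * (X / d) + _).
  have -> : (u * (n / d) + s / u ^+ 2) * (u ^+ 3 * d) = u ^+ 4 * n + u * s * d.
    by field; rewrite u0.
  by rewrite /n /d /=; field.
- rewrite ec_add_secant // wmap_chord !wE ec_add_secant; last first.
    by rewrite (inj_eq (addIr _)) (inj_eq (mulfI _)) ?expf_neq0.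
  congr chord; have h : x2 - x1 != 0 by rewrite subr_eq0 eq_sym.
  have e : u ^+ 2 * x2 + r - (u ^+ 2 * x1 + r) = u ^+ 2 * (x2 - x1) by ring.
  by rewrite e; field; rewrite u0 h.
Qed.

End Change.

(** * Substitutions are isomorphisms *)

Section Isomorphism.
Variables (K : fieldType).

Definition wpoint_map (u r s t : K) : point_map K :=
  fun L iota => wmap (iota u) (iota r) (iota s) (iota t).

Lemma base_change_wpull (u r s t : K) E (L : fieldType) (iota : {rmorphism K -> L}) :
  base_change iota (wpull u r s t E) =
  wpull (iota u) (iota r) (iota s) (iota t) (base_change iota E).
Proof.
rewrite /base_change /wpull /=.
by congr Weierstrass; rewrite fmorph_div; congr (_ / _);
   rewrite !(rmorph_nat, rmorphXn, rmorphB, rmorphD, rmorphM).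
Qed.

(** The substitution is linear in projective coordinates, so one triple of linear forms serves at
    every point, infinity included. *)
Lemma wpoint_map_morphism (u r s t : K) E : u != 0 ->
  morphism (wpull u r s t E) E (wpoint_map u r s t).
Proof.
move=> u0 L iota P onP; have iu0 (L' : fieldType) (j : {rmorphism K -> L'}) : j u != 0.
  by rewrite fmorph_eq0.
rewrite base_change_wpull in onP.
split; first by rewrite on_curve_wmap ?iu0.
pose X (i : nat) : {mpoly K[3]} := 'X_(inord i).
pose F : forms K := fun i => [tuple (u ^+ 2) *: X 0%N + r *: X 2%N;
   (u ^+ 3) *: X 1%N + s *: X 0%N + t *: X 2%N; X 2%N]`_i.
have evF (L' : fieldType) (j : {rmorphism K -> L'}) Q i : forms_eval F j Q i =
   [tuple j u ^+ 2 * hcoord Q (inord 0) + j r * hcoord Q (inord 2);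
    j u ^+ 3 * hcoord Q (inord 1) + j s * hcoord Q (inord 0) + j t * hcoord Q (inord 2);
    hcoord Q (inord 2)]`_i.
  have eX i' : (map_mpoly j (X i')).@[hcoord Q] = hcoord Q (inord i').
    by rewrite /X map_mpolyX mevalXU.
  have eZ a p : (map_mpoly j (a *: p)).@[hcoord Q] = j a * (map_mpoly j p).@[hcoord Q].
    by rewrite map_mpolyZ mevalZ.
  case: i => [[|[|[|i]]] hi] //; rewrite /forms_eval /F /=;
  by rewrite ?rmorphD ?mevalD /= ?eZ ?eX ?rmorphXn.
have repF (L' : fieldType) (j : {rmorphism K -> L'}) Q : exists2 k : L', k != 0 &
    forall i, forms_eval F j Q i = k * hcoord (wpoint_map u r s t j Q) i.
  (* The forms send [(0 : 1 : 0)] to [(0 : u ^+ 3 : 0)], hence the scalar at infinity. *)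
  exists (if Q is Some _ then 1 else j u ^+ 3).
    by case: (Q) => [_|]; rewrite ?oner_neq0 ?expf_neq0 ?iu0.
  move=> i; rewrite evF; case: Q => [[x y]|] /=; rewrite !inordK //;
    by case: i => [[|[|[|i]]] hi] //=; ring.
exists 1%N, F; split=> [i|M j Q onQ _|].
- have hX m : X m \is 1.-homog by rewrite dhomogX /= mdeg1.
  by rewrite /F; case: i => [[|[|[|n]]] hi] //=; rewrite ?rpredD ?rpredZ ?hX //.
- exact: repF.
have [k k0 e] := repF _ iota P; case: P onP e => [[x y]|] _ e.
  by exists (@Ordinal 3 2 isT); rewrite e mulr1.
by exists (@Ordinal 3 1 isT); rewrite e mulr1.
Qed.

Lemma wpull_isomorphic (u r s t : K) E : u != 0 ->
  isomorphic (wpull u r s t E) E.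
Proof.
move=> u0.
exists (wpoint_map u r s t),
  (wpoint_map u^-1 (- r / u ^+ 2) (- s / u ^+ 5) ((r * s - t * u ^+ 2) / u ^+ 5)).
have iE (L : fieldType) (iota : {rmorphism K -> L}) :
    wpoint_map u^-1 (- r / u ^+ 2) (- s / u ^+ 5) ((r * s - t * u ^+ 2) / u ^+ 5) iota =
    wmap (iota u)^-1 (- iota r / iota u ^+ 2) (- iota s / iota u ^+ 5)
      ((iota r * iota s - iota t * iota u ^+ 2) / iota u ^+ 5).
  rewrite /wpoint_map !fmorph_div fmorphV.
  by rewrite !(rmorphN, rmorphB, rmorphM, rmorphXn).
split=> //.
- exact: wpoint_map_morphism.
- have uV : u^-1 != 0 by rewrite invr_eq0.
  have := @wpoint_map_morphism u^-1 (- r / u ^+ 2) (- s / u ^+ 5)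
    ((r * s - t * u ^+ 2) / u ^+ 5) (wpull u r s t E) uV.
  by rewrite wpullK.
- by move=> L iota P _; rewrite iE wmapK // fmorph_eq0.
- by move=> L iota P _; rewrite iE [LHS]wmapVK // fmorph_eq0.
Qed.

End Isomorphism.

(** * The function field *)

Section CoordinateNorm.
Variables (K : fieldType) (E : weierstrass K).
Implicit Types A B : {poly K}.

Definition lin : {poly K} := (a1 E)%:P * 'X + (a3 E)%:P.
Definition cub : {poly K} :=
  'X^3 + (a2 E)%:P * 'X^2 + (a4 E)%:P * 'X + (a6 E)%:P.

(* The norm of A + B y over K(x). *)
Definition cnorm A B : {poly K} := A ^+ 2 - lin * A * B - cub * B ^+ 2.

Lemma size_lin : (size lin <= 2)%N.
Proof.
apply: leq_trans (size_polyD _ _) _; rewrite geq_max size_polyC.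
rewrite (leq_trans (size_polyMleq _ _)) ?size_polyC ?size_polyX /=.
  by case: (_ != 0).
by case: (_ != 0).
Qed.

Lemma size_cub : size cub = 4%N.
Proof.
rewrite /cub -!addrA size_polyDl size_polyXn // ltnS.
apply/leq_sizeP => j hj; rewrite !coefD !coefCM coefXn coefX coefC.
by move: j hj => [|[|[|j]]] //= _; rewrite !mulr0 !addr0.
Qed.

Lemma size_sqr (A : {poly K}) : size (A ^+ 2) = (size A + size A).-1.
Proof.
have [->|A0] := eqVneq A 0; first by rewrite expr0n /= size_poly0.
by rewrite expr2 size_mul.
Qed.

(** The degrees of [A ^+ 2] and [cub * B ^+ 2] have different parity, so the two never cancel, and
    the mixed term stays below the larger of them. *)
Lemma size_cnorm A B :
  size (cnorm A B) =
    if (size B + 1 < size A)%N then (size A + size A).-1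
    else if B == 0 then (A != 0) : nat else (size B + size B + 2)%N.
Proof.
have s1 : (size (lin * A * B)%R <= size A + size B)%N.
  apply: leq_trans (size_polyMleq _ _) _.
  by have := size_polyMleq lin A; have := size_lin; lia.
have s2 : (size (cub * B ^+ 2)%R <= size B + size B + 2)%N.
  have [->|B0] := eqVneq B 0; first by rewrite expr0n mulr0 size_poly0.
  have sB : (0 < size B)%N by rewrite size_poly_gt0.
  by apply: leq_trans (size_polyMleq _ _) _; rewrite size_sqr size_cub; lia.
have [hAB|hAB] := ltnP.
  have h1 : (size (lin * A * B)%R < (size A + size A).-1)%N by lia.
  have h2 : (size (cub * B ^+ 2)%R < (size A + size A).-1)%N by lia.
  rewrite /cnorm -addrA size_polyDl size_sqr //.
  apply: leq_ltn_trans (size_polyD _ _) _; rewrite !size_polyN gtn_max.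
  by rewrite h1 h2.
have [B0|B0] := eqVneq B 0.
  move: hAB; rewrite /cnorm B0 size_poly0 expr0n !mulr0 !subr0 size_sqr.
  by rewrite -size_poly_gt0; lia.
have sB : (0 < size B)%N by rewrite size_poly_gt0.
have c0 : cub != 0 by rewrite -size_poly_gt0 size_cub.
have s3 : size (cub * B ^+ 2)%R = (size B + size B + 2)%N.
  by rewrite size_mul ?expf_neq0 // size_sqr size_cub; lia.
have h1 : (size (lin * A * B)%R < size B + size B + 2)%N by lia.
have h2 : ((size A + size A).-1 < size B + size B + 2)%N by lia.
rewrite /cnorm addrC size_polyDl size_polyN s3 //.
apply: leq_ltn_trans (size_polyD _ _) _; rewrite size_polyN gtn_max size_sqr.
by rewrite h1 h2.
Qed.

Lemma cnorm_eq0 A B : cnorm A B = 0 -> A = 0 /\ B = 0.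
Proof.
move=> /(congr1 (fun p : {poly K} => size p)); rewrite size_poly0 size_cnorm.
case: ltnP => h; first by lia.
have [->|B0] := eqVneq B 0; last by lia.
by have [->|//] := eqVneq A 0.
Qed.

End CoordinateNorm.

Lemma quadratic_root_frac (F : fieldType) (a d l c : F) :
  d != 0 -> (a / d) ^+ 2 + l * (a / d) - c = 0 ->
  a ^+ 2 - l * a * - d - c * (- d) ^+ 2 = 0.
Proof.
by move=> d0 h; rewrite -[RHS](mulr0 (d ^+ 2)) -h; field.
Qed.

(** An interface hiding the construction: a quadratic extension of [K(x)] is used below only through
    these properties. *)
Record function_field (K : fieldType) (E : weierstrass K) := FunctionField {
  ff : fieldType;
  cst : {rmorphism {poly K} -> ff};
  eta : ff;
  cst_inj : injective cst;
  eta_eq : eta ^+ 2 + cst (lin E) * eta = cst (cub E);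
  ff_frac : forall v, exists A B D,
    D != 0 /\ v * cst D = cst A + cst B * eta }.

Lemma quadratic_extension (F : fieldType) (l c : F) :
  (forall v, v ^+ 2 + l * v - c != 0) ->
  exists (L : fieldType) (iota : {rmorphism F -> L}) (z : L),
    z ^+ 2 + iota l * z = iota c /\
    forall v, exists a b, v = iota a + iota b * z.
Proof.
move=> noroot; pose h : {poly F} := 'X^2 + l%:P * 'X - c%:P.
have szh : size h = 3%N.
  rewrite /h -addrA size_polyDl size_polyXn // ltnS.
  apply/leq_sizeP => j hj; rewrite coefB coefCM coefX coefC.
  by move: j hj => [|[|j]] //= _; rewrite mulr0 subr0.
have irr : irreducible_poly h.
  apply: cubic_irreducible; first by rewrite szh.
  move=> v; apply: contraNN (noroot v) => /eqP.
  by rewrite !(hornerD, hornerN, hornerM, hornerXn, hornerC, hornerX) => ->.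
have [L dimL [z rz zL]] := irredp_FAdjoin irr.
exists L, (in_alg L), z; split.
  move: rz; rewrite /root /h rmorphB rmorphD /= map_polyXn.
  rewrite [map_poly _ (_ * _)]rmorphM /= map_polyX !map_polyC.
  rewrite !(hornerD, hornerN, hornerM, hornerXn, hornerC, hornerX) => /eqP e.
  by apply/eqP; rewrite -subr_eq0 e.
move=> v; have /Fadjoin1_polyP[q ->] : v \in <<1; z>>%VS by rewrite zL memvf.
pose r := q %% h; exists r`_0, r`_1.
have szr : (size r <= 2)%N.
  by rewrite -ltnS -szh ltn_modp -size_poly_gt0 szh.
rewrite {1}(divp_eq q h) rmorphD rmorphM hornerD hornerM (eqP rz) mulr0.
rewrite add0r -/r (horner_coef_wide _ (n := 2)) ?size_map_poly //.
by rewrite !big_ord_recl big_ord0 !coef_map /= expr0 expr1 mulr1 addr0.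
Qed.

Lemma fracP (R : idomainType) (v : {fraction R}) :
  exists A D, D != 0 /\ v = tofrac A / tofrac D.
Proof.
elim/quotW: v => x; exists (frac x).1, (frac x).2.
have d0 := denom_ratioP x; split=> //.
rewrite -[LHS](@mulfK _ (tofrac (frac x).2)) ?tofrac_eq0 //; congr (_ / _).
rewrite !piE; apply/eqmodP; rewrite /= FracField.equivfE /FracField.mulf.
by rewrite !numden_Ratio ?mulf_neq0 ?oner_neq0 // !mulr1 mulrC.
Qed.

Lemma add_frac (F : fieldType) (a b c d z : F) :
  c != 0 -> d != 0 -> (a / c + b / d * z) * (c * d) = a * d + b * c * z.
Proof. by move=> c0 d0; field; rewrite d0 c0. Qed.

(** The Weierstrass equation has no root in [K(x)]: a root [A / D] would make the norm of [A - D y]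
    vanish, against [cnorm_eq0]. *)
Lemma function_field_exists (K : fieldType) (E : weierstrass K) :
  inhabited (function_field E).
Proof.
have [|L [iota [z [zE zP]]]] :=
    @quadratic_extension {fraction {poly K}} (tofrac (lin E)) (tofrac (cub E)).
  move=> v; apply/eqP; have [A [D [D0 ->]]] := fracP v => hv.
  have d0 : tofrac D != 0 by rewrite tofrac_eq0.
  have /eqP : tofrac (cnorm E A (- D)) = 0.
    rewrite /cnorm !(rmorphB, rmorphM, rmorphXn, rmorphN).
    exact: quadratic_root_frac d0 hv.
  rewrite tofrac_eq0 => /eqP/cnorm_eq0[_ /eqP]; rewrite oppr_eq0.
  by rewrite (negPf D0).
constructor; pose c : {rmorphism {poly K} -> L} := iota \o (@tofrac {poly K}).
have c_inj : injective c.
  by move=> A B /(fmorph_inj iota)/eqP; rewrite tofrac_eq => /eqP.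
apply: (FunctionField c_inj zE) => v.
have [a [b ->]] := zP v.
have [A [C [C0 ->]]] := fracP a; have [B [D [D0 ->]]] := fracP b.
exists (A * D), (B * C), (C * D); split; first by rewrite mulf_neq0.
have e P Q : iota (tofrac P / tofrac Q) = c P / c Q by rewrite fmorph_div.
have nz P : P != 0 -> c P != 0 by rewrite -(inj_eq c_inj) rmorph0.
by rewrite !e !(rmorphM c); apply: add_frac; apply: nz.
Qed.

(** * Common zeros of proper ideals *)

Section Ideals.

Definition ideal (R : pzRingType) (I : R -> Prop) : Prop :=
  [/\ I 0, forall g h, I g -> I h -> I (g + h) & forall g h, I h -> I (g * h)].

Lemma min_nat (P : nat -> Prop) :
  (exists n, P n) -> exists2 n, P n & forall m, P m -> (n <= m)%N.
Proof.
case=> n; elim/ltn_ind: n => n ih hn.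
have [[m [lt_mn Pm]]|none] := classic (exists m, (m < n)%N /\ P m).
  exact: ih Pm.
exists n => // m Pm; rewrite leqNgt; apply/negP => lt; apply: none.
by exists m.
Qed.

Lemma ideal_generator (F : fieldType) (I : {poly F} -> Prop) :
  ideal I -> ~ I 1 -> (exists2 g : {poly F}, g != 0 & I g) ->
  exists p : {poly F}, [/\ (1 < size p)%N, I p & forall g, I g -> p %| g].
Proof.
case=> I0 ID IM I1 [g g0 Ig].
have [] := @min_nat (fun n => exists h : {poly F}, [/\ h != 0, I h & size h = n]).
  by exists (size g), g.
move=> n [p [p0 Ip sp]] min; exists p; split=> // [|h Ih].
  rewrite ltnNge; apply/negP => /size1_polyC pE; apply: I1.
  have c0 : p`_0 != 0 by apply: contraNneq p0 => c0; rewrite pE c0.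
  have -> : 1 = ((p`_0)^-1)%:P * p by rewrite {2}pE -polyCM mulVf // polyC1.
  exact: IM.
rewrite /dvdp; apply/negPn/negP => r0.
have : (n <= size (h %% p)%R)%N.
  apply: min; exists (h %% p); split=> //.
  have -> : h %% p = h + (- (h %/ p)) * p.
    by rewrite {2}(divp_eq h p) mulNr addrAC subrr add0r.
  by apply: ID => //; apply: IM.
by rewrite leqNgt -sp ltn_modp p0.
Qed.

Lemma irreducible_divisor (F : fieldType) (p : {poly F}) :
  (1 < size p)%N -> exists2 q, irreducible_poly q & q %| p.
Proof.
move: {2}(size p) (leqnn (size p)) => n; elim: n p => [|n ih] p hn hp.
  by move: hn hp; case: (size p).
have [irr|red] := classic (irreducible_poly p); first by exists p.
have [q [q1 qp nq]] : exists q : {poly F}, [/\ size q != 1%N, q %| p & ~~ (q %= p)].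
  apply: NNPP => none; apply: red; split=> // q q1 qp.
  by apply/negPn/negP => nq; apply: none; exists q.
have p0 : p != 0 by rewrite -size_poly_gt0; lia.
have q0 : q != 0 by apply: contraNneq p0 => q0; move: qp; rewrite q0 dvd0p.
have lt : (size q < size p)%N.
  by rewrite ltn_neqAle dvdp_leq // andbT; move: nq; rewrite dvdp_size_eqp.
have [||r irr rq] := ih q.
- lia.
- by move: q0; rewrite -size_poly_gt0; lia.
by exists r => //; apply: dvdp_trans rq qp.
Qed.

End Ideals.

(** The outer polynomial variable stands for y, the inner one for x. *)
Definition ev2 (K L : fieldType) (iota : {rmorphism K -> L}) (x y : L) :
    {rmorphism {poly {poly K}} -> L} :=
  horner_eval y \o map_poly (horner_eval x \o map_poly iota).

(** A Nullstellensatz for two variables. The coordinate [x] is adjoined by an irreducible factor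
    [p1] of the generator of the contraction of [J] to [K[x]]; the image of [J] in polynomials over
    that field has again a generator, and an irreducible factor of it yields [y]. The nonzero [d]
    and the monic [W] keep both ideals nonzero. *)
Lemma common_zero (K : fieldType) (J : {poly {poly K}} -> Prop) :
  ideal J -> ~ J 1 -> (exists2 d : {poly K}, d != 0 & J d%:P) ->
  (exists2 W, W \is monic & J W) ->
  exists (L : fieldType) (iota : {rmorphism K -> L}) (x y : L),
    forall g, J g -> ev2 iota x y g = 0.
Proof.
case=> J0 JD JM J1 exd [W monW JW].
have [] := @ideal_generator K (fun d => J d%:P) _ J1 exd.
  split=> [//|g h|g h]; first by rewrite polyCD; apply: JD.
  by rewrite polyCM; apply: JM.
move=> p [szp Jp pmin].
have p0 : p != 0 by rewrite -size_poly_gt0; lia.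
have [p1 irr1 p1p] := irreducible_divisor szp.
have [L1 _ [z rz zL]] := irredp_FAdjoin irr1.
pose rho : {rmorphism {poly K} -> L1} := horner_eval z \o map_poly (in_alg L1).
have lift (h2 : {poly L1}) : exists h, h2 = map_poly rho h.
  elim/poly_ind: h2 => [|h2 c [h ->]]; first by exists 0; rewrite rmorph0.
  have /Fadjoin1_polyP[q ->] : c \in <<1; z>>%VS by rewrite zL memvf.
  by exists (h * 'X + q%:P); rewrite rmorphD rmorphM /= map_polyX map_polyC.
have ker a : rho a = 0 -> p1 %| a.
  move=> ra; apply/negPn; rewrite -irreducible_poly_coprime //.
  rewrite -(coprimep_map (in_alg L1)); apply/negP => /coprimep_root/(_ rz).
  by rewrite -[_.[z]]/(rho a) ra eqxx.
pose J2 g2 := exists2 g, J g & g2 = map_poly rho g.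
have idJ2 : ideal J2.
  split; first by exists 0; rewrite ?rmorph0.
    move=> _ _ [g Jg ->] [h Jh ->]; exists (g + h); rewrite ?rmorphD //.
    exact: JD.
  move=> h2 _ [g Jg ->]; have [h ->] := lift h2.
  by exists (h * g); rewrite ?rmorphM //; apply: JM.
(* If the image contained 1, some [g] in [J] would be congruent to 1 modulo [p1]. Multiplying by the
   cofactor [p2] of [p1] in [p] would put [p2] into [J], below the minimal degree. *)
have J21 : ~ J2 1.
  case=> g Jg g1; have [g' gE] : exists g', 1 - g = p1%:P * g'.
    exists (map_poly (fun a => a %/ p1) (1 - g)); apply/polyP => i.
    rewrite coefCM coef_map_id0 ?div0p // mulrC divpK //; apply: ker.
    have := congr1 (fun h : {poly L1} => h`_i) g1; rewrite coef_map => e.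
    by rewrite coefB rmorphB -e !coef1 rmorph_nat subrr.
  have [p2 pE] := dvdpP _ _ p1p.
  have Jp2 : J p2%:P.
    have -> : p2%:P = p2%:P * g + g' * p%:P.
      by rewrite pE polyCM mulrCA -mulrDr (mulrC g') -gE addrC subrK mulr1.
    by apply: JD; apply: JM.
  have p20 : p2 != 0 by apply: contraNneq p0 => p20; rewrite pE p20 mul0r.
  have := dvdp_leq p20 (pmin _ Jp2).
  case: irr1 => sp1 _; rewrite pE size_mul //; last first.
    by rewrite -size_poly_gt0; lia.
  by move: p20; rewrite -size_poly_gt0; lia.
have [|m [szm _ mmin]] := ideal_generator idJ2 J21.
  exists (map_poly rho W); last by exists W.
  by apply: monic_neq0; apply: monic_map.
have [q irrq qm] := irreducible_divisor szm.
have [L2 _ [y ry _]] := irredp_FAdjoin irrq.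
exists L2, (in_alg L2 \o in_alg L1), (in_alg L2 z), y => g Jg.
have [u gE] : exists u, map_poly rho g = u * q.
  by apply/dvdpP; apply: dvdp_trans qm (mmin _ _); exists g.
have -> : ev2 (in_alg L2 \o in_alg L1) (in_alg L2 z) y g
    = (map_poly (in_alg L2) (map_poly rho g)).[y].
  rewrite /ev2 /= /horner_eval -map_poly_comp; congr (_.[y]); apply: eq_map_poly => a /=.
  by rewrite /horner_eval map_poly_comp horner_map.
by rewrite gE rmorphM hornerM (eqP ry) mulr0.
Qed.

(** * Morphisms at the generic point *)

Section Evaluation.
Variables (K L : fieldType) (iota : {rmorphism K -> L}) (x y : L).

Lemma ev2C (A : {poly K}) : ev2 iota x y A%:P = (map_poly iota A).[x].
Proof. by rewrite /ev2 /= map_polyC /= /horner_eval hornerC. Qed.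

Lemma ev2X : ev2 iota x y 'X = y.
Proof. by rewrite /ev2 /= map_polyX /horner_eval hornerX. Qed.

Definition dehomog (p : {mpoly K[3]}) : {poly {poly K}} :=
  mmap (polyC \o polyC) (fun i : 'I_3 => [tuple 'X%:P; 'X; 1]`_i) p.

Lemma ev2_dehomog (F : forms K) i :
  ev2 iota x y (dehomog (F i)) = forms_eval F iota (Some (x, y)) i.
Proof.
have e (j : 'I_3) : ev2 iota x y [tuple 'X%:P; 'X; 1]`_j = hcoord (Some (x, y)) j.
  case: j => [[|[|[|j]]] hj] //; [|exact: ev2X|exact: rmorph1].
  by rewrite [LHS]ev2C map_polyX hornerX.
rewrite /forms_eval /dehomog /map_mpoly /mmap !rmorph_sum.
apply: eq_bigr => m _; rewrite !rmorphM; congr (_ * _).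
  by rewrite [LHS]ev2C map_polyC hornerC [RHS]mevalC.
rewrite mmap1_id [RHS]mevalX /mmap1 rmorph_prod; apply: eq_bigr => j _.
by rewrite rmorphXn -e.
Qed.

End Evaluation.

Section Weierstrass.
Variables (K : fieldType) (E : weierstrass K).

Definition weq : {poly {poly K}} := 'X^2 + (lin E)%:P * 'X - (cub E)%:P.

Lemma weq_monic : weq \is monic.
Proof.
apply/monicP; rewrite /weq /lead_coef -addrA size_polyDl size_polyXn.
  by rewrite !coefD coefN coefXn coefCM coefX coefC /= mulr0 subr0 addr0.
rewrite ltnS; apply/leq_sizeP => j hj; rewrite coefB coefCM coefX coefC.
by move: j hj => [|[|j]] //= _; rewrite mulr0 subr0.
Qed.

Lemma weq_mod g : exists A B q, g = A%:P + B%:P * 'X + weq * q.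
Proof.
elim/poly_ind: g => [|g c [A [B [q ->]]]].
  by exists 0, 0, 0; rewrite polyC0 mul0r mulr0 !addr0.
exists (B * cub E + c), (A - B * lin E), (B%:P + q * 'X).
rewrite /weq !(polyCD, polyCM, polyCN); ring.
Qed.

Variables (L : fieldType) (iota : {rmorphism K -> L}).

Lemma ev2_lin x y : ev2 iota x y (lin E)%:P = iota (a1 E) * x + iota (a3 E).
Proof.
rewrite ev2C /lin rmorphD rmorphM /= !map_polyC map_polyX.
by rewrite hornerD hornerM !hornerC hornerX.
Qed.

Lemma ev2_cub x y : ev2 iota x y (cub E)%:P =
  x ^+ 3 + iota (a2 E) * x ^+ 2 + iota (a4 E) * x + iota (a6 E).
Proof.
rewrite ev2C /cub !rmorphD /= ![map_poly _ (_%:P * _)]rmorphM /=.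
rewrite !map_polyC !map_polyXn map_polyX.
by rewrite !(hornerD, hornerM, hornerC, hornerXn, hornerX).
Qed.

Lemma ev2_weq x y :
  on_curve (base_change iota E) (Some (x, y)) = (ev2 iota x y weq == 0).
Proof.
rewrite /weq rmorphB rmorphD rmorphXn rmorphM !ev2X ev2_lin ev2_cub subr_eq0.
by congr (_ == _); rewrite /=; ring.
Qed.

End Weierstrass.

Section Generic.
Variables (K : fieldType) (E : weierstrass K) (F : function_field E).
Local Notation Om := (ff F).
Local Notation c := (cst F).
Local Notation eta := (eta F).

Lemma cst_eq0 A : (c A == 0) = (A == 0).
Proof. by rewrite -(inj_eq (@cst_inj _ _ F)) rmorph0. Qed.

Definition kgen : {rmorphism K -> Om} := c \o polyC.

Definition ev : {rmorphism {poly {poly K}} -> Om} := ev2 kgen (c 'X) eta.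

Lemma evC A : ev A%:P = c A.
Proof.
rewrite /ev ev2C; elim/poly_ind: A => [|A a ih].
  by rewrite !rmorph0 horner0.
rewrite !(rmorphD, rmorphM) /= map_polyX map_polyC.
by rewrite !(hornerD, hornerM, hornerX, hornerC) ih.
Qed.

Lemma evX : ev 'X = eta. Proof. exact: ev2X. Qed.

Lemma ev_weq : ev (weq E) = 0.
Proof.
by rewrite /weq rmorphB rmorphD rmorphXn rmorphM evX !evC eta_eq subrr.
Qed.

(** Multiplying by the conjugate, in which [eta] becomes [- lin E - eta], gives the norm. *)
Lemma cst_indep A B : c A + c B * eta = 0 -> A = 0 /\ B = 0.
Proof.
move=> h; apply: (@cnorm_eq0 _ E); apply: (@cst_inj _ _ F); rewrite rmorph0.
have -> : c (cnorm E A B) = (c A + c B * eta) * (c A - c (lin E) * c B - c B * eta).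
  rewrite /cnorm !(rmorphB, rmorphM, rmorphXn) -(eta_eq F); ring.
by rewrite h mul0r.
Qed.

Lemma ev_reduce g : exists A B, ev g = c A + c B * eta.
Proof.
have [A [B [q ->]]] := weq_mod E g; exists A, B.
by rewrite rmorphD [ev (weq E * q)]rmorphM ev_weq mul0r addr0 rmorphD rmorphM evX !evC.
Qed.

Lemma ev_eq0 g : ev g = 0 -> exists q, g = weq E * q.
Proof.
have [A [B [q ->]]] := weq_mod E g.
rewrite rmorphD [ev (weq E * q)]rmorphM ev_weq mul0r addr0 rmorphD rmorphM.
rewrite evX !evC => /cst_indep[-> ->].
by exists q; rewrite polyC0 mul0r !add0r.
Qed.

(** The kernel of [ev] is generated by [weq E]; this is how identities at the generic point
    specialize. *)
Lemma ev_eq0_at g (L : fieldType) (iota : {rmorphism K -> L}) x y :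
  on_curve (base_change iota E) (Some (x, y)) -> ev g = 0 ->
  ev2 iota x y g = 0.
Proof. by rewrite ev2_weq => /eqP h /ev_eq0[q ->]; rewrite rmorphM h mul0r. Qed.

Lemma generic_on_curve : on_curve (base_change kgen E) (Some (c 'X, eta)).
Proof. by rewrite ev2_weq [ev2 _ _ _ _]ev_weq. Qed.

(* The multipliers taking v into the coordinate ring form an ideal; if it were
   proper, it would vanish at an affine point, where v is regular. *)
Lemma regular_integral (v : Om) :
  (forall (L : fieldType) (iota : {rmorphism K -> L}) x y,
     on_curve (base_change iota E) (Some (x, y)) ->
     exists g h, ev2 iota x y g != 0 /\ ev g * v = ev h) ->
  exists g, v = ev g.
Proof.
move=> reg; pose J g := exists h, ev g * v = ev h.
have idJ : ideal J.
  split; first by exists 0; rewrite rmorph0 mul0r.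
    move=> g g' [h e] [h' e']; exists (h + h').
    by rewrite !rmorphD mulrDl e e'.
  by move=> g g' [h e]; exists (g * h); rewrite !rmorphM -mulrA e.
have [[h]|J1] := classic (J 1); first by rewrite rmorph1 mul1r => ->; exists h.
have [||L [iota [x [y zJ]]]] := common_zero idJ J1.
(* A denominator of [v] supplies the polynomial in x, and the Weierstrass equation the monic
   polynomial in y. *)
- have [A [B [D [D0 e]]]] := ff_frac v; exists D => //.
  exists (A%:P + B%:P * 'X).
  by rewrite rmorphD rmorphM evX !evC mulrC.
- exists (weq E); first exact: weq_monic.
  by exists 0; rewrite ev_weq mul0r rmorph0.
have [|g [h [g0 e]]] := reg L iota x y.
  by rewrite ev2_weq zJ //; exists 0; rewrite ev_weq mul0r rmorph0.
by move: g0; rewrite zJ ?eqxx //; exists h.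
Qed.

End Generic.

Definition affine_map (K : fieldType) (E : weierstrass K) (phi : point_map K)
    (gX gY : {poly {poly K}}) : Prop :=
  forall (L : fieldType) (iota : {rmorphism K -> L}) x y,
    on_curve (base_change iota E) (Some (x, y)) ->
    phi L iota (Some (x, y)) = Some (ev2 iota x y gX, ev2 iota x y gY).

(** The forms valid near an affine point also express the image of the generic point as a quotient,
    which makes its coordinates regular at that point; [regular_integral] then turns them into
    polynomials. *)
Lemma morphism_affine (K : fieldType) (E E' : weierstrass K) (phi : point_map K) :
  morphism E E' phi ->
  (forall (L : fieldType) (iota : {rmorphism K -> L}) x y,
     on_curve (base_change iota E) (Some (x, y)) ->
     phi L iota (Some (x, y)) <> None) ->
  exists gX gY, affine_map E phi gX gY.
Proof.
move=> mphi aff; have [F] := function_field_exists E.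
have := aff _ _ _ _ (generic_on_curve F).
case ePhi : (phi _ _ _) => [[X Y]|] // _.
(* Forms defining phi at an affine point also define it at the generic point:
   a form vanishing at the generic point vanishes on the whole curve. *)
have loc L iota x y : on_curve (base_change iota E) (Some (x, y)) ->
    exists u v G0 G1 G2, [/\ phi L iota (Some (x, y)) = Some (u, v),
      ev2 iota x y G2 != 0,
      ev2 iota x y G0 = ev2 iota x y G2 * u /\
      ev2 iota x y G1 = ev2 iota x y G2 * v
    & ev F G2 * X = ev F G0 /\ ev F G2 * Y = ev F G1].
  move=> ony; have [_ [d [G [_ rep def]]]] := mphi _ _ _ ony.
  have := aff _ _ _ _ ony; case e : (phi _ _ _) => [[u v]|] // _.
  pose i0 := @Ordinal 3 0 isT; pose i1 := @Ordinal 3 1 isT; pose i2 := @Ordinal 3 2 isT.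
  have [k k0 ek] := rep _ _ _ ony def; rewrite e in ek.
  exists u, v, (dehomog (G i0)), (dehomog (G i1)), (dehomog (G i2)).
  have nz : ev2 iota x y (dehomog (G i2)) != 0 by rewrite ev2_dehomog ek mulr1.
  have nzg : ev F (dehomog (G i2)) != 0.
    by apply: contra_neq nz; apply: ev_eq0_at.
  have defg : defined_at G (kgen F) (Some (cst F 'X, eta F)).
    by exists i2; rewrite -ev2_dehomog.
  have [k' k'0 ek'] := rep _ _ _ (generic_on_curve F) defg; rewrite ePhi in ek'.
  split=> //; first by rewrite !ev2_dehomog !ek /= mulr1.
  by rewrite /ev !ev2_dehomog !ek' /= mulr1.
have [gX eX] : exists g, X = ev F g.
  apply: regular_integral => L iota x y /loc[u [v [G0 [G1 [G2 [_ nz _ [e _]]]]]]].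
  by exists G2, G0.
have [gY eY] : exists g, Y = ev F g.
  apply: regular_integral => L iota x y /loc[u [v [G0 [G1 [G2 [_ nz _ [_ e]]]]]]].
  by exists G2, G1.
exists gX, gY => L iota x y ony.
have [u [v [G0 [G1 [G2 [-> nz [e0 e1] [e2 e3]]]]]]] := loc _ _ _ _ ony.
(* The relations [G2 * gX = G0] and [G2 * gY = G1] hold at the generic point, hence here, where [G2]
   does not vanish. *)
have z0 : ev2 iota x y (G2 * gX - G0) = 0.
  by apply: (@ev_eq0_at _ _ F _ _ _ x y ony); rewrite rmorphB rmorphM -eX e2 subrr.
have z1 : ev2 iota x y (G2 * gY - G1) = 0.
  by apply: (@ev_eq0_at _ _ F _ _ _ x y ony); rewrite rmorphB rmorphM -eY e3 subrr.
move: z0 z1; rewrite !rmorphB !rmorphM e0 e1 => /eqP; rewrite subr_eq0 => /eqP/(mulfI nz) ->.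
by move=> /eqP; rewrite subr_eq0 => /eqP/(mulfI nz) ->.
Qed.

(** * Pole orders at infinity *)

Section PoleOrder.
Variables (K : fieldType) (E : weierstrass K) (F : function_field E).
Local Notation Om := (ff F).
Local Notation c := (cst F).
Local Notation eta := (eta F).

(* Two more than the pole order of A + B y at infinity, and 0 for the zero
   function. *)
Definition weight (A B : {poly K}) : nat :=
  maxn (2 * size A) (if B == 0 then 0%N else (2 * size B + 3)%N).

Definition pole (v : Om) (n : nat) : Prop :=
  exists A B, v = c A + c B * eta /\ weight A B = n.+2.

Definition pole_le (v : Om) (n : nat) : Prop :=
  exists A B, v = c A + c B * eta /\ (weight A B <= n.+2)%N.

(** The degree of the norm is the pole order: [weight] exceeds that order by two, and [size] exceeds
    the degree by one. *)
Lemma weight_cnorm A B : (0 < weight A B)%N ->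
  size (cnorm E A B) = (weight A B).-1.
Proof.
rewrite size_cnorm /weight; have [->|B0] := eqVneq B 0.
  rewrite size_poly0 -(size_poly_eq0 A) maxn0 add0n.
  by case: (size A) => [|[|n]] //=; lia.
have sB : (0 < size B)%N by rewrite size_poly_gt0.
by move: (size A) (size B) sB => a b; case: (ltnP (b + 1) a) => /=; lia.
Qed.

Lemma weight_eq0 A B : weight A B = 0%N -> A = 0 /\ B = 0.
Proof.
rewrite /weight; case: (eqVneq B 0) => [->|B0]; last by lia.
by rewrite maxn0 => /eqP; rewrite muln_eq0 /= size_poly_eq0 => /eqP ->.
Qed.

Lemma weight_neq1 A B : weight A B != 1%N.
Proof.
by rewrite /weight; case: (eqVneq B 0) => _; apply/eqP; move: (size A) (size B) => a b; lia.
Qed.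

Lemma weight_add A B C D :
  (weight (A + C) (B + D) <= maxn (weight A B) (weight C D))%N.
Proof.
have sA := size_polyD A C; have sB := size_polyD B D.
have eB (P : {poly K}) : (if P == 0 then 0%N else (2 * size P + 3)%N) =
    (if size P == 0 then 0 else 2 * size P + 3)%N by rewrite size_poly_eq0.
rewrite /weight !eB.
move: (size A) (size B) (size C) (size D) (size (A + C)) (size (B + D)) sA sB.
move=> a b d e f g.
by case: (eqVneq b 0%N); case: (eqVneq e 0%N); case: (eqVneq g 0%N) => /=; lia.
Qed.

Lemma weightN A B : weight (- A) (- B) = weight A B.
Proof. by rewrite /weight !size_polyN oppr_eq0. Qed.

(** The arguments are the coefficients of the product after [y ^+ 2] has been reduced, and the norm
    is multiplicative. *)
Lemma weight_mul A B C D : (0 < weight A B)%N -> (0 < weight C D)%N ->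
  (weight (A * C + B * D * cub E) (A * D + B * C - lin E * B * D) + 2
   = weight A B + weight C D)%N.
Proof.
move=> h1 h2.
have eN : cnorm E (A * C + B * D * cub E) (A * D + B * C - lin E * B * D) =
    cnorm E A B * cnorm E C D by rewrite /cnorm; ring.
have n1 : cnorm E A B != 0.
  by apply: contraTneq h1 => /cnorm_eq0[-> ->]; rewrite /weight size_poly0 eqxx.
have n2 : cnorm E C D != 0.
  by apply: contraTneq h2 => /cnorm_eq0[-> ->]; rewrite /weight size_poly0 eqxx.
have n3 : (0 < weight (A * C + B * D * cub E) (A * D + B * C - lin E * B * D))%N.
  rewrite lt0n; apply/eqP => /weight_eq0[z1 z2].
  by move: (mulf_neq0 n1 n2); rewrite -eN z1 z2 /cnorm expr0n !mulr0 !subr0 eqxx.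
have := congr1 (fun P : {poly K} => size P) eN.
rewrite size_mul // !weight_cnorm //.
have := weight_neq1 A B; have := weight_neq1 C D.
set w := weight (_ + _) _ in n3 *.
move: (weight A B) (weight C D) w h1 h2 n3 => a b w; lia.
Qed.

Lemma pole_pole_le v n : pole v n -> pole_le v n.
Proof. by case=> A [B [-> e]]; exists A, B; rewrite e. Qed.

Lemma pole_leW v m n : (m <= n)%N -> pole_le v m -> pole_le v n.
Proof. by move=> h [A [B [-> e]]]; exists A, B; split=> //; lia. Qed.

Lemma pole_le_cst a : pole_le (kgen F a) 0.
Proof.
exists a%:P, 0; rewrite rmorph0 mul0r addr0; split=> //.
by rewrite /weight eqxx size_polyC; case: (a != 0).
Qed.

Lemma pole_cst a : a != 0 -> pole (kgen F a) 0.
Proof.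
move=> a0; exists a%:P, 0; rewrite rmorph0 mul0r addr0; split=> //.
by rewrite /weight eqxx size_polyC a0.
Qed.

Lemma pole_unique v m n : pole v m -> pole_le v n -> (m <= n)%N.
Proof.
case=> A [B [-> e]] [C [D [e' h]]].
have [eA eB] : A - C = 0 /\ B - D = 0.
  by apply: (@cst_indep _ _ F); rewrite !rmorphB -[RHS](subrr (c A + c B * eta)) {2}e'; ring.
move: e h; rewrite (subr0_eq eA) (subr0_eq eB) => -> ; lia.
Qed.

Lemma pole_leD u v n : pole_le u n -> pole_le v n -> pole_le (u + v) n.
Proof.
move=> [A [B [-> e]]] [C [D [-> e']]]; exists (A + C), (B + D); split.
  by rewrite !rmorphD; ring.
by apply: leq_trans (weight_add _ _ _ _) _; rewrite geq_max e.
Qed.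

Lemma pole_leN v n : pole_le v n -> pole_le (- v) n.
Proof.
move=> [A [B [-> e]]]; exists (- A), (- B); rewrite weightN; split=> //.
by rewrite !rmorphN; ring.
Qed.

Lemma poleD u v m n : (m < n)%N -> pole u n -> pole_le v m -> pole (u + v) n.
Proof.
move=> lt [A [B [-> e]]] [C [D [-> e']]]; exists (A + C), (B + D); split.
  by rewrite !rmorphD; ring.
have := weight_add A B C D.
have := weight_add (A + C) (B + D) (- C) (- D); rewrite !addrK weightN.
move: e e'; move: (weight A B) (weight C D) (weight (A + C) (B + D)) => a b d; lia.
Qed.

Lemma poleM u v m n : pole u m -> pole v n -> pole (u * v) (m + n).
Proof.
move=> [A [B [-> e]]] [C [D [-> e']]].
exists (A * C + B * D * cub E), (A * D + B * C - lin E * B * D); split.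
  have := eta_eq F; move: (lin E) (cub E) => l q eq_eta.
  by rewrite !(rmorphB, rmorphD, rmorphM) -eq_eta; ring.
have := @weight_mul A B C D; rewrite e e' => /(_ isT isT) h.
by apply/eqP; rewrite -(eqn_add2r 2) h; apply/eqP; lia.
Qed.

Lemma pole_le0 n : pole_le 0 n.
Proof.
by exists 0, 0; rewrite !rmorph0 mul0r addr0 /weight size_poly0 eqxx.
Qed.

Lemma pole_le_pole v n : pole_le v n -> v = 0 \/ exists2 m, pole v m & (m <= n)%N.
Proof.
move=> [A [B [e h]]]; case ew: (weight A B) => [|[|m]].
- by have [eA eB] := weight_eq0 ew; left; rewrite e eA eB !rmorph0 mul0r addr0.
- by have := weight_neq1 A B; rewrite ew.
by right; exists m; [exists A, B|lia].
Qed.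

Lemma pole_leM u v m n : pole_le u m -> pole_le v n -> pole_le (u * v) (m + n).
Proof.
move=> /pole_le_pole[->|[m' pu lm]]; first by rewrite mul0r => _; apply: pole_le0.
move=> /pole_le_pole[->|[n' pv ln]]; first by rewrite mulr0; apply: pole_le0.
by apply: pole_leW (pole_pole_le (poleM pu pv)); lia.
Qed.

(** The exact order is claimed for positive [n] only, because the zero function has no order and
    receives the bound 0. *)
Lemma pole_ev g : exists n, pole_le (ev F g) n /\ ((0 < n)%N -> pole (ev F g) n).
Proof.
have [A [B ->]] := ev_reduce F g; case ew: (weight A B) => [|[|m]].
- by exists 0%N; split=> //; exists A, B; rewrite ew.
- by have := weight_neq1 A B; rewrite ew.
exists m; split; first by exists A, B; rewrite ew.
by exists A, B.
Qed.

Lemma pole_x : pole (c 'X) 2.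
Proof.
by exists 'X, 0; rewrite rmorph0 mul0r addr0 /weight size_polyX eqxx.
Qed.

Lemma pole_y : pole eta 3.
Proof.
exists 0, 1; rewrite rmorph0 rmorph1 mul1r add0r /weight size_poly0 size_poly1.
by rewrite oner_eq0.
Qed.

Lemma kgenE a : kgen F a = c a%:P. Proof. by []. Qed.

(** Here and in [pole_le3] the Riemann-Roch spaces of two and three times the point at infinity are
    determined: a summand [B y] has order at least 3. *)
Lemma pole_le2 v : pole_le v 2 -> exists a b, v = kgen F a * c 'X + kgen F b.
Proof.
move=> [A [B [-> h]]]; exists A`_1, A`_0.
have B0 : B = 0.
  apply/eqP; apply: contraTT h; rewrite /weight -size_poly_gt0 => /[dup] h.
  by case: eqP h => [->|_]; rewrite ?size_poly0 //; lia.
have sA : (size A <= 2)%N by move: h; rewrite /weight; lia.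
rewrite B0 rmorph0 mul0r addr0 !kgenE -!rmorphM -rmorphD; congr (c _).
apply/polyP => i; rewrite coefD coefCM coefX coefC.
case: i => [|[|i]] /=; rewrite ?mulr0 ?mulr1 ?add0r ?addr0 //.
by rewrite nth_default //; apply: leq_trans sA _.
Qed.

Lemma pole_le3 v : pole_le v 3 ->
  exists a b d, v = kgen F d * eta + kgen F a * c 'X + kgen F b.
Proof.
move=> [A [B [-> h]]]; exists A`_1, A`_0, B`_0.
have sA : (size A <= 2)%N by move: h; rewrite /weight; lia.
have sB : (size B <= 1)%N.
  have [->|_] := eqVneq B 0; rewrite ?size_poly0 //; move: h; rewrite /weight.
  by case: eqP => [->|_]; rewrite ?size_poly0; lia.
rewrite {1}(size1_polyC sB) addrC -addrA; congr (_ + _).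
rewrite !kgenE -!rmorphM -rmorphD; congr (c _).
apply/polyP => i; rewrite coefD coefCM coefX coefC.
case: i => [|[|i]] /=; rewrite ?mulr0 ?mulr1 ?add0r ?addr0 //.
by rewrite nth_default //; apply: leq_trans sA _.
Qed.

End PoleOrder.

Lemma cubic_eq0 (K : fieldType) (p0 p1 p2 p3 : K) :
  p0%:P + p1%:P * 'X + p2%:P * 'X^2 + p3%:P * 'X^3 = 0 ->
  [/\ p0 = 0, p1 = 0, p2 = 0 & p3 = 0].
Proof.
move=> h; have e i : (p0%:P + p1%:P * 'X + p2%:P * 'X^2 + p3%:P * 'X^3)`_i = 0.
  by rewrite h coef0.
split; [move: (e 0%N)|move: (e 1%N)|move: (e 2%N)|move: (e 3%N)];
  by rewrite !coefD !coefCM !coefXn coefX coefC /= !(mulr0, mulr1, addr0, add0r).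
Qed.

(** * Isomorphisms are substitutions *)

Section Linear.
Variables (K : fieldType) (E E' : weierstrass K) (F : function_field E).
Local Notation Om := (ff F).
Local Notation c := (cst F).
Local Notation eta := (eta F).
Local Notation k := (kgen F).
Variables (X Y : Om) (gX gY hX hY : {poly {poly K}}).
Hypothesis eX : X = ev F gX.
Hypothesis eY : Y = ev F gY.
Hypothesis onXY : on_curve (base_change k E') (Some (X, Y)).
Hypothesis exi : c 'X = ev2 k X Y hX.
Hypothesis eeta : eta = ev2 k X Y hY.

Lemma pole_unique_eq (v : Om) m n : pole v m -> pole v n -> m = n.
Proof.
move=> pm pn; apply/eqP; rewrite eqn_leq.
by rewrite (pole_unique pm (pole_pole_le pn)) (pole_unique pn (pole_pole_le pm)).
Qed.

Lemma pole_le_horner m (A : {poly K}) :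
  pole_le X m -> pole_le (map_poly k A).[X] (m * (size A).-1).
Proof.
move=> leX; elim/poly_ind: A => [|A a ih].
  by rewrite rmorph0 horner0; apply: pole_le0.
rewrite rmorphD rmorphM /= map_polyX map_polyC !hornerE size_MXaddC.
have [->|A0] /= := eqVneq A 0.
  rewrite rmorph0 horner0 mul0r add0r; apply: pole_leW (pole_le_cst F a).
  by case: (a == 0).
apply: pole_leD; last by apply: pole_leW (pole_le_cst F a).
apply: pole_leW (pole_leM ih leX).
by rewrite -size_poly_gt0 in A0; rewrite -mulnSr prednK.
Qed.

Lemma pole_horner m (A : {poly K}) : (0 < m)%N -> A != 0 ->
  pole X m -> pole (map_poly k A).[X] (m * (size A).-1).
Proof.
move=> m0 + pX; elim/poly_ind: A => [|A a ih]; first by rewrite eqxx.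
rewrite rmorphD rmorphM /= map_polyX map_polyC !hornerE size_MXaddC.
have [->|A0] /= := eqVneq A 0.
  rewrite rmorph0 horner0 !mul0r !add0r polyC_eq0 => a0; rewrite (negPf a0) ?size_poly0 muln0.
  exact: pole_cst.
move=> _; have sA : (0 < size A)%N by rewrite size_poly_gt0.
apply: (@poleD _ _ _ _ _ 0); last exact: pole_le_cst.
  by rewrite muln_gt0 m0.
by have := poleM (ih A0) pX; rewrite -mulnSr prednK.
Qed.

Lemma relXY : Y ^+ 2 + k (a1 E') * X * Y + k (a3 E') * Y =
  X ^+ 3 + k (a2 E') * X ^+ 2 + k (a4 E') * X + k (a6 E').
Proof. exact/eqP. Qed.

Lemma ev2_reduce h : exists A B,
  ev2 k X Y h = (map_poly k A).[X] + (map_poly k B).[X] * Y.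
Proof.
have [A [B [q ->]]] := weq_mod E' h; exists A, B.
have := onXY; rewrite ev2_weq => /eqP z.
by rewrite rmorphD [ev2 _ _ _ (weq _ * _)]rmorphM z mul0r addr0 rmorphD rmorphM ev2X !ev2C.
Qed.

Lemma pole_XY : pole X 2 /\ pole Y 3.
Proof.
have [m [leX pX]] := pole_ev F gX; rewrite -eX in leX pX.
have [n [leY pY]] := pole_ev F gY; rewrite -eY in leY pY.
have leM a u l l' : pole_le u l -> (l <= l')%N -> pole_le (k a * u) l'.
  move=> pu ll'; apply: pole_leW (pole_leM (pole_le_cst F a) pu).
  by rewrite add0n.
have leXX : pole_le (X ^+ 2) (m + m) by apply: pole_leM.
have leYY : pole_le (Y ^+ 2) (n + n) by apply: pole_leM.
have leXXX : pole_le (X ^+ 3) (m + (m + m)) by rewrite exprS; apply: pole_leM.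
have leXY : pole_le (X * Y) (m + n) by apply: pole_leM.
have le1 a l : pole_le (k a) l by apply: pole_leW (pole_le_cst F a).
(* Otherwise the pole of [Y ^+ 2] would exceed those of all other terms of the equation; [h2] is the
   same for [X ^+ 3]. *)
have h1 : (n + n <= m + (m + m))%N.
  rewrite leqNgt; apply/negP => lt; have n0 : (0 < n)%N by lia.
  have : pole (Y ^+ 2) (n + n) by apply: poleM; apply: pY.
  have -> : Y ^+ 2 = X ^+ 3 + k (a2 E') * X ^+ 2 + k (a4 E') * X + k (a6 E')
     - k (a1 E') * (X * Y) - k (a3 E') * Y by rewrite -relXY; ring.
  have le : pole_le (X ^+ 3 + k (a2 E') * X ^+ 2 + k (a4 E') * X + k (a6 E')
     - k (a1 E') * (X * Y) - k (a3 E') * Y) (n + n).-1.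
    do !apply: pole_leD; do ?apply: pole_leN; rewrite ?le1 //;
     by [apply: pole_leW leXXX; lia | apply: leM leXX _; lia | apply: leM leX _; lia
        | apply: leM leXY _; lia | apply: leM leY _; lia | exact: le1].
  by move=> /pole_unique/(_ le); lia.
have h2 : (m + (m + m) <= n + n)%N.
  rewrite leqNgt; apply/negP => lt; have m0 : (0 < m)%N by lia.
  have : pole (X ^+ 3) (m + (m + m)).
    by rewrite exprS; do 2 (apply: poleM; first exact: pX); apply: pX.
  have -> : X ^+ 3 = Y ^+ 2 + k (a1 E') * (X * Y) + k (a3 E') * Y
     - k (a2 E') * X ^+ 2 - k (a4 E') * X - k (a6 E').
    rewrite -[LHS](addrK (k (a2 E') * X ^+ 2 + k (a4 E') * X + k (a6 E'))).
    by rewrite !addrA -relXY; ring.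
  have le : pole_le (Y ^+ 2 + k (a1 E') * (X * Y) + k (a3 E') * Y
     - k (a2 E') * X ^+ 2 - k (a4 E') * X - k (a6 E')) (m + (m + m)).-1.
    do !apply: pole_leD; do ?apply: pole_leN; rewrite ?le1 //;
     by [apply: pole_leW leYY; lia | apply: leM leXX _; lia | apply: leM leX _; lia
        | apply: leM leXY _; lia | apply: leM leY _; lia | exact: le1].
  by move=> /pole_unique/(_ le); lia.
have [j [mE nE]] : exists j, m = (2 * j)%N /\ n = (3 * j)%N.
  by exists (n - m)%N; lia.
(* For [j = 0] every polynomial in [X] and [Y] would have order at most 0, but x is one of them. *)
have j0 : (0 < j)%N.
  rewrite lt0n; apply/eqP => j0; have m0 : m = 0%N by lia.
  have n0 : n = 0%N by lia.
  rewrite m0 in leX; rewrite n0 in leY.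
  have := pole_x F; rewrite exi; have [A [B ->]] := ev2_reduce hX => px.
  have lA := pole_le_horner A leX; have lB := pole_le_horner B leX.
  by have := pole_unique px (pole_leD lA (pole_leM lB leY)).
have {}pX : pole X (2 * j) by rewrite -mE; apply: pX; lia.
have {}pY : pole Y (3 * j) by rewrite -nE; apply: pY; lia.
(* In [A(X) + B(X) Y] the orders are an even and an odd multiple of [j], so the larger one
   survives. *)
have mult h : ev2 k X Y h = 0 \/ exists i, pole (ev2 k X Y h) (i * j).
  have [A [B ->]] := ev2_reduce h.
  have j2 : (0 < 2 * j)%N by lia.
  have [->|A0] := eqVneq A 0; have [->|B0] := eqVneq B 0.
  - by left; rewrite rmorph0 horner0 mul0r addr0.
  - right; exists (2 * (size B).-1 + 3)%N; rewrite rmorph0 horner0 add0r.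
    have := poleM (pole_horner j2 B0 pX) pY; congr pole; lia.
  - right; exists (2 * (size A).-1)%N; rewrite rmorph0 horner0 mul0r addr0.
    have := pole_horner j2 A0 pX; congr pole; lia.
  have pA := pole_horner j2 A0 pX; have pB := poleM (pole_horner j2 B0 pX) pY.
  right; case: (ltngtP (2 * (size B).-1 + 3)%N (2 * (size A).-1)%N) => lt; last by lia.
  - exists (2 * (size A).-1)%N.
    have := poleD _ pA (pole_pole_le pB); rewrite (_ : (_ < _)%N); last by nia.
    by move=> /(_ isT); congr pole; lia.
  - exists (2 * (size B).-1 + 3)%N; rewrite addrC.
    have := poleD _ pB (pole_pole_le pA); rewrite (_ : (_ < _)%N); last by nia.
    by move=> /(_ isT); congr pole; lia.
have notpole0 l : ~ pole (0 : Om) l.+1 by move=> /pole_unique/(_ (pole_le0 F 0)).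
have [i2 e2] : exists i, 2%N = (i * j)%N.
  have := pole_x F; rewrite exi.
  case: (mult hX) => [->|[i pi] /pole_unique_eq/(_ pi)]; last by exists i.
  by move=> /notpole0.
have [i3 e3] : exists i, 3%N = (i * j)%N.
  have := pole_y F; rewrite eeta.
  case: (mult hY) => [->|[i pi] /pole_unique_eq/(_ pi)]; last by exists i.
  by move=> /notpole0.
have j1 : j = 1%N.
  apply/eqP; rewrite -dvdn1 (_ : 1 = 3 - 2)%N // dvdn_sub //.
    by rewrite e3 dvdn_mull.
  by rewrite e2 dvdn_mull.
by move: pX pY; rewrite j1.
Qed.

(** Inserting [X = A] and [Y = B + G eta] into the equation of the target and reducing [eta ^+ 2]
    leaves these components along 1 and [eta]. *)
Lemma coord_relation (A B G e1 e2 e3 e4 e6 : {poly K}) :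
  (c B + c G * eta) ^+ 2 + c e1 * c A * (c B + c G * eta)
    + c e3 * (c B + c G * eta)
  = c A ^+ 3 + c e2 * c A ^+ 2 + c e4 * c A + c e6 ->
  c (G ^+ 2 * cub E + B ^+ 2 + (e1 * A + e3) * B
     - (A ^+ 3 + e2 * A ^+ 2 + e4 * A + e6))
  + c (2 * G * B - G ^+ 2 * lin E + (e1 * A + e3) * G) * eta = 0.
Proof.
have := eta_eq F; move: (lin E) (cub E) => l q eqe rel.
rewrite !(rmorphB, rmorphD, rmorphM, rmorphXn, rmorph_nat) -eqe.
by rewrite -[RHS](subrr (c A ^+ 3 + c e2 * c A ^+ 2 + c e4 * c A + c e6)) -{1}rel; ring.
Qed.

Lemma coords_linear : exists u r s t, u != 0 /\ E = wpull u r s t E'.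
Proof.
have [p2 p3] := pole_XY.
have [al [be eX']] := pole_le2 (pole_pole_le p2).
have [de [ep [ga eY']]] := pole_le3 (pole_pole_le p3).
pose A := al%:P * 'X + be%:P; pose B := de%:P * 'X + ep%:P.
have := relXY; rewrite (_ : X = c A); last by rewrite eX' rmorphD rmorphM.
rewrite (_ : Y = c B + c ga%:P * eta); last first.
  by rewrite eY' /B rmorphD rmorphM; ring.
move=> /coord_relation/cst_indep[]; rewrite /lin /cub /A /B => P0 Q0.
have [p0 p1 p2' p3'] : [/\
    ga ^+ 2 * a6 E + ep ^+ 2 + (a1 E' * be + a3 E') * ep
   - (be ^+ 3 + a2 E' * be ^+ 2 + a4 E' * be + a6 E') = 0,
    ga ^+ 2 * a4 E + 2 * de * ep + a1 E' * (al * ep + be * de) + a3 E' * de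
   - (3 * al * be ^+ 2 + 2 * a2 E' * al * be + a4 E' * al) = 0,
    ga ^+ 2 * a2 E + de ^+ 2 + a1 E' * al * de - 3 * al ^+ 2 * be
   - a2 E' * al ^+ 2 = 0 &
    ga ^+ 2 - al ^+ 3 = 0].
  apply: cubic_eq0; rewrite -[RHS]P0 !(polyCD, polyCN, polyCM); ring.
have [q0 q1 _ _] : [/\
    2 * ga * ep - ga ^+ 2 * a3 E + (a1 E' * be + a3 E') * ga = 0,
    2 * ga * de - ga ^+ 2 * a1 E + a1 E' * al * ga = 0, 0 = 0 :> K & 0 = 0 :> K].
  apply: cubic_eq0; rewrite -[RHS]Q0 !(polyCD, polyCN, polyCM); ring.
have al0 : al != 0.
  apply/eqP => al0; move: p2; rewrite eX' al0 rmorph0 mul0r add0r.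
  by move=> /pole_unique/(_ (pole_le_cst F be)).
have e3 : ga ^+ 2 = al ^+ 3 := subr0_eq p3'.
have ga0 : ga != 0.
  by apply: contraNneq al0 => g0; move/eqP: e3; rewrite g0 expr0n eq_sym expf_eq0.
(* The coefficient of the cube of x gives [ga ^+ 2 = al ^+ 3], so [u = ga / al] satisfies
   [u ^+ 2 = al] and [u ^+ 3 = ga]. *)
exists (ga / al), be, de, ep; split; first by rewrite mulf_neq0 ?invr_eq0.
have u2 : (ga / al) ^+ 2 = al by rewrite expr_div_n e3 exprS mulfK ?expf_neq0.
have u3 : (ga / al) ^+ 3 = ga by rewrite exprS u2 divfK.
have u4 : (ga / al) ^+ 4 = al ^+ 2 by rewrite (exprM _ 2 2) u2.
have u6 : (ga / al) ^+ 6 = ga ^+ 2 by rewrite (exprM _ 3 2) u3.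
rewrite /wpull u2 u3 u4 u6; move: p0 p1 p2' q0 q1; case: (E) => b1 b2 b3 b4 b6 /=.
have solve b n g : g != 0 -> n - g * b = 0 -> b = n / g :> K.
  by move=> g0 /subr0_eq ->; rewrite mulrC mulKf.
move=> p0 p1 p2' q0 q1; congr Weierstrass; apply: solve; rewrite ?expf_neq0 //.
- by apply: (mulfI ga0); rewrite mulr0 -[RHS]q1; ring.
- by rewrite -[RHS]oppr0 -p2'; ring.
- by apply: (mulfI ga0); rewrite mulr0 -[RHS]q0; ring.
- by rewrite -[RHS]oppr0 -p1; ring.
- by rewrite -[RHS]oppr0 -p0; ring.
Qed.

End Linear.

(** Both maps fix infinity and are mutually inverse, so affine points stay affine. At the generic
    point, [phi] gives [X] and [Y] as polynomials in x and y, and [psi] recovers x and y as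
    polynomials in [X] and [Y]. *)
Lemma isomorphic_wpull (K : fieldType) (E E' : weierstrass K) :
  isomorphic E E' -> exists u r s t, u != 0 /\ E = wpull u r s t E'.
Proof.
case=> phi [psi [mphi mpsi phiK psiK phi0]].
have psi0 L iota : psi L iota None = None by rewrite -(phi0 L iota) phiK.
have [|gX [gY gE]] := morphism_affine mphi.
  by move=> L iota x y ony e; have := phiK _ _ _ ony; rewrite e psi0.
have [|hX [hY hE]] := morphism_affine mpsi.
  by move=> L iota x y ony e; have := psiK _ _ _ ony; rewrite e phi0.
have [F] := function_field_exists E.
have onP := generic_on_curve F.
have [onQ _] := mphi _ _ _ onP.
have := phiK _ _ _ onP; have := gE _ _ _ _ onP => eQ; rewrite eQ in onQ *.
by rewrite (hE _ _ _ _ onQ) => -[] e1 e2; apply: coords_linear onQ (esym e1) (esym e2).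
Qed.

(** * Ideal classes and associativity *)

Section FractionalIdeals.
Variables (K : fieldType) (E : weierstrass K) (F : function_field E).
Local Notation Om := (ff F).
Implicit Types (I J M : Om -> Prop) (v w a d : Om).

Definition entire v : Prop := exists g, v = ev F g.

Lemma entireD v w : entire v -> entire w -> entire (v + w).
Proof. by move=> [g ->] [h ->]; exists (g + h); rewrite rmorphD. Qed.
Lemma entireN v : entire v -> entire (- v).
Proof. by move=> [g ->]; exists (- g); rewrite rmorphN. Qed.
Lemma entireM v w : entire v -> entire w -> entire (v * w).
Proof. by move=> [g ->] [h ->]; exists (g * h); rewrite rmorphM. Qed.
Lemma entireX v n : entire v -> entire (v ^+ n).
Proof. by move=> [g ->]; exists (g ^+ n); rewrite rmorphXn. Qed.
Lemma entire_cst A : entire (cst F A).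
Proof. by exists A%:P; rewrite evC. Qed.
Lemma entire_k x : entire (kgen F x).
Proof. exact: entire_cst. Qed.
Lemma entire_eta : entire (eta F).
Proof. by exists 'X; rewrite evX. Qed.
Lemma entire_nat n : entire n%:R.
Proof. by exists n%:R; rewrite rmorph_nat. Qed.
Lemma entire0 : entire 0. Proof. exact: (entire_nat 0). Qed.
Lemma entire1 : entire 1. Proof. exact: (entire_nat 1). Qed.

Definition frac_ideal I : Prop :=
  [/\ I 0, forall v w, I v -> I w -> I (v + w)
    & forall g v, entire g -> I v -> I (g * v)].

Inductive iprod I J : Om -> Prop :=
| iprod_mul v w : I v -> J w -> iprod I J (v * w)
| iprod_0 : iprod I J 0
| iprod_add v w : iprod I J v -> iprod I J w -> iprod I J (v + w).

Definition iscale a I : Om -> Prop := fun v => exists2 w, I w & v = a * w.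

(** Equality of ideal classes. *)
Definition isim I J : Prop := exists2 a, a != 0 & I = iscale a J.

Definition gen2 p q : Om -> Prop :=
  fun v => exists g h, [/\ entire g, entire h & v = g * p + h * q].

(** Ideals are predicates; extensionality makes those with the same elements equal, so that products
    can be rewritten. *)
Lemma ideal_ext I J : (forall v, I v <-> J v) -> I = J.
Proof.
by move=> h; apply: functional_extensionality => v; apply: propositional_extensionality.
Qed.

Lemma frac_ideal_entire : frac_ideal entire.
Proof. by split; [exact: entire0|exact: entireD|exact: entireM]. Qed.

Lemma frac_ideal_gen2 p q : frac_ideal (gen2 p q).
Proof.
split; first by exists 0, 0; split; rewrite ?mul0r ?addr0 //; exact: entire0.
  move=> _ _ [g [h [eg eh ->]]] [g' [h' [eg' eh' ->]]].
  exists (g + g'), (h + h'); split; [exact: entireD|exact: entireD|ring].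
move=> f _ ef [g [h [eg eh ->]]].
exists (f * g), (f * h); split; [exact: entireM|exact: entireM|ring].
Qed.

Lemma frac_ideal_iprod I J : frac_ideal I -> frac_ideal (iprod I J).
Proof.
case=> I0 ID IM; split; [exact: iprod_0|exact: iprod_add|].
move=> g v eg; elim=> [{}v w Iv Jw||{}v w _ h _ h'].
- by rewrite mulrA; apply: iprod_mul => //; apply: IM.
- by rewrite mulr0; apply: iprod_0.
by rewrite mulrDr; apply: iprod_add.
Qed.

Lemma frac_ideal_iscale a I : frac_ideal I -> frac_ideal (iscale a I).
Proof.
case=> I0 ID IM; split; first by exists 0; rewrite ?mulr0.
  by move=> _ _ [v Iv ->] [w Iw ->]; exists (v + w); rewrite ?mulrDr //; apply: ID.
by move=> g _ eg [v Iv ->]; exists (g * v); [apply: IM|rewrite mulrCA].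
Qed.

Lemma iprod_sub I J M : frac_ideal M ->
  (forall v w, I v -> J w -> M (v * w)) -> forall v, iprod I J v -> M v.
Proof.
case=> M0 MD _ h v; elim=> [{}v w Iv Jw||{}v w _ hv _ hw] //; [exact: h|exact: MD].
Qed.

Lemma gen2_sub p q M : frac_ideal M -> M p -> M q -> forall v, gen2 p q v -> M v.
Proof. by case=> M0 MD MM Mp Mq v [g [h [eg eh ->]]]; apply: MD; apply: MM. Qed.

Lemma gen2_l p q : gen2 p q p.
Proof. by exists 1, 0; split; [exact: entire1|exact: entire0|rewrite mul0r mul1r addr0]. Qed.

Lemma gen2_r p q : gen2 p q q.
Proof. by exists 0, 1; split; [exact: entire0|exact: entire1|rewrite mul0r mul1r add0r]. Qed.

Lemma iprod_gen2_sub p q p' q' M : frac_ideal M ->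
  M (p * p') -> M (p * q') -> M (q * p') -> M (q * q') ->
  forall v, iprod (gen2 p q) (gen2 p' q') v -> M v.
Proof.
move=> fM; have [_ MD MM] := fM; move=> m1 m2 m3 m4.
apply: iprod_sub => // _ _ [g [h [eg eh ->]]] [g' [h' [eg' eh' ->]]].
have -> : (g * p + h * q) * (g' * p' + h' * q') = (g * g') * (p * p') +
  (g * h') * (p * q') + (h * g') * (q * p') + (h * h') * (q * q') by ring.
by apply: (MD); [apply: (MD); [apply: (MD)|]|]; apply: (MM) => //; apply: entireM.
Qed.

Lemma iprodC I J : iprod I J = iprod J I.
Proof.
have sub A B v : iprod A B v -> iprod B A v.
  elim=> [{}v w Iv Jw||{}v w _ h _ h']; [|exact: iprod_0|exact: iprod_add].
  by rewrite mulrC; apply: iprod_mul.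
by apply: ideal_ext => v; split; apply: sub.
Qed.

Lemma iprodA I J M : iprod I (iprod J M) = iprod (iprod I J) M.
Proof.
apply: ideal_ext => v; split.
  elim=> [{}v w Iv||{}v w _ h _ h']; [|exact: iprod_0|exact: iprod_add].
  elim=> [{}w t Jw Mt||{}w t _ h _ h'].
  - by rewrite mulrA; apply: iprod_mul => //; apply: iprod_mul.
  - by rewrite mulr0; apply: iprod_0.
  by rewrite mulrDr; apply: iprod_add.
elim=> [{}v w IJv Mw||{}v w _ h _ h']; [|exact: iprod_0|exact: iprod_add].
elim: IJv => [{}v t Iv Jt||{}v t _ h _ h'].
- by rewrite -mulrA; apply: iprod_mul => //; apply: iprod_mul.
- by rewrite mul0r; apply: iprod_0.
by rewrite mulrDl; apply: iprod_add.
Qed.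

Lemma iprod1 I : frac_ideal I -> iprod entire I = I.
Proof.
move=> fI; have [_ _ IM] := fI; apply: ideal_ext => v; split.
  by apply: iprod_sub => // g w; apply: IM.
by move=> Iv; rewrite -[v]mul1r; apply: iprod_mul => //; apply: entire1.
Qed.

Lemma iscaleM a b I : iscale a (iscale b I) = iscale (a * b) I.
Proof.
apply: ideal_ext => v; split; first by case=> _ [w Iw ->] ->; exists w; rewrite ?mulrA.
by case=> w Iw ->; exists (b * w); rewrite ?mulrA //; exists w.
Qed.

Lemma iscale1 I : iscale 1 I = I.
Proof.
by apply: ideal_ext => v; split=> [[w Iw ->]|Iv]; [rewrite mul1r|exists v; rewrite ?mul1r].
Qed.

Lemma iscale_iprod a I J : iprod (iscale a I) J = iscale a (iprod I J).
Proof.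
apply: ideal_ext => v; split.
  elim=> [_ w [{}v Iv ->] Jw||{}v w _ [v' h ->] _ [w' h' ->]].
  - by exists (v * w); rewrite ?mulrA //; apply: iprod_mul.
  - by exists 0; rewrite ?mulr0 //; apply: iprod_0.
  by exists (v' + w'); rewrite ?mulrDr //; apply: iprod_add.
case=> w + ->; elim=> [{}v t Iv Jt||{}v t _ h _ h'].
- by rewrite mulrA; apply: iprod_mul => //; exists v.
- by rewrite mulr0; apply: iprod_0.
by rewrite mulrDr; apply: iprod_add.
Qed.

Lemma isim_refl I : isim I I.
Proof. by exists 1; rewrite ?oner_neq0 ?iscale1. Qed.

Lemma isim_sym I J : isim I J -> isim J I.
Proof.
by case=> a a0 ->; exists a^-1; rewrite ?invr_eq0 // iscaleM mulVf ?iscale1.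
Qed.

Lemma isim_trans I J M : isim I J -> isim J M -> isim I M.
Proof. by case=> a a0 -> [b b0 ->]; exists (a * b); rewrite ?mulf_neq0 ?iscaleM. Qed.

Lemma isim_iprod I I' J : isim I I' -> isim (iprod I J) (iprod I' J).
Proof. by case=> a a0 ->; exists a; rewrite ?iscale_iprod. Qed.

Lemma principal_eq d I : frac_ideal I ->
  (forall v, I v -> iscale d entire v) -> I d -> I = iscale d entire.
Proof.
case=> _ _ IM sub Id; apply: ideal_ext => v; split; first exact: sub.
by case=> g eg ->; rewrite mulrC; apply: IM.
Qed.

End FractionalIdeals.

Arguments entire {K E} F v.

(** * Ideals of points and lines *)

Section PointIdeals.
Variables (K : fieldType) (a b d : K).
Local Notation E := (Weierstrass 0 a 0 b d).
Hypothesis two0 : (2 : K) != 0.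
Hypothesis ellE : elliptic E.
Variable F : function_field E.
Local Notation Om := (ff F).
Local Notation k := (kgen F).
Local Notation xi := (cst F 'X).
Local Notation eta := (eta F).
Implicit Types (x y : K) (P Q R : point K) (M : Om -> Prop).

Lemma smooth_cubic x : x ^+ 3 + a * x ^+ 2 + b * x + d = 0 ->
  3 * x ^+ 2 + 2 * a * x + b != 0.
Proof.
move=> f0; apply: contraNneq ellE => f1.
have eb : b = - (3 * x ^+ 2 + 2 * a * x).
  by apply/eqP; rewrite -addr_eq0 addrC f1.
have ed : d = - (x ^+ 3 + a * x ^+ 2 + b * x).
  by apply/eqP; rewrite -addr_eq0 addrC f0.
by rewrite /disc /= ed eb; apply/eqP; ring.
Qed.

Lemma eta_sqr : eta ^+ 2 = xi ^+ 3 + k a * xi ^+ 2 + k b * xi + k d.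
Proof.
have := eta_eq F; rewrite /lin /cub /= polyC0 mul0r addr0 rmorph0 mul0r addr0 => ->.
by rewrite !rmorphD ![cst F (_%:P * _)]rmorphM !rmorphXn.
Qed.

Definition idl P : Om -> Prop :=
  if P is Some (x, y) then gen2 (xi - k x) (eta - k y) else entire F.

Lemma frac_ideal_idl P : frac_ideal (idl P).
Proof. case: P => [[x y]|]; [exact: frac_ideal_gen2|exact: frac_ideal_entire]. Qed.

Lemma mem_unit M e v : frac_ideal M -> e != 0 -> M (k e * v) -> M v.
Proof.
move=> [_ _ MM] e0 /(MM (k e^-1) _ (entire_k F _)).
by rewrite mulrA -rmorphM mulVf // rmorph1 mul1r.
Qed.

Ltac ent := repeat first [ exact: entire_k | exact: entire_eta | exact: entire_cst
  | exact: entire_nat | exact: entire1 | apply: entireN | apply: entireD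
  | apply: entireX | apply: entireM ].

(** The vertical line through [(x, y)] meets the curve in this point and its opposite. Every product
    of generators is divisible by [xi - k x], the last one because [eta ^+ 2 - k (y ^+ 2)] equals
    [(xi - k x) * g]. *)
Lemma idl_opp x y : on_curve E (Some (x, y)) ->
  iprod (idl (Some (x, y))) (idl (Some (x, - y))) = iscale (xi - k x) (entire F).
Proof.
move=> /eqP /=; rewrite !mul0r !addr0 => onP.
have fp := frac_ideal_iprod (idl (Some (x, y))) (frac_ideal_idl (Some (x, - y))).
rewrite iprodC; set M := iprod _ _ in fp *.
pose g := xi ^+ 2 + k x * xi + k x ^+ 2 + k a * (xi + k x) + k b.
have eg : entire F g by rewrite /g; ent.
have e2 : (eta - k (- y)) * (eta - k y) = (xi - k x) * g.
  have -> : (eta - k (- y)) * (eta - k y) = eta ^+ 2 - k (y ^+ 2).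
    by rewrite !(rmorphN, rmorphM); ring.
  by rewrite eta_sqr onP /g !(rmorphD, rmorphM, rmorphXn); ring.
have [_ MD MM] := fp.
have m1 : M ((xi - k x) * (xi - k x)) by apply: iprod_mul; apply: gen2_l.
have m2 : M ((xi - k x) * (eta - k y)) by apply: iprod_mul; [apply: gen2_l|apply: gen2_r].
have m3 : M ((eta - k (- y)) * (xi - k x)) by apply: iprod_mul; [apply: gen2_r|apply: gen2_l].
have m4 : M ((xi - k x) * g) by rewrite -e2; apply: iprod_mul; apply: gen2_r.
apply: principal_eq => //.
  apply: iprod_gen2_sub; first exact: frac_ideal_iscale (frac_ideal_entire F).
  - by exists (xi - k x) => //; ent.
  - by exists (eta - k y) => //; ent.
  - by exists (eta - k (- y)); [ent|rewrite mulrC].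
  - by exists g.
(* To recover [xi - k x]: for nonzero [y] the mixed products differ by [2 y] times it. For [y = 0]
   the cofactor [g] takes at [x] the value of the derivative of the cubic, nonzero by smoothness. *)
have [y0|y0] := eqVneq y 0.
  apply: (@mem_unit _ (3 * x ^+ 2 + 2 * a * x + b)) => //.
    by apply: smooth_cubic; rewrite -onP y0 expr0n.
  have -> : k (3 * x ^+ 2 + 2 * a * x + b) * (xi - k x) = (xi - k x) * g
      + (- (xi + 2 * k x + k a)) * ((xi - k x) * (xi - k x)).
    by rewrite /g !(rmorph_nat, rmorphXn, rmorphM, rmorphD); ring.
  by apply: MD => //; apply: MM => //; ent.
apply: (@mem_unit _ (2 * y)); rewrite ?mulf_neq0 //.
have -> : k (2 * y) * (xi - k x) =
    (eta - k (- y)) * (xi - k x) + (-1) * ((xi - k x) * (eta - k y)).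
  by rewrite !(rmorph_nat, rmorphN, rmorphM); ring.
by apply: MD => //; apply: MM => //; ent.
Qed.

Section Chord.
Variables x1 y1 x2 l : K.
Let x3 := l ^+ 2 - a - x1 - x2.
Let y2 := y1 + l * (x2 - x1).
Let y3 := l * (x1 - x3) - y1.
(** With the choice of [x3], these are Vieta's formulas: the cubic minus the square of the line of
    slope [l] through [(x1, y1)] has the roots [x1], [x2], [x3]. The third intersection is
    [(x3, - y3)]. *)
Hypothesis hb : b = 2 * l * (y1 - l * x1) + (x1 * x2 + x1 * x3 + x2 * x3).
Hypothesis hd : d = (y1 - l * x1) ^+ 2 - x1 * x2 * x3.
Hypothesis sep : x1 != x2 \/ x1 = x2 /\ y1 != 0.

Let L : Om := eta - k y1 - k l * (xi - k x1).
Let L' : Om := eta + k y1 + k l * (xi - k x1).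
Let v1 : Om := xi - k x1.
Let v2 : Om := xi - k x2.
Let v3 : Om := xi - k x3.

Let rE := (rmorph_nat, rmorphXn, rmorphN, rmorphB, rmorphM, rmorphD).

Lemma chord_norm : L * L' = v1 * v2 * v3.
Proof.
have -> : L * L' = eta ^+ 2 - (k y1 + k l * (xi - k x1)) ^+ 2 by rewrite /L /L'; ring.
by rewrite eta_sqr (congr1 k hb) (congr1 k hd) /v1 /v2 /v3 /x3 !rE; ring.
Qed.

(** The two ordinate generators differ from [L] by multiples of [v1] and [v2]. The point is to
    recover [L] from products of generators; [sep] makes a constant multiple available, by [x1 - x2]
    for a secant and [2 * y1] for a tangent. *)
Lemma chord_prod :
  iprod (idl (Some (x1, y1))) (idl (Some (x2, y2))) = gen2 (v1 * v2) L.
Proof.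
have fp := frac_ideal_iprod (idl (Some (x1, y1))) (frac_ideal_idl (Some (x2, y2))).
rewrite iprodC; set M := iprod _ _ in fp *; have [_ MD MM] := fp.
have w1E : eta - k y1 = L + k l * v1 by rewrite /L /v1; ring.
have w2E : eta - k y2 = L + k l * v2 by rewrite /L /v2 /y2 !rE; ring.
have m1 : M (v2 * v1) by apply: iprod_mul; apply: gen2_l.
have m2 : M (v2 * (eta - k y1)) by apply: iprod_mul; [apply: gen2_l|apply: gen2_r].
have m3 : M ((eta - k y2) * v1) by apply: iprod_mul; [apply: gen2_r|apply: gen2_l].
have m4 : M ((eta - k y2) * (eta - k y1)) by apply: iprod_mul; apply: gen2_r.
apply: ideal_ext => v; split; last first.
  apply: gen2_sub => //; first by rewrite mulrC.
  case: sep => [ne|[e12 y0]].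
    apply: (@mem_unit _ (x1 - x2)) => //; first by rewrite subr_eq0.
    have -> : k (x1 - x2) * L = v2 * (eta - k y1) + (-1) * ((eta - k y2) * v1).
      by rewrite w1E w2E /v1 /v2 !rE; ring.
    by apply: (MD) => //; apply: (MM) => //; ent.
  (* As [L' - L = 2 * k y1 + 2 * k l * v1], this multiple of [L] is the norm [L * L'] plus a
     combination of products of generators. *)
  apply: (@mem_unit _ (2 * y1)) => //; first by rewrite mulf_neq0.
  have e2 : v2 = v1 by rewrite /v2 -e12.
  have -> : k (2 * y1) * L = L * L' - L ^+ 2 + (- (2 * k l)) * (v1 * L).
    by rewrite /L' /L /v1 !rE; ring.
  rewrite chord_norm.
  have -> : v1 * v2 * v3 - L ^+ 2 + - (2 * k l) * (v1 * L) = v3 * (v2 * v1)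
     + (-1) * ((eta - k y2) * (eta - k y1)) + k l ^+ 2 * (v2 * v1).
    by rewrite w1E w2E e2; ring.
  by apply: (MD); [apply: (MD)|]; apply: (MM) => //; rewrite /v3; ent.
apply: iprod_gen2_sub; first exact: frac_ideal_gen2.
- by exists 1, 0; split; [ent|exact: entire0|rewrite /v1 /v2; ring].
- exists (k l), v2; split; [ent|rewrite /v2; ent|rewrite w1E /v1 /v2; ring].
- exists (k l), v1; split; [ent|rewrite /v1; ent|rewrite w2E /v1 /v2; ring].
exists (k l ^+ 2), (L + k l * (v1 + v2)).
by split; [ent|rewrite /L /v1 /v2; ent|rewrite w1E w2E /v1 /v2; ring].
Qed.

(** The line itself has divisor the three intersection points, and [chord_norm] shows that [L]
    divides the product of the abscissa generators. *)
Lemma chord_principal :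
  iprod (gen2 (v1 * v2) L) (idl (Some (x3, - y3))) = iscale L (entire F).
Proof.
have fp := frac_ideal_iprod (idl (Some (x3, - y3))) (frac_ideal_gen2 (v1 * v2) L).
set M := iprod _ _ in fp *; have [_ MD MM] := fp.
have w3E : eta - k (- y3) = L + k l * v3 by rewrite /L /v3 /y3 !rE; ring.
have m1 : M ((v1 * v2) * v3) by apply: iprod_mul; apply: gen2_l.
have m2 : M ((v1 * v2) * (eta - k (- y3))) by apply: iprod_mul; [apply: gen2_l|apply: gen2_r].
have m3 : M (L * v3) by apply: iprod_mul; [apply: gen2_r|apply: gen2_l].
have m4 : M (L * (eta - k (- y3))) by apply: iprod_mul; apply: gen2_r.
apply: principal_eq => //.
  apply: iprod_gen2_sub; first exact: frac_ideal_iscale (frac_ideal_entire F).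
  - by exists L'; [rewrite /L'; ent|rewrite chord_norm].
  - exists (v1 * v2 + k l * L'); first by rewrite /v1 /v2 /L'; ent.
    rewrite w3E mulrDr [in RHS]mulrDr [L * (k l * L')]mulrCA chord_norm; ring.
  - by exists v3 => //; rewrite /v3; ent.
  - by exists (eta - k (- y3)) => //; ent.
(* If [y3 = 0], then [(x3 - x1) * (x3 - x2)] is the derivative of the cubic at its root [x3], so it
   is invertible; otherwise [2 y3] serves. *)
have [y30|y30] := eqVneq y3 0.
  have nz : (x3 - x1) * (x3 - x2) != 0.
    have f3 : x3 ^+ 3 + a * x3 ^+ 2 + b * x3 + d = 0.
      have -> : x3 ^+ 3 + a * x3 ^+ 2 + b * x3 + d = y3 ^+ 2.
        by rewrite hb hd /y3 /x3; ring.
      by rewrite y30 expr0n.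
    have := smooth_cubic f3; congr (_ != 0).
    have -> : 3 * x3 ^+ 2 + 2 * a * x3 + b = (x3 - x1) * (x3 - x2) - 2 * l * y3.
      by rewrite hb /y3 /x3; ring.
    by rewrite y30 mulr0 subr0.
  apply: (@mem_unit _ ((x3 - x1) * (x3 - x2))) => //.
  have -> : k ((x3 - x1) * (x3 - x2)) * L = (v1 * v2) * (eta - k (- y3))
      + (- k l) * ((v1 * v2) * v3) + (- (v3 + (2 * k x3 - k x1 - k x2))) * (L * v3).
    by rewrite w3E /v1 /v2 /v3 !rE; ring.
  by apply: (MD); [apply: (MD) => //|]; apply: (MM) => //; rewrite /v3; ent.
apply: (@mem_unit _ (- 2 * y3)); rewrite ?mulf_neq0 ?oppr_eq0 //.
have -> : k (- 2 * y3) * L = (v1 * v2) * v3 + (-1) * (L * (eta - k (- y3)))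
    + (- k l) * (L * v3).
  by rewrite -chord_norm /L' /L /v3 /y3 !rE; ring.
by apply: (MD); [apply: (MD) => //|]; apply: (MM) => //; ent.
Qed.

End Chord.
End PointIdeals.

Section ClassMap.
Variables (K : fieldType) (a b d : K).
Local Notation E := (Weierstrass 0 a 0 b d).
Hypothesis two0 : (2 : K) != 0.
Hypothesis ellE : elliptic E.
Variable F : function_field E.
Local Notation Om := (ff F).
Local Notation k := (kgen F).
Local Notation xi := (cst F 'X).
Local Notation eta := (eta F).
Local Notation idl := (@idl _ _ _ _ F).
Implicit Types (x y : K) (P Q R : point K).

Lemma xi_sub_neq0 x : xi - k x != 0.
Proof. by rewrite -rmorphB cst_eq0 polyXsubC_eq0. Qed.

Lemma eta_line_neq0 x y l : eta - k y - k l * (xi - k x) != 0.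
Proof.
apply/eqP => h; have [_ /eqP] : - y%:P - l%:P * ('X - x%:P) = 0 /\ (1 : {poly K}) = 0.
  apply: (@cst_indep _ _ F); rewrite -[RHS]h !(rmorphB, rmorphN, rmorphM, rmorph1).
  by rewrite -!kgenE; ring.
by rewrite oner_eq0.
Qed.

(** Multiplying the principal ideal of the line by the ideal of [(x3, y3)] and cancelling opposite
    points by [idl_opp] leaves [xi - k x3] times the product of the first two ideals equal to [L]
    times the third. *)
Lemma chord_sum x1 y1 x2 l (x3 := l ^+ 2 - a - x1 - x2) :
  b = 2 * l * (y1 - l * x1) + (x1 * x2 + x1 * x3 + x2 * x3) ->
  d = (y1 - l * x1) ^+ 2 - x1 * x2 * x3 ->
  x1 != x2 \/ x1 = x2 /\ y1 != 0 ->
  on_curve E (chord E l x1 y1 x2) /\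
  isim (idl (chord E l x1 y1 x2))
    (iprod (idl (Some (x1, y1))) (idl (Some (x2, y1 + l * (x2 - x1))))).
Proof.
move=> hb hd sep; set y3 := l * (x1 - x3) - y1.
have -> : chord E l x1 y1 x2 = Some (x3, y3).
  by rewrite /chord /= mul0r addr0 !subr0 mul0r subr0.
have on3 : on_curve E (Some (x3, y3)).
  by apply/eqP; rewrite /= hb hd /y3 /x3; ring.
split=> //; rewrite (chord_prod two0 F hb hd sep).
have := idl_opp two0 ellE F on3.
set G := gen2 _ _; set L := (X in gen2 _ X) in G *; set J := iprod _ _ => eJ.
have : iprod G (idl (Some (x3, - y3))) = iscale L (entire F).
  exact: chord_principal.
move=> /(congr1 (fun I => iprod I (idl (Some (x3, y3))))).
rewrite -iprodA [iprod (idl (Some (x3, - y3))) _]iprodC -/J eJ.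
rewrite iscale_iprod iprod1; last exact: frac_ideal_idl.
rewrite iprodC iscale_iprod iprod1; last exact: frac_ideal_gen2.
move=> e; apply: (isim_trans (J := iscale L (idl (Some (x3, y3))))).
  by apply: isim_sym; exists L => //; apply: eta_line_neq0.
by rewrite -e; exists (xi - k x3) => //; apply: xi_sub_neq0.
Qed.

Lemma idl_add P Q : on_curve E P -> on_curve E Q ->
  on_curve E (ec_add E P Q) /\ isim (idl (ec_add E P Q)) (iprod (idl P) (idl Q)).
Proof.
case: P => [[x1 y1]|] onP onQ; last first.
  by split=> //; rewrite iprod1; [exact: isim_refl|exact: frac_ideal_idl].
case: Q onQ => [[x2 y2]|] onQ; last first.
  by split=> //; rewrite iprodC iprod1; [exact: isim_refl|exact: frac_ideal_idl].
have e1 : y1 ^+ 2 = x1 ^+ 3 + a * x1 ^+ 2 + b * x1 + d.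
  by move/eqP: onP => /= <-; ring.
have e2 : y2 ^+ 2 = x2 ^+ 3 + a * x2 ^+ 2 + b * x2 + d.
  by move/eqP: onQ => /= <-; ring.
case: (ec_add_cases onP onQ) => [[ex ey]|[ex ey d0]|ne].
- have {}ey : y2 = - y1 by rewrite ey /=; ring.
  rewrite -ex ec_add_opp /=; last by rewrite ey; ring.
  split=> //; rewrite ey; apply: isim_sym.
  by exists (xi - k x1); [exact: xi_sub_neq0|exact: idl_opp].
- have y0 : 2 * y1 != 0 by move: d0; rewrite /= mul0r !addr0.
  rewrite -ex -ey ec_add_tangent //=; set l := (_ / _).
  have hl : 3 * x1 ^+ 2 + 2 * a * x1 + b = 2 * l * y1.
    by rewrite /l !mul0r !addr0 subr0 -[RHS]mulrA [RHS]mulrCA divfK.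
  have := @chord_sum x1 y1 x1 l; rewrite subrr mulr0 addr0; apply.
  - rewrite -[LHS](addrK (3 * x1 ^+ 2 + 2 * a * x1)) [X in X - _]addrC hl; ring.
  - have -> : d = y1 ^+ 2 - x1 ^+ 3 - a * x1 ^+ 2 - (3 * x1 ^+ 2 + 2 * a * x1 + b) * x1
      + (3 * x1 ^+ 2 + 2 * a * x1) * x1 by rewrite e1; ring.
    by rewrite hl; ring.
  - by right; split=> //; apply: contraNneq y0 => ->; rewrite mulr0.
have n12 : x1 - x2 != 0 by rewrite subr_eq0.
rewrite ec_add_secant //; set l := (_ / _).
have hl : y2 = y1 + l * (x2 - x1).
  by rewrite /l divfK ?subr_eq0 1?eq_sym // addrC subrK.
rewrite hl in e2; rewrite hl.
set x3 := l ^+ 2 - a - x1 - x2.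
(* Subtracting the equations of the two points leaves a multiple of [x1 - x2]. *)
have eb : b = 2 * l * (y1 - l * x1) + (x1 * x2 + x1 * x3 + x2 * x3).
  apply: (mulfI n12); apply/eqP; rewrite -subr_eq0; apply/eqP.
  have -> : (x1 - x2) * b - (x1 - x2) * (2 * l * (y1 - l * x1) + (x1 * x2 + x1 * x3 + x2 * x3))
    = (x1 ^+ 3 + a * x1 ^+ 2 + b * x1 + d - y1 ^+ 2)
     - (x2 ^+ 3 + a * x2 ^+ 2 + b * x2 + d - (y1 + l * (x2 - x1)) ^+ 2).
    by rewrite /x3; ring.
  by rewrite e1 e2; ring.
apply: chord_sum => //; last by left.
have -> : d = y1 ^+ 2 - x1 ^+ 3 - a * x1 ^+ 2 - b * x1 by rewrite e1; ring.
by rewrite {1}eb -/x3 /x3; ring.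
Qed.

End ClassMap.

(** * Injectivity of the class map *)

Section Injectivity.
Variables (K : fieldType) (a b d : K).
Local Notation E := (Weierstrass 0 a 0 b d).
Variable F : function_field E.
Local Notation Om := (ff F).
Local Notation k := (kgen F).
Local Notation xi := (cst F 'X).
Local Notation eta := (eta F).
Local Notation idl := (@idl _ _ _ _ F).
Implicit Types (x y : K) (P Q R : point K) (v w : Om).

Lemma pole_neq0 v n : pole v n -> v != 0.
Proof.
move=> [A [B [-> w]]]; apply/eqP => /cst_indep[eA eB].
by move: w; rewrite eA eB /weight size_poly0 eqxx.
Qed.

(** Weights are even or at least 5, never 3: this is where positive genus enters. *)
Lemma not_pole1 v : ~ pole v 1.
Proof.
case=> A [B [_]]; rewrite /weight; case: (eqVneq B 0) => [_|].
  by rewrite maxn0; move: (size A) => n; lia.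
by rewrite -size_poly_gt0; move: (size A) (size B) => n m; lia.
Qed.

Lemma pole_le_entire v : entire F v -> exists n, pole_le v n.
Proof. by case=> g ->; have [n [h _]] := pole_ev F g; exists n. Qed.

(** Generators of the ideal vanish at the point; the identity over the function field is specialized
    at the point over [K] itself. *)
Lemma idl_eval x y al be de : on_curve E (Some (x, y)) ->
  idl (Some (x, y)) (k de * eta + k al * xi + k be) ->
  de * y + al * x + be = 0.
Proof.
move=> onP [_ [_ [[g1 ->] [g2 ->] e]]].
pose id1 : {rmorphism K -> K} := idfun.
have onP' : on_curve (base_change id1 E) (Some (x, y)) by [].
pose G : {poly {poly K}} := de%:P%:P * 'X + (al%:P * 'X)%:P + be%:P%:P
  - (g1 * ('X - x%:P)%:P + g2 * ('X - y%:P%:P)).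
have : ev F G = 0.
  rewrite /G !(rmorphB, rmorphD, rmorphM) !evX !evC.
  by rewrite -!kgenE e subrr.
move=> /(ev_eq0_at onP'); rewrite /G !(rmorphB, rmorphD, rmorphM) !ev2X !ev2C.
rewrite !map_polyX !map_polyC !hornerX !hornerC /= !subrr !mulr0 addr0 subr0.
by [].
Qed.

Lemma idl_pole2 x y v : on_curve E (Some (x, y)) ->
  idl (Some (x, y)) v -> pole_le v 2 -> exists al, v = k al * (xi - k x).
Proof.
move=> onP + /pole_le2[al [be e]]; rewrite {}e => h; exists al.
have := @idl_eval x y al be 0 onP; rewrite !rmorph0 !mul0r !add0r => /(_ h) /eqP.
by rewrite addrC addr_eq0 => /eqP ->; rewrite rmorphN rmorphM; ring.
Qed.

Lemma idl_pole3 x y v : on_curve E (Some (x, y)) ->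
  idl (Some (x, y)) v -> pole_le v 3 ->
  exists al de, v = k de * (eta - k y) + k al * (xi - k x).
Proof.
move=> onP + /pole_le3[al [be [de e]]]; rewrite {}e => h; exists al, de.
have /eqP := idl_eval onP h; rewrite addrC addr_eq0 => /eqP ->.
by rewrite rmorphN rmorphD !rmorphM; ring.
Qed.

Lemma idl_pole_ge2 x y v n : on_curve E (Some (x, y)) ->
  idl (Some (x, y)) v -> pole v n -> (2 <= n)%N.
Proof.
move=> onP Iv pv; rewrite leqNgt; apply/negP => lt.
have [|al e] := idl_pole2 onP Iv.
  by apply: pole_leW (pole_pole_le pv); lia.
have [al0|al0] := eqVneq al 0.
  by have := pole_neq0 pv; rewrite e al0 rmorph0 mul0r eqxx.
have : pole v 2.
  rewrite e -[2%N]add0n; apply: poleM; first exact: pole_cst.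
  apply: (poleD (m := 0)) => //; [exact: pole_x|apply: pole_leN; exact: pole_le_cst].
by move=> /pole_unique/(_ (pole_pole_le pv)); lia.
Qed.

Lemma entire_pole v : entire F v -> v != 0 -> exists n, pole v n.
Proof.
move=> /pole_le_entire[n /pole_le_pole[->|[m pm _]]]; first by rewrite eqxx.
by exists m.
Qed.

Lemma idl_entire P v : idl P v -> entire F v.
Proof.
case: P => [[x y]|] //= [g [h [eg eh ->]]].
by apply: entireD; apply: entireM => //; apply: entireD;
   do ?apply: entireN; do ?[exact: entire_k|exact: entire_eta|exact: entire_cst].
Qed.

Lemma pole_xi_sub x : pole (xi - k x) 2.
Proof.
by apply: (poleD (m := 0)) => //; [exact: pole_x|apply: pole_leN; exact: pole_le_cst].
Qed.

Lemma pole_eta_sub y : pole (eta - k y) 3.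
Proof.
by apply: (poleD (m := 0)) => //; [exact: pole_y|apply: pole_leN; exact: pole_le_cst].
Qed.

(* Clearing the denominator of the similarity factor keeps both sides in the
   coordinate ring, the only place where pole orders are defined. *)
Lemma isim_clear P Q : isim (idl P) (idl Q) ->
  exists D e m n, [/\ pole D m, pole e n,
    forall v, idl P v -> exists2 w, idl Q w & D * v = e * w &
    forall w, idl Q w -> exists2 v, idl P v & D * v = e * w].
Proof.
case=> q q0 ePQ; have [A [B [D [D0 eD]]]] := ff_frac q.
have cD0 : cst F D != 0 by rewrite cst_eq0.
have ent : entire F (q * cst F D).
  by rewrite eD; apply: entireD; last apply: entireM; do ?exact: entire_cst; exact: entire_eta.
have [m pD] := entire_pole (entire_cst F D) cD0.
have [n pe] := entire_pole ent (mulf_neq0 q0 cD0).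
exists (cst F D), (q * cst F D), m, n; split=> //.
  by rewrite ePQ => v [w Iw ->]; exists w => //; ring.
by move=> w Iw; exists (q * w); [rewrite ePQ; exists w|ring].
Qed.

(** A similarity shifts all pole orders by a constant. The nonzero elements of the ideal of an
    affine point have least order 2, and order 3 occurs too; the coordinate ring starts at 0 but has
    no element of order 1. *)
Lemma isim_affine_ne x y : on_curve E (Some (x, y)) ->
  ~ isim (idl None) (idl (Some (x, y))).
Proof.
move=> onP /isim_clear[D [e [m [n [pD pe sub sup]]]]].
have [w Iw ew] := sub 1 (entire1 F).
have D0 := pole_neq0 pD; have e0 := pole_neq0 pe.
have w0 : w != 0 by apply: contraNneq D0 => w0; rewrite -[D]mulr1 ew w0 mulr0.
have [l pw] := entire_pole (idl_entire Iw) w0.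
have l2 := idl_pole_ge2 onP Iw pw.
have mE : m = (n + l)%N.
  by have := poleM pe pw; rewrite -ew mulr1; apply: pole_unique_eq.
have [g eg e2] := sup _ (gen2_l _ _).
have [h eh e3] := sup _ (gen2_r _ _).
have g0 : g != 0.
  apply: contraTneq (mulf_neq0 e0 (pole_neq0 (pole_xi_sub x))) => g0.
  by rewrite -e2 g0 mulr0 eqxx.
have h0 : h != 0.
  apply: contraTneq (mulf_neq0 e0 (pole_neq0 (pole_eta_sub y))) => h0.
  by rewrite -e3 h0 mulr0 eqxx.
have [i pg] := entire_pole eg g0; have [j ph] := entire_pole eh h0.
have E1 : (m + i = n + 2)%N.
  by have := poleM pD pg; rewrite e2 => /pole_unique_eq; apply; apply: poleM (pole_xi_sub x).
have E2 : (m + j = n + 3)%N.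
  by have := poleM pD ph; rewrite e3 => /pole_unique_eq; apply; apply: poleM (pole_eta_sub y).
have j1 : j = 1%N by lia.
by move: ph; rewrite j1 => /not_pole1.
Qed.

(** Both ideals have least order 2, so the shift cannot be negative; applied in both directions, it
    is zero. *)
Lemma isim_affine_le x y x' y' D e m n :
  on_curve E (Some (x', y')) -> pole D m -> pole e n ->
  (forall v, idl (Some (x, y)) v -> exists2 w, idl (Some (x', y')) w & D * v = e * w) ->
  (n <= m)%N.
Proof.
move=> onQ pD pe sub; have [w Iw ew] := sub _ (gen2_l _ _).
have w0 : w != 0.
  apply: contraTneq (mulf_neq0 (pole_neq0 pD) (pole_neq0 (pole_xi_sub x))) => w0.
  by rewrite ew w0 mulr0 eqxx.
have [l pw] := entire_pole (idl_entire (P := Some (x', y')) Iw) w0.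
have l2 := idl_pole_ge2 onQ Iw pw.
have : (m + 2 = n + l)%N.
  by have := poleM pD (pole_xi_sub x); rewrite ew => /pole_unique_eq; apply; apply: poleM.
by lia.
Qed.

Lemma idl_inj P Q : on_curve E P -> on_curve E Q ->
  isim (idl P) (idl Q) -> P = Q.
Proof.
case: P => [[x y]|]; case: Q => [[x' y']|] // onP onQ; last first.
- by move=> /(isim_affine_ne onQ).
- by move=> /isim_sym/(isim_affine_ne onP).
move=> /isim_clear[D [e [m [n [pD pe sub sup]]]]].
have mn : m = n.
  apply/eqP; rewrite eqn_leq (isim_affine_le onQ pD pe sub) andbT.
  apply: (isim_affine_le (x := x') (y := y') onP pe pD) => w /sup[v Iv eDv].
  by exists v.
rewrite {}mn in pD.
have D0 := pole_neq0 pD; have e0 := pole_neq0 pe.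
have [w1 Iw1 e1] := sub _ (gen2_l _ _).
have [w2 Iw2 e2] := sub _ (gen2_r _ _).
have ord v w l : pole v l -> entire F w -> D * v = e * w -> pole w l.
  move=> pv ew evw; have w0 : w != 0.
    by apply: contraTneq (mulf_neq0 D0 (pole_neq0 pv)) => w0; rewrite evw w0 mulr0 eqxx.
  have [j pj] := entire_pole ew w0.
  have : (n + l = n + j)%N.
    by have := poleM pD pv; rewrite evw => /pole_unique_eq; apply; apply: poleM.
  by move=> /addnI ->.
have p1 := ord _ _ _ (pole_xi_sub x) (idl_entire (P := Some (x', y')) Iw1) e1.
have p2 := ord _ _ _ (pole_eta_sub y) (idl_entire (P := Some (x', y')) Iw2) e2.
have [al eal] := idl_pole2 onQ Iw1 (pole_pole_le p1).
have [be [ga ebg]] := idl_pole3 onQ Iw2 (pole_pole_le p2).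
(* Cross-multiplication eliminates the similarity factor; the components along 1 and [eta] then
   identify the points. *)
have cross : w1 * (eta - k y) = w2 * (xi - k x).
  apply: (mulfI (mulf_neq0 D0 e0)).
  have -> : D * e * (w1 * (eta - k y)) = (D * (eta - k y)) * (e * w1) by ring.
  by rewrite -e1 e2; ring.
have al0 : al != 0.
  by apply: contraNneq (pole_neq0 p1) => al0; rewrite eal al0 rmorph0 mul0r.
have : cst F (- al%:P * ('X - x'%:P) * y%:P
      - (- ga%:P * y'%:P + be%:P * ('X - x'%:P)) * ('X - x%:P))
   + cst F (al%:P * ('X - x'%:P) - ga%:P * ('X - x%:P)) * eta = 0.
  rewrite -[RHS](subrr (w1 * (eta - k y))) {2}cross eal ebg.
  by rewrite !(rmorphB, rmorphD, rmorphM, rmorphN) -!kgenE; ring.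
move=> /cst_indep[/eqP + /eqP]; rewrite !subr_eq0 => /eqP cA /eqP cB.
have gal : ga = al.
  have := congr1 (fun p : {poly K} => p`_1) cB.
  by rewrite !coefCM !coefB !coefX !coefC /= !subr0 !mulr1.
rewrite gal in cA cB; have xx : x' = x.
  have := congr1 (fun p : {poly K} => p.[x]) cB.
  rewrite !(hornerM, hornerD, hornerN, hornerX, hornerC) subrr mulr0 => /eqP.
  by rewrite mulf_eq0 (negPf al0) /= subr_eq0 eq_sym => /eqP.
rewrite xx in cA *; congr (Some (_, _)).
have v0 : 'X - x%:P != 0 :> {poly K} by rewrite polyXsubC_eq0.
have /(mulIf v0) : - al%:P * y%:P * ('X - x%:P)
    = (- al%:P * y'%:P + be%:P * ('X - x%:P)) * ('X - x%:P) by rewrite -cA; ring.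
move=> /(congr1 (fun p : {poly K} => p.[x])).
rewrite !(hornerM, hornerD, hornerN, hornerX, hornerC) subrr mulr0 addr0.
by apply: mulfI; rewrite oppr_eq0.
Qed.
End Injectivity.

(** * Associativity and commutativity *)

Section GroupLaw.
Variables (K : fieldType) (a b d : K).
Local Notation E := (Weierstrass 0 a 0 b d).
Hypothesis two0 : (2 : K) != 0.
Hypothesis ellE : elliptic E.
Implicit Types (P Q R : point K).

Lemma on_curve_add P Q :
  on_curve E P -> on_curve E Q -> on_curve E (ec_add E P Q).
Proof.
move=> onP onQ; have [F] := function_field_exists E.
by have [] := idl_add two0 ellE F onP onQ.
Qed.

Lemma ec_addA P Q R : on_curve E P -> on_curve E Q -> on_curve E R ->
  ec_add E P (ec_add E Q R) = ec_add E (ec_add E P Q) R.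
Proof.
move=> onP onQ onR; have [F] := function_field_exists E.
have [onPQ ePQ] := idl_add two0 ellE F onP onQ.
have [onQR eQR] := idl_add two0 ellE F onQ onR.
have [onl el] := idl_add two0 ellE F onP onQR.
have [onr er] := idl_add two0 ellE F onPQ onR.
apply: (idl_inj onl onr); apply: isim_trans el _; apply: isim_sym.
apply: isim_trans er _; apply: isim_trans (isim_iprod _ ePQ) _.
rewrite -iprodA [X in isim _ X]iprodC [X in isim X _]iprodC.
by apply: isim_iprod; apply: isim_sym.
Qed.

Lemma ec_addC P Q : on_curve E P -> on_curve E Q -> ec_add E P Q = ec_add E Q P.
Proof.
move=> onP onQ; have [F] := function_field_exists E.
have [onPQ ePQ] := idl_add two0 ellE F onP onQ.
have [onQP eQP] := idl_add two0 ellE F onQ onP.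
apply: (idl_inj onPQ onQP); apply: isim_trans ePQ _.
by rewrite iprodC; apply: isim_sym.
Qed.

End GroupLaw.

(** * Orders of points *)

Section Multiples.
Variables (K : fieldType) (a b d : K).
Local Notation E := (Weierstrass 0 a 0 b d).
Hypothesis two0 : (2 : K) != 0.
Hypothesis ellE : elliptic E.
Implicit Types (P Q R : point K) (m n : nat).
Local Notation mul := (ec_mul E).
Local Notation add := (ec_add E).

Lemma ec_mulS n P : mul n.+1 P = add P (mul n P). Proof. by []. Qed.
Lemma ec_mul1 P : mul 1 P = P. Proof. by case: P => [[]|]. Qed.
Lemma ec_add0 P : add P None = P. Proof. by case: P => [[]|]. Qed.
Lemma ec_mul2 P : mul 2 P = add P P. Proof. by rewrite ec_mulS ec_mul1. Qed.

Lemma on_curve_mul n P : on_curve E P -> on_curve E (mul n P).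
Proof. by move=> onP; elim: n => // n ih; apply: on_curve_add. Qed.

Lemma ec_mulD m n P : on_curve E P -> mul (m + n) P = add (mul m P) (mul n P).
Proof.
move=> onP; elim: m => [|m ih] //.
by rewrite addSn !ec_mulS ih ec_addA //; apply: on_curve_mul.
Qed.

Lemma ec_mulM m n P : on_curve E P -> mul (m * n) P = mul m (mul n P).
Proof. by move=> onP; elim: m => [|m ih] //; rewrite mulSn ec_mulD // ih. Qed.

Lemma ec_mul_None n : mul n None = None. Proof. by elim: n. Qed.

Lemma ec_mul_add n P Q : on_curve E P -> on_curve E Q ->
  mul n (add P Q) = add (mul n P) (mul n Q).
Proof.
move=> onP onQ; have onC := on_curve_mul _ onP; have onD := on_curve_mul _ onQ.
elim: n => // n ih; rewrite !ec_mulS ih.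
have onA := on_curve_add two0 ellE; rewrite -!ec_addA // ?onA //; congr (add P _).
by rewrite !ec_addA // ?onA // [add Q _]ec_addC.
Qed.

Lemma point_of_orderP n P : point_of_order E n P ->
  forall m, (mul m P == None) = (n %| m)%N.
Proof.
case=> onP n0 nP min m; rewrite [in LHS](divn_eq m n) ec_mulD // ec_mulM // nP.
rewrite ec_mul_None /= /dvdn; case: (posnP (m %% n)) => [-> //|h].
by apply/eqP; apply: min; rewrite h ltn_mod.
Qed.

Lemma point_of_order_intro n P : on_curve E P -> (0 < n)%N ->
  (forall m, (mul m P == None) = (n %| m)%N) -> point_of_order E n P.
Proof.
move=> onP n0 h; split=> //; first by apply/eqP; rewrite h.
by move=> m /andP[m0 mn] /eqP; rewrite h gtnNdvd.
Qed.

Lemma point_of_order_mul m n P : (0 < m)%N -> (0 < n)%N ->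
  point_of_order E (m * n) P -> point_of_order E m (mul n P).
Proof.
move=> m0 n0 oP; have [onP _ _ _] := oP.
apply: point_of_order_intro => // [|i]; first exact: on_curve_mul.
by rewrite -ec_mulM // (point_of_orderP oP) dvdn_pmul2r.
Qed.

(** The exact order divides [p ^ n.+1] but not [p ^ n]; two multiples are checked instead of all
    smaller ones. *)
Lemma point_of_order_prime_power p n P : prime p -> on_curve E P ->
  mul (p ^ n.+1) P = None -> mul (p ^ n) P <> None ->
  point_of_order E (p ^ n.+1) P.
Proof.
move=> pp onP h0 h1; have hex : exists m, (0 < m)%N && (mul m P == None).
  by exists (p ^ n.+1)%N; rewrite expn_gt0 prime_gt0 // h0 eqxx.
case: (ex_minnP hex) => e /andP[e0 /eqP eP] min.
have oP : point_of_order E e P.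
  split=> // m /andP[m0 me] /eqP mP; have := min m; rewrite m0 mP => /(_ isT).
  by rewrite leqNgt me.
have : (e %| p ^ n.+1)%N by rewrite -(point_of_orderP oP) h0.
move=> /(dvdn_pfactor _ _ pp)[j jn ej]; move: jn; rewrite leq_eqVlt => /orP[/eqP jn|].
  by rewrite -jn -ej.
rewrite ltnS => jn; case: h1; apply/eqP; rewrite (point_of_orderP oP) ej.
exact: dvdn_exp2l.
Qed.

Lemma point_of_order_add m n P Q : coprime m n ->
  point_of_order E m P -> point_of_order E n Q -> point_of_order E (m * n) (add P Q).
Proof.
move=> cop oP oQ; have [onP m0 _ _] := oP; have [onQ n0 _ _] := oQ.
apply: point_of_order_intro; [exact: on_curve_add|by rewrite muln_gt0 m0|].
move=> i; apply/eqP/idP => [h|/dvdnP[j ->]]; last first.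
  rewrite ec_mul_add //.
  have /eqP -> : mul (j * (m * n)) P == None.
    by rewrite (point_of_orderP oP) dvdn_mull // dvdn_mulr.
  by apply/eqP; rewrite /= (point_of_orderP oQ) dvdn_mull // dvdn_mull.
have kP : mul (i * n) P = None.
  have : mul (n * i) (add P Q) = None by rewrite ec_mulM ?h ?ec_mul_None // on_curve_add.
  rewrite ec_mul_add // mulnC.
  have /eqP -> : mul (i * n) Q == None by rewrite (point_of_orderP oQ) dvdn_mull.
  by rewrite ec_add0.
have kQ : mul (i * m) Q = None.
  have : mul (m * i) (add P Q) = None by rewrite ec_mulM ?h ?ec_mul_None // on_curve_add.
  rewrite ec_mul_add // mulnC.
  by have /eqP -> : mul (i * m) P == None by rewrite (point_of_orderP oP) dvdn_mull.
have dm : (m %| i)%N by rewrite -(Gauss_dvdl _ cop) -(point_of_orderP oP) kP.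
have dn : (n %| i)%N.
  by rewrite -(@Gauss_dvdl _ _ m) 1?coprime_sym // -(point_of_orderP oQ) kQ.
by rewrite Gauss_dvd // dm dn.
Qed.

Lemma point_of_order2P P : point_of_order E 2 P <->
  exists2 x, P = Some (x, 0) & x ^+ 3 + a * x ^+ 2 + b * x + d = 0.
Proof.
split=> [oP|[x -> fx]].
  have [+ _ + min] := oP; rewrite ec_mul2; case: P oP min => [[x y]|] oP min onP; last first.
    by have := min 1%N isT.
  have e : y ^+ 2 = x ^+ 3 + a * x ^+ 2 + b * x + d.
    by move/eqP: onP => /= <-; ring.
  case: (ec_add_cases onP onP) => [[_ ey]|[_ _ y0]|/eqP //].
    have y0 : y = 0.
      apply/eqP; have : 2 * y = 0 by rewrite mulr_natl mulr2n {1}ey /=; ring.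
      by move=> /eqP; rewrite mulf_eq0 (negPf two0).
    by exists x; rewrite -?e y0 // expr0n.
  by rewrite ec_add_tangent.
split=> //; first by apply/eqP; rewrite /= fx; ring.
  by rewrite ec_mul2 ec_add_opp //=; ring.
by move=> [|[|m]].
Qed.

End Multiples.

(** * Invariance under substitutions *)

Section Transfer.
Variables (K : fieldType) (a b d u r s t : K).
Local Notation E := (Weierstrass 0 a 0 b d).
Local Notation E' := (wpull u r s t E).
Hypothesis two0 : (2 : K) != 0.
Hypothesis ellE : elliptic E.
Hypothesis u0 : u != 0.
Local Notation wm := (wmap u r s t).

Lemma wmap_mul n P : on_curve E' P ->
  wm (ec_mul E' n P) = ec_mul E n (wm P) /\ on_curve E' (ec_mul E' n P).
Proof.
move=> onP; have onwP : on_curve E (wm P) by rewrite on_curve_wmap.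
elim: n => // n [ih onn]; rewrite !ec_mulS -ih.
rewrite -wmap_add // -(on_curve_wmap r s t u0) wmap_add // ih; split=> //.
by apply: on_curve_add => //; apply: on_curve_mul.
Qed.

Lemma wmap_order n P : point_of_order E n (wm P) <-> point_of_order E' n P.
Proof.
rewrite /point_of_order on_curve_wmap //.
have inj := wmap_inj (r := r) (s := s) (t := t) u0.
split=> -[onP n0 nP min]; have e m := (wmap_mul m onP).1; split=> //.
- by apply: inj; rewrite e.
- by move=> m /min; rewrite -e => h h'; apply: h; rewrite h'.
- by rewrite -e nP.
by move=> m /min h; rewrite -e => h'; apply: h; apply: inj.
Qed.

Lemma one_point_wpull n :
  one_point_of_order_2_and_point_of_order E' n <->
  one_point_of_order_2_and_point_of_order E n.
Proof.
have [w' wK w'K] : bijective wm by exact: (Bijective (wmapK _ _ _ u0) (wmapVK _ _ _ u0)).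
split=> -[[T [oT uT]] [P oP]]; split.
- exists (wm T); split; first exact/wmap_order.
  by move=> Q; rewrite -(w'K Q) => /wmap_order/uT <-.
- by exists (wm P); apply/wmap_order.
- exists (w' T); split; first by apply/wmap_order; rewrite w'K.
  by move=> Q /wmap_order/uT ->; rewrite wK.
by exists (w' P); apply/wmap_order; rewrite w'K.
Qed.

Lemma elliptic_wpull (W : weierstrass K) : elliptic (wpull u r s t W) = elliptic W.
Proof.
rewrite /elliptic; have -> : disc W = u ^+ 12 * disc (wpull u r s t W).
  by rewrite /disc /wpull /=; field.
by rewrite mulf_eq0 expf_eq0 (negPf u0).
Qed.

End Transfer.

(** * Curves with a unique point of order two *)

Section Equivalence.
Variable K : fieldType.
Hypothesis two0 : (2 : K) != 0.
Implicit Types (E W : weierstrass K) (p q x y : K).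

Definition wequiv E W : Prop := exists u r s t, u != 0 /\ E = wpull u r s t W.

Lemma isomorphic_wequiv E W : isomorphic E W <-> wequiv E W.
Proof.
split; first exact: isomorphic_wpull.
by case=> u [r [s [t [u0 ->]]]]; apply: wpull_isomorphic.
Qed.

Lemma wequiv_sym E W : wequiv E W -> wequiv W E.
Proof.
case=> u [r [s [t [u0 ->]]]].
exists u^-1, (- r / u ^+ 2), (- s / u ^+ 5), ((r * s - t * u ^+ 2) / u ^+ 5).
by rewrite wpullK ?invr_eq0.
Qed.

Lemma wequiv_trans E W V : wequiv E W -> wequiv W V -> wequiv E V.
Proof.
case=> u [r [s [t [u0 ->]]]] [u' [r' [s' [t' [u'0 ->]]]]].
rewrite wpull_wpull //; do 4 eexists; split; last by reflexivity.
by rewrite mulf_neq0.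
Qed.

Definition torsion_curve p q : weierstrass K := Weierstrass 0 p 0 q 0.

Lemma elliptic_torsion_curve p q :
  elliptic (torsion_curve p q) = (q != 0) && (p ^+ 2 - 4 * q != 0).
Proof.
rewrite /elliptic.
have -> : disc (torsion_curve p q) = 2 ^+ 4 * (q ^+ 2 * (p ^+ 2 - 4 * q)).
  by rewrite /disc /=; ring.
by rewrite mulf_eq0 expf_eq0 (negPf two0) /= mulf_eq0 expf_eq0 negb_or.
Qed.

Lemma wequiv_scale p q c : c != 0 ->
  wequiv (torsion_curve p q) (torsion_curve (p * c ^+ 2) (q * c ^+ 4)).
Proof.
move=> c0; exists c, 0, 0, 0; split=> //.
by rewrite /wpull /torsion_curve /=; congr Weierstrass; field.
Qed.

(** The left curve is [y^2 = (x^2 + p x + q)(x + e)]; its root [- e] is moved to the origin. *)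
Lemma wequiv_shift p q e :
  wequiv (Weierstrass 0 (p + e) 0 (q + e * p) (e * q))
    (torsion_curve (p - 2 * e) (q - e * p + e ^+ 2)).
Proof.
exists 1, e, 0, 0; split; first exact: oner_neq0.
by rewrite /wpull /torsion_curve /=; congr Weierstrass; field; exact: oner_neq0.
Qed.

Lemma nonsquare_div c x y : x = c ^+ 2 * y -> ~ is_square x -> ~ is_square y.
Proof. by move=> -> h [z e]; apply: h; exists (c * z); rewrite e exprMn. Qed.

Lemma nonsquare_mul c x y : c != 0 -> x = c ^+ 2 * y ->
  ~ is_square y -> ~ is_square x.
Proof.
move=> c0 e; apply: (@nonsquare_div c^-1).
by rewrite e exprVn mulKf ?expf_neq0.
Qed.

Lemma order2_torsion_curve p q P : ~ is_square (p ^+ 2 - 4 * q) ->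
  point_of_order (torsion_curve p q) 2 P <-> P = Some (0, 0).
Proof.
move=> nsq; rewrite point_of_order2P //; split=> [[x -> e]|->]; last first.
  by exists 0 => //; rewrite !expr0n /= !mulr0 !addr0.
have [-> //|x0] := eqVneq x 0; case: nsq; exists (2 * x + p).
have e' : x ^+ 2 + p * x + q = 0.
  by apply: (mulfI x0); rewrite mulr0 -[RHS]e; ring.
by rewrite -[LHS]addr0 -(mulr0 4) -e'; ring.
Qed.

Lemma one_point_torsion_curve p q n : ~ is_square (p ^+ 2 - 4 * q) ->
  one_point_of_order_2_and_point_of_order (torsion_curve p q) n <->
  exists P, point_of_order (torsion_curve p q) n P.
Proof.
move=> nsq; split=> [[]//|h]; split=> //; exists (Some (0, 0)).
by split=> [|P]; rewrite order2_torsion_curve.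
Qed.

Lemma one_point_wequiv E p q n : elliptic E ->
  wequiv E (torsion_curve p q) ->
  (one_point_of_order_2_and_point_of_order E n <->
   one_point_of_order_2_and_point_of_order (torsion_curve p q) n).
Proof.
move=> + [u [r [s [t [u0 eE]]]]]; rewrite eE elliptic_wpull // => ell.
exact: one_point_wpull.
Qed.

(* Completing the square and moving the point of order 2 to the origin. *)
Lemma normal_form E n : elliptic E ->
  one_point_of_order_2_and_point_of_order E n ->
  exists p q, [/\ elliptic (torsion_curve p q), ~ is_square (p ^+ 2 - 4 * q),
    wequiv E (torsion_curve p q)
    & exists P, point_of_order (torsion_curve p q) n P].
Proof.
move=> ellE one; have four0 : (4 : K) != 0.
  have -> : (4 : K) = 2 * 2 by ring.
  by rewrite mulf_neq0.
pose a := a2 E + a1 E ^+ 2 / 4; pose b := a4 E + a1 E * a3 E / 2.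
pose d := a6 E + a3 E ^+ 2 / 4; pose S := Weierstrass 0 a 0 b d.
have eS : E = wpull 1 0 (a1 E / 2) (a3 E / 2) S.
  rewrite /S /a /b /d; case: (E) => b1 b2 b3 b4 b6; rewrite /wpull /=.
  by congr Weierstrass; field; rewrite ?oner_neq0 ?two0 ?four0.
have ellS : elliptic S by rewrite eS elliptic_wpull ?oner_neq0 in ellE.
have [[T [oT _]] _] : one_point_of_order_2_and_point_of_order S n.
  by move: one; rewrite {1}eS one_point_wpull ?oner_neq0.
have [e _ fe] := (point_of_order2P a b d two0 T).1 oT.
(* Coefficients of the cubic expanded at its root [e]. *)
pose p := 3 * e + a; pose q := 3 * e ^+ 2 + 2 * a * e + b.
have eC : S = wpull 1 (- e) 0 0 (torsion_curve p q).
  rewrite /wpull /torsion_curve /S /=.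
  have -> : d = - (e ^+ 3 + a * e ^+ 2 + b * e) by apply/eqP; rewrite -addr_eq0 addrC fe.
  by rewrite /p /q; congr Weierstrass; field; rewrite ?oner_neq0.
have ellC : elliptic (torsion_curve p q) by rewrite eC elliptic_wpull ?oner_neq0 in ellS.
have eqv : wequiv E (torsion_curve p q).
  apply: (@wequiv_trans _ S).
    by exists 1, 0, (a1 E / 2), (a3 E / 2); rewrite oner_neq0.
  by exists 1, (- e), 0, 0; rewrite oner_neq0.
have [[T' [oT' uT']] exP] := (one_point_wequiv n ellE eqv).1 one.
(* A square root [v] of [p ^+ 2 - 4 * q] gives the root [(v - p) / 2] of the quadratic factor.
   Uniqueness of the point of order 2 makes it 0, so [q = 0], against ellipticity. *)
exists p, q; split=> // -[v ev].
have h x : x ^+ 3 + p * x ^+ 2 + q * x + 0 = 0 -> T' = Some (x, 0).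
  by move=> fx; apply: uT'; apply/(point_of_order2P _ _ _ two0); exists x.
have e1 := h 0; have e2 := h ((v - p) / 2).
move: ellC; rewrite elliptic_torsion_curve => /andP[q0 _].
have {}e1 : T' = Some (0, 0) by apply: e1; rewrite !expr0n /= !mulr0 !addr0.
have qE : q = (p ^+ 2 - v ^+ 2) / 4 by rewrite -ev; field.
have {}e2 : T' = Some ((v - p) / 2, 0).
  by apply: e2; rewrite qE; field; rewrite two0 four0.
case: (etrans (esym e1) e2) => /esym/eqP; rewrite mulf_eq0 invr_eq0 (negPf two0) orbF.
by rewrite subr_eq0 => /eqP vp; move: q0; rewrite qE vp subrr mul0r eqxx.
Qed.

End Equivalence.

(** * Parameters attached to points of small order *)

Section Torsion.
Variables (K : fieldType) (p q : K).
Hypothesis two0 : (2 : K) != 0.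
Local Notation C := (torsion_curve p q).
Local Notation T := (Some (0, 0) : point K).
Hypothesis ellC : elliptic C.
Hypothesis nsq : ~ is_square (p ^+ 2 - 4 * q).
Implicit Types (x y l : K).

Lemma on_torsion_curve x y :
  on_curve C (Some (x, y)) <-> y ^+ 2 = x ^+ 3 + p * x ^+ 2 + q * x.
Proof.
split=> [/eqP /= e|e]; first by rewrite -[RHS]addr0 -e; ring.
by apply/eqP; rewrite /= -e; ring.
Qed.

Lemma double_torsion_curve x y l : y != 0 ->
  2 * y * l = 3 * x ^+ 2 + 2 * p * x + q ->
  ec_mul C 2 (Some (x, y)) =
    Some (l ^+ 2 - p - 2 * x, l * (3 * x + p - l ^+ 2) - y).
Proof.
move=> y0 el; have d0 : 2 * y + 0 * x + 0 != 0 by rewrite mul0r !addr0 mulf_neq0.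
rewrite ec_mul2 ec_add_tangent //= -/(torsion_curve p q).
set s := _ / _; have -> : s = l.
  apply: (mulIf d0); rewrite /s divfK //.
  by rewrite (_ : l * _ = 2 * y * l); [rewrite el; ring|ring].
by rewrite /chord /=; congr (Some (_, _)); ring.
Qed.

Lemma point_of_order_y0 n x y : (2 < n)%N ->
  point_of_order C n (Some (x, y)) -> y != 0.
Proof.
move=> n2 [onP _ _ min]; apply/eqP => y0; apply: (min 2%N); first by rewrite n2.
by rewrite ec_mul2 ec_add_opp // y0 /=; ring.
Qed.

Lemma point_of_order_half n P : (0 < n)%N ->
  point_of_order C (2 * n) P -> ec_mul C n P = T.
Proof.
move=> n0 oP; apply/(order2_torsion_curve two0 _ nsq).
by apply: point_of_order_mul => //; rewrite mulnC.
Qed.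

Lemma tangent_slope x y : y != 0 ->
  exists l, 2 * y * l = 3 * x ^+ 2 + 2 * p * x + q.
Proof.
move=> y0; exists ((3 * x ^+ 2 + 2 * p * x + q) / (2 * y)).
by rewrite mulrC divfK ?mulf_neq0.
Qed.

(** The origin is its own opposite, so the tangent at a half of it passes through the origin, whence
    [y = l * x]. *)
Lemma half_origin x y : ec_mul C 2 (Some (x, y)) = T -> y != 0 ->
  exists l, [/\ y = l * x, l ^+ 2 = p + 2 * x & x ^+ 2 = q].
Proof.
move=> e y0; have [l el] := tangent_slope x y0; exists l.
move: e; rewrite (double_torsion_curve y0 el) => -[] e1 e2.
have l2 : l ^+ 2 = p + 2 * x.
  by apply/eqP; rewrite -subr_eq0 -e1; apply/eqP; ring.
have yE : y = l * x.
  by rewrite -[LHS]addr0 -e2 l2; ring.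
split=> //; apply: (mulfI two0).
have : 2 * x * l ^+ 2 = 3 * x ^+ 2 + 2 * p * x + q by rewrite -el yE; ring.
rewrite l2 => h; apply/eqP; rewrite -subr_eq0.
have -> : 2 * x ^+ 2 - 2 * q = 2 * (2 * x * (p + 2 * x) - (3 * x ^+ 2 + 2 * p * x + q)) by ring.
by rewrite h subrr mulr0.
Qed.

(** The duplication formula when [(0, 0)] has order 2: abscissas of doubles are squares with an
    explicit root. *)
Lemma double_x_square x y x' y' : on_curve C (Some (x, y)) -> y != 0 ->
  ec_mul C 2 (Some (x, y)) = Some (x', y') ->
  x' = ((x ^+ 2 - q) / (2 * y)) ^+ 2.
Proof.
move=> /on_torsion_curve onP y0; have [l el] := tangent_slope x y0.
rewrite (double_torsion_curve y0 el) => -[] <- _.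
have -> : l = (3 * x ^+ 2 + 2 * p * x + q) / (2 * y).
  by rewrite -el mulrC mulKf // mulf_neq0.
have d0 : 2 * y != 0 by rewrite mulf_neq0.
rewrite !expr_div_n; apply: (mulIf (expf_neq0 2 d0)).
rewrite !mulrBl !divfK ?expf_neq0 // exprMn onP; ring.
Qed.

Lemma order4_param P : point_of_order C 4 P -> exists l x,
  [/\ P = Some (x, l * x), p = l ^+ 2 - 2 * x, q = x ^+ 2, x != 0 & l != 0].
Proof.
move=> oP; have h := point_of_order_half (n := 2) isT oP.
case: P oP h => [[x y]|] // oP h.
have y0 := point_of_order_y0 (n := 4) isT oP.
have [l [yE l2 x2]] := half_origin h y0; exists l, x.
have [x0 l0] : x != 0 /\ l != 0.
  by apply/andP; rewrite -negb_or -mulf_eq0 mulrC -yE.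
by split=> //; rewrite ?yE ?l2 ?x2 //; ring.
Qed.

(** A point of order 3 is a flex: the cubic minus the square of its tangent is the cube of [X - x].
    At [X = 0] this reads [x ^+ 3 = (y - l * x) ^+ 2], so [x] is the square of
    [w = (y - l * x) / x]. *)
Lemma order3_param P : point_of_order C 3 P -> exists l w,
  [/\ w != 0, P = Some (w ^+ 2, w ^+ 3 + l * w ^+ 2), p = l ^+ 2 - 3 * w ^+ 2
    & q = 2 * w ^+ 3 * l + 3 * w ^+ 4].
Proof.
move=> oP; have [onP _ P3 _] := oP.
case: P oP onP P3 => [[x y]|] oP onP P3; last by have [_ _ _ /(_ 1%N isT)] := oP.
have y0 := point_of_order_y0 (n := 3) isT oP.
have [l el] := tangent_slope x y0.
have l2 : l ^+ 2 - p - 2 * x = x.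
  move: P3; rewrite ec_mulS (double_torsion_curve y0 el).
  set x' := _ - 2 * x; set y' := _ - y => P3.
  apply/eqP/negPn/negP => ne; move: P3; rewrite ec_add_secant //.
  by rewrite eq_sym.
move/on_torsion_curve : onP => onP.
have pE : p = l ^+ 2 - 3 * x.
  by rewrite -[LHS]addr0 -(subrr x) -{1}l2; ring.
have qE : q = 2 * y * l - 3 * x ^+ 2 - 2 * p * x by rewrite el; ring.
have x3 : x ^+ 3 = (y - l * x) ^+ 2.
  have -> : (y - l * x) ^+ 2 = y ^+ 2 - 2 * y * l * x + l ^+ 2 * x ^+ 2 by ring.
  by rewrite onP qE pE; ring.
have x0 : x != 0.
  apply: contraNneq y0 => x0; move/eqP: onP.
  by rewrite x0 !expr0n /= !mulr0 !addr0 expf_eq0.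
pose w := (y - l * x) / x; have wx : w ^+ 2 = x.
  by rewrite expr_div_n -x3 exprS mulfK ?expf_neq0.
have yE : y = w ^+ 3 + l * w ^+ 2.
  by rewrite exprSr wx [_ * w]mulrC /w divfK // subrK.
exists l, w; split.
- by apply: contraNneq x0 => w0; rewrite -wx w0 expr0n.
- by rewrite -yE wx.
- by rewrite wx.
by rewrite qE pE yE (exprM w 2 2) wx; ring.
Qed.

End Torsion.

Section TorsionPoints.
Variables (K : fieldType).
Hypothesis two0 : (2 : K) != 0.
Implicit Types (p q x y l : K).
Local Notation C := torsion_curve.
Local Notation T := (Some (0, 0) : point K).

Lemma ec_add_None (E : weierstrass K) x1 y1 x2 y2 :
  ec_add E (Some (x1, y1)) (Some (x2, y2)) = None -> x1 = x2.
Proof.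
by case: (eqVneq x1 x2) => // ne; rewrite ec_add_secant.
Qed.

Lemma order_scale p q c n x y : c != 0 -> elliptic (C p q) ->
  point_of_order (C p q) n (Some (x, y)) ->
  point_of_order (C (p * c ^+ 2) (q * c ^+ 4)) n (Some (c ^+ 2 * x, c ^+ 3 * y)).
Proof.
move=> c0 ell oP; have eC : C p q = wpull c 0 0 0 (C (p * c ^+ 2) (q * c ^+ 4)).
  by rewrite /wpull /torsion_curve /=; congr Weierstrass; field.
have -> : Some (c ^+ 2 * x, c ^+ 3 * y) = wmap c 0 0 0 (Some (x, y)).
  by rewrite /= mul0r !addr0.
rewrite eC elliptic_wpull // in ell.
by apply/(wmap_order 0 0 0 two0 ell c0); rewrite -eC.
Qed.

(** Here [x] is also the abscissa of the fourth multiple, which is a double. *)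
Lemma order5_square p q x y : elliptic (C p q) ->
  point_of_order (C p q) 5 (Some (x, y)) -> exists2 w, w != 0 & x = w ^+ 2.
Proof.
move=> ell oP; have [onP _ P5 min] := oP.
have y0 := point_of_order_y0 (n := 5) isT oP.
have [l el] := tangent_slope p q two0 x y0.
have e2 := double_torsion_curve two0 y0 el.
set x2 := _ - 2 * x in e2; set y2 := _ - y in e2.
have on2 : on_curve (C p q) (Some (x2, y2)) by rewrite -e2; apply: on_curve_mul.
have e4 : ec_mul (C p q) 4 (Some (x, y)) = ec_mul (C p q) 2 (Some (x2, y2)).
  by rewrite (@ec_mulM _ _ _ _ two0 ell 2 2) // e2.
have y20 : y2 != 0.
  apply/eqP => y20; apply: (min 4%N) => //.
  by rewrite e4 ec_mul2 ec_add_opp // y20 /=; ring.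
case e4' : (ec_mul (C p q) 2 (Some (x2, y2))) => [[x4 y4]|]; last first.
  by case: (min 4%N) => //; rewrite e4.
have := double_x_square two0 on2 y20 e4'.
have -> : x4 = x by move: P5; rewrite ec_mulS e4 e4' => /ec_add_None.
set w := (_ / _) => xw; exists w => //.
apply: contraNneq y0 => w0; move/on_torsion_curve/eqP: onP.
by rewrite xw w0 !expr0n /= !mulr0 !addr0 expf_eq0.
Qed.

(** By duplication the double has abscissa [r ^+ 2] with [r = (1 - q) / (2 * y)]. The abscissa of
    the fourth multiple is again 1, which gives an equation between [r] and [y] up to a sign. *)
Lemma order5_param p q y : elliptic (C p q) ->
  point_of_order (C p q) 5 (Some (1, y)) ->
  exists r Y, [/\ r != 0, r ^+ 2 != 1, 2 * Y * r = - ((r + 1) * (r ^+ 2 - 1)),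
    p = Y ^+ 2 - 2 + 2 * Y * r & q = 1 - 2 * Y * r].
Proof.
move=> ell oP; have [onP _ P5 min] := oP.
have y0 := point_of_order_y0 (n := 5) isT oP.
have onP' := (on_torsion_curve _ _ _ _).1 onP.
pose r : K := (1 - q) / (2 * y).
have qE : q = 1 - 2 * y * r.
  by rewrite /r mulrC divfK ?mulf_neq0 // subKr.
have pE : p = y ^+ 2 - 2 + 2 * y * r by rewrite onP' qE; ring.
clearbody r.
have el : 2 * y * (y + r) = 3 * 1 ^+ 2 + 2 * p * 1 + q by rewrite pE qE; ring.
have := double_torsion_curve two0 y0 el.
have -> : (y + r) ^+ 2 - p - 2 * 1 = r ^+ 2 by rewrite pE; ring.
set y2 := _ - y => e2; have y2E : y2 = r * (1 - r ^+ 2 - y * r) by rewrite /y2 pE; ring.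
clearbody y2.
have on2 : on_curve (C p q) (Some (r ^+ 2, y2)) by rewrite -e2; apply: on_curve_mul.
have e4 : ec_mul (C p q) 4 (Some (1, y)) = ec_mul (C p q) 2 (Some (r ^+ 2, y2)).
  by rewrite (@ec_mulM _ _ _ _ two0 ell 2 2) // e2.
have y20 : y2 != 0.
  apply/eqP => y20; apply: (min 4%N) => //.
  by rewrite e4 ec_mul2 ec_add_opp // y20 /=; ring.
have r0 : r != 0 by apply: contraNneq y20 => r0; rewrite y2E r0 mul0r.
have r1 : r ^+ 2 != 1.
  apply/eqP => r1; rewrite r1 in on2 e2 e4.
  case: (ec_add_cases onP on2) => [[_ ey]|[_ ey _]|]; last by rewrite eqxx.
    by case: (min 3%N) => //; rewrite ec_mulS e2 ec_add_opp.
  have := P5; rewrite ec_mulS e4 -ey e2 -ey -ec_mul2; exact: min.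
case e4' : (ec_mul (C p q) 2 (Some (r ^+ 2, y2))) => [[x4 y4]|]; last first.
  by case: (min 4%N) => //; rewrite e4.
have := double_x_square two0 on2 y20 e4'.
have -> : x4 = 1 by move: P5; rewrite ec_mulS e4 e4' => /ec_add_None.
move=> /esym/eqP; rewrite sqrf_eq1 => /orP h.
have y22 : 2 * y2 != 0 by rewrite mulf_neq0.
have [r1a r1b] : r - 1 != 0 /\ r + 1 != 0.
  by apply/andP; rewrite -negb_or -mulf_eq0 -subr_sqr_1 subr_eq0.
(* The sign is [e]. The factor [r + e] is spurious, since [r ^+ 2 = 1] would make the double equal
   to the point or its opposite. *)
have root_of (e : K) : (r ^+ 2) ^+ 2 - q = e * (2 * y2) -> e ^+ 2 = 1 ->
    (r + e) * (2 * y * r * e + (r + e) * (r ^+ 2 - 1)) = 0.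
  rewrite qE y2E => he e1; rewrite -(subrr ((r ^+ 2) ^+ 2 - (1 - 2 * y * r))) {2}he.
  have -> : (r + e) * (2 * y * r * e + (r + e) * (r ^+ 2 - 1)) =
    r ^+ 4 - e ^+ 2 + 2 * y * r * e ^+ 2 + (e ^+ 2 - 1) * r ^+ 2
     - e * (2 * (r * (1 - r ^+ 2 - y * r))) by ring.
  by rewrite e1; ring.
case: h => /eqP hx.
  have h : (r ^+ 2) ^+ 2 - q = 1 * (2 * y2) by rewrite -[LHS](divfK y22) hx.
  exists r, y; split=> //; have := root_of _ h (expr1n _ 2).
  by move=> /eqP; rewrite mulf_eq0 (negPf r1b) mulr1 addr_eq0 => /eqP.
have h : (r ^+ 2) ^+ 2 - q = -1 * (2 * y2) by rewrite -[LHS](divfK y22) hx.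
(* The formulas for [p] and [q] are unchanged when both signs flip, which absorbs the sign. *)
exists (- r), (- y); split; rewrite ?oppr_eq0 ?sqrrN //.
- have := root_of _ h (etrans (sqrrN _) (expr1n _ 2)) => /eqP.
  rewrite mulf_eq0 (negPf r1a) addr_eq0 => /eqP e.
  have -> : 2 * - y * - r = - (2 * y * r * -1) by ring.
  by rewrite e; ring.
- by rewrite pE; ring.
by rewrite qE; ring.
Qed.

(** The double of [P] has order 4 and abscissa [g ^+ 2]. Scaling by [g] puts it at abscissa 1, and
    the last equation is then the duplication formula for the scaled abscissa of [P]. *)
Lemma order8_param p q P : elliptic (C p q) -> ~ is_square (p ^+ 2 - 4 * q) ->
  point_of_order (C p q) 8 P -> exists g L X, [/\ g != 0, X != 0,
    p = g ^+ 2 * (L ^+ 2 - 2), q = g ^+ 4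
    & (X ^+ 2 - 1) ^+ 2 = 4 * X * (X ^+ 2 + (L ^+ 2 - 2) * X + 1)].
Proof.
move=> ell nsq oP.
have [l [x [e2 pE qE x0 l0]]] := order4_param two0 ell nsq
  (@point_of_order_mul _ _ _ _ two0 ell 4 2 P isT isT oP).
case: P oP e2 => [[X Y]|] oP e2; last by have [_ _ _ /(_ 1%N isT)] := oP.
have Y0 := point_of_order_y0 (n := 8) isT oP; have [onP _ _ _] := oP.
have xE := double_x_square two0 onP Y0 e2.
move/on_torsion_curve : onP => onP.
set g := (_ / _) in xE.
have g0 : g != 0 by apply: contraNneq x0 => g0; rewrite xE g0 expr0n.
have hg : X ^+ 2 - q = g * (2 * Y) by rewrite /g divfK ?mulf_neq0.
have X0 : X != 0.
  apply: contraNneq Y0 => X0; move/eqP: onP.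
  by rewrite X0 !expr0n /= !mulr0 !addr0 expf_eq0.
have qE' : q = g ^+ 4 by rewrite qE xE -exprM.
exists g, (l / g), (X / g ^+ 2); split=> //.
- by rewrite mulf_neq0 ?invr_eq0 ?expf_neq0.
- by rewrite pE xE; field.
have h1 : (X ^+ 2 - g ^+ 4) ^+ 2 = 4 * g ^+ 2 * (X ^+ 3 + p * X ^+ 2 + q * X).
  by rewrite -onP -qE' hg; ring.
rewrite pE qE' xE in h1.
have -> : ((X / g ^+ 2) ^+ 2 - 1) ^+ 2 = (X ^+ 2 - g ^+ 4) ^+ 2 / g ^+ 8 by field.
by rewrite h1; field.
Qed.

Lemma double_half p q x l : p = l ^+ 2 - 2 * x -> q = x ^+ 2 -> x != 0 -> l != 0 ->
  ec_mul (C p q) 2 (Some (x, l * x)) = T.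
Proof.
move=> pE qE x0 l0; rewrite (@double_torsion_curve _ _ _ two0 _ _ l) ?mulf_neq0 //.
  by rewrite pE; congr (Some (_, _)); ring.
by rewrite pE qE; ring.
Qed.

Lemma double_origin p q : ec_mul (C p q) 2 T = None.
Proof. by rewrite ec_mul2 ec_add_opp //=; ring. Qed.

Lemma order4_intro p q x l : elliptic (C p q) ->
  p = l ^+ 2 - 2 * x -> q = x ^+ 2 -> x != 0 -> l != 0 ->
  point_of_order (C p q) 4 (Some (x, l * x)).
Proof.
move=> ell pE qE x0 l0; have onP : on_curve (C p q) (Some (x, l * x)).
  by apply/on_torsion_curve; rewrite pE qE; ring.
have e2 := double_half pE qE x0 l0.
apply: (@point_of_order_prime_power _ _ _ _ two0 ell 2 1) => //; last by rewrite e2.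
by rewrite (@ec_mulM _ _ _ _ two0 ell 2 2) // e2 double_origin.
Qed.

Lemma order3_intro p q x y l : elliptic (C p q) -> on_curve (C p q) (Some (x, y)) ->
  y != 0 -> 2 * y * l = 3 * x ^+ 2 + 2 * p * x + q -> l ^+ 2 = p + 3 * x ->
  point_of_order (C p q) 3 (Some (x, y)).
Proof.
move=> ell onP y0 el l2.
apply: (@point_of_order_prime_power _ _ _ _ two0 ell 3 0) => //.
rewrite ec_mulS (double_torsion_curve two0 y0 el) l2.
have -> : p + 3 * x - p - 2 * x = x by ring.
by rewrite ec_add_opp //=; ring.
Qed.

Lemma order5_intro p q r Y : elliptic (C p q) ->
  r != 0 -> r ^+ 2 != 1 -> 2 * Y * r = - ((r + 1) * (r ^+ 2 - 1)) ->
  p = Y ^+ 2 - 2 + 2 * Y * r -> q = 1 - 2 * Y * r ->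
  point_of_order (C p q) 5 (Some (1, Y)).
Proof.
move=> ell r0 r1 YE pE qE.
have [r1a r1b] : r - 1 != 0 /\ r + 1 != 0.
  by apply/andP; rewrite -negb_or -mulf_eq0 -subr_sqr_1 subr_eq0.
have Y0 : Y != 0.
  apply: contraTneq (mulf_neq0 r1b r1a) => Y0; rewrite negbK.
  have : (r + 1) * (r ^+ 2 - 1) = 0 by rewrite -[LHS]opprK -YE Y0; ring.
  by move=> /eqP; rewrite subr_sqr_1 !mulf_eq0 (negPf r1a) (negPf r1b).
have onP : on_curve (C p q) (Some (1, Y)).
  by apply/on_torsion_curve; rewrite pE qE; ring.
have el : 2 * Y * (Y + r) = 3 * 1 ^+ 2 + 2 * p * 1 + q by rewrite pE qE; ring.
have := double_torsion_curve two0 Y0 el.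
have -> : (Y + r) ^+ 2 - p - 2 * 1 = r ^+ 2 by rewrite pE; ring.
set y2 := _ - Y => e2; have y2E : y2 = r * (1 - r ^+ 2 - Y * r) by rewrite /y2 pE; ring.
clearbody y2.
have YE' : Y = - ((r + 1) * (r ^+ 2 - 1)) / (2 * r).
  by rewrite -YE; field; rewrite ?r0 ?two0.
have y20 : y2 != 0.
  have -> : y2 = r * (r - 1) ^+ 2 * (r + 1) / 2 by rewrite y2E YE'; field; rewrite ?r0 ?two0.
  by rewrite !mulf_neq0 ?invr_eq0 ?expf_neq0.
(* The slope of the tangent at the double [(r ^+ 2, y2)], with [Y] eliminated. *)
pose l2 := (r ^+ 3 - r ^+ 2 + r + 1) / (2 * r).
have el2 : 2 * y2 * l2 = 3 * (r ^+ 2) ^+ 2 + 2 * p * r ^+ 2 + q.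
  by rewrite pE qE y2E YE' /l2; field; rewrite ?r0 ?two0.
have e4 := double_torsion_curve two0 y20 el2.
have e44 : ec_mul (C p q) 4 (Some (1, Y)) = Some (1, - Y).
  rewrite (@ec_mulM _ _ _ _ two0 ell 2 2) // e2 e4 pE y2E YE' /l2.
  by congr (Some (_, _)); field; rewrite ?r0 ?two0.
apply: (@point_of_order_prime_power _ _ _ _ two0 ell 5 0) => //.
by rewrite ec_mulS e44 ec_add_opp //=; ring.
Qed.

Lemma order2_mul_odd p q n P : elliptic (C p q) -> odd n ->
  point_of_order (C p q) n P -> exists Q, point_of_order (C p q) (2 * n) Q.
Proof.
move=> ell on oP; exists (ec_add (C p q) T P).
apply: point_of_order_add => //; first by rewrite coprime2n.
by apply/point_of_order2P => //; exists 0 => //; ring.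
Qed.

End TorsionPoints.

(** * The five families *)

Section Families.
Variable K : fieldType.
Hypothesis charK : 2%N \notin [pchar K].
Implicit Types (E : weierstrass K) (a b t p q : K).
Local Notation C := (@torsion_curve K).

Let two0 : (2 : K) != 0 := two_neq0 charK.

Let four0 : (4 : K) != 0.
Proof. by rewrite (_ : 4 = 2 ^+ 2); [rewrite expf_neq0|ring]. Qed.

Let n16 : (16 : K) != 0.
Proof. by rewrite (_ : 16 = 2 ^+ 4); [rewrite expf_neq0|ring]. Qed.

Lemma elliptic_wequiv E (W : weierstrass K) : wequiv E W -> elliptic E = elliptic W.
Proof. by case=> u [r [s [t [u0 ->]]]]; apply: elliptic_wpull. Qed.

(** Ellipticity of the normal form is inherited from [E], so torsion points on it may be exhibited
    under that assumption. *)
Lemma one_point_isomorphic E (W : weierstrass K) p q n : elliptic E ->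
  wequiv W (C p q) -> ~ is_square (p ^+ 2 - 4 * q) ->
  (elliptic (C p q) -> exists P, point_of_order (C p q) n P) ->
  isomorphic E W -> one_point_of_order_2_and_point_of_order E n.
Proof.
move=> ellE eW nsq ex /isomorphic_wequiv eEW.
have eE := wequiv_trans eEW eW.
apply/(one_point_wequiv two0 n ellE eE)/(one_point_torsion_curve two0 n nsq)/ex.
by rewrite -(elliptic_wequiv eE).
Qed.

Lemma E4E a b : E4 a b = C (a ^+ 2 + 2 * b) (b ^+ 2).
Proof.
rewrite /E4 -[X in _ * X]addr0 -polyC0 curve_quadXlinear.
by rewrite /torsion_curve addr0 !mul0r addr0.
Qed.

Lemma E8E t :
  E8 t = C (2 * ((t ^+ 4 + 2 * t ^+ 2 - 1) / (t ^+ 2 - 1) ^+ 2)) 1.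
Proof.
rewrite /E8 -[X in _ * X]addr0 -polyC0 -[X in (_ + X) * _]polyC1 curve_quadXlinear.
by rewrite /torsion_curve addr0 !mul0r addr0.
Qed.

Lemma wequiv_cubic p q :
  wequiv (curve_of_cubic (('X^2 + p *: 'X + q%:P) * ('X + 1))) (C (p - 2) (q - p + 1)).
Proof.
rewrite -[X in _ * (_ + X)]polyC1 curve_quadXlinear.
by have := wequiv_shift p q 1; rewrite mulr1 mul1r expr1n.
Qed.

Lemma E6E t : wequiv (E6 t) (C (t ^+ 2 + 2 * t - 2) (1 - 2 * t)).
Proof.
have := wequiv_cubic (t ^+ 2 + 2 * t) (t ^+ 2); congr (wequiv _ (C _ _)); ring.
Qed.

(** Scaling makes [w = 1]; comparing [3 + 2 * (l / w)] with [1 - 2 * t] then gives the parameter. *)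
Lemma wequiv_E6 p q l w : w != 0 -> p = l ^+ 2 - 3 * w ^+ 2 ->
  q = 2 * w ^+ 3 * l + 3 * w ^+ 4 -> wequiv (C p q) (E6 (- (1 + l / w))).
Proof.
move=> w0 pE qE; have wV : w^-1 != 0 by rewrite invr_eq0.
apply: (@wequiv_trans _ _ (C ((- (1 + l / w)) ^+ 2 + 2 * (- (1 + l / w)) - 2)
   (1 - 2 * (- (1 + l / w))))); last by apply: wequiv_sym; apply: E6E.
have := wequiv_scale p q wV; congr (wequiv _ (C _ _)).
  by rewrite pE; field.
by rewrite qE; field.
Qed.

(** The parameter is [(1 - c ^+ 2) / 2] for [c = (3 * t ^+ 2 + 1) / (1 - t ^+ 2)]: it makes the
    coefficient [1 - 2 * m] of the normal form of [E6 m] the square [c ^+ 2], as a point of order 4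
    demands. *)
Lemma E12E t : t ^+ 2 - 1 != 0 ->
  E12 t = E6 (- 4 * t ^+ 2 * (t ^+ 2 + 1) / (t ^+ 2 - 1) ^+ 2).
Proof.
move=> d0; rewrite /E12 mulrC /E6.
congr (curve_of_cubic ((_ + _ *: _ + _%:P) * _)); by field.
Qed.

(** Under this change of parameter the excluded values 1 and 0 of [t] correspond to [r = 0] and
    [r = -1], while -1 is not attained. *)
Lemma E10E r Y : r != 0 -> r ^+ 2 != 1 ->
  2 * Y * r = - ((r + 1) * (r ^+ 2 - 1)) ->
  wequiv (E10 ((1 + r) / (1 - r))) (C (Y ^+ 2 - 2 + 2 * Y * r) (1 - 2 * Y * r)).
Proof.
move=> r0 r1 eY.
have [r1a r1b] : r - 1 != 0 /\ r + 1 != 0.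
  by apply/andP; rewrite -negb_or -mulf_eq0 -subr_sqr_1 subr_eq0.
have r1c : 1 - r != 0 by rewrite -opprB oppr_eq0.
have YE : Y = - ((r + 1) * (r ^+ 2 - 1)) / (2 * r).
  by rewrite -eY; field; rewrite ?r0 ?two0.
have d1 : (1 + r) / (1 - r) - 1 = 2 * r / (1 - r) by field.
have d2 : (1 + r) / (1 - r) + 1 = 2 / (1 - r) by field.
rewrite /E10 mulrC; set A := (_ / _); set B := (_ / _).
have := wequiv_cubic A B; congr (wequiv _ (C _ _)).
  by rewrite /A d1 d2 YE; field; rewrite ?r0 ?two0 ?r1c ?four0 ?n16.
by rewrite /A /B d1 d2 YE; field; rewrite ?r0 ?two0 ?r1c ?four0 ?n16.
Qed.

Lemma torsion4 E a : elliptic E -> a != 0 ->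
  (one_point_of_order_2_and_point_of_order E 4 <->
   exists b, [/\ b != 0, ~ is_square (a ^+ 2 + 4 * b) & isomorphic E (E4 a b)]).
Proof.
move=> ellE a0; split=> [/(normal_form two0 ellE)|[b [b0 nsq]]]; last first.
  apply: one_point_isomorphic => //.
  - by rewrite E4E; exists 1, 0, 0, 0; rewrite wpull1 oner_neq0.
  - apply: (nonsquare_mul a0 _ nsq); ring.
  move=> ell; exists (Some (- b, - a * - b)).
  by apply: order4_intro; rewrite ?oppr_eq0 //; ring.
case=> p [q [ell nsq eE [P oP]]].
have [l [x [_ pE qE x0 l0]]] := order4_param two0 ell nsq oP.
(* Scaling by [c] turns the slope [l] into the prescribed [a]. *)
pose c := a / l; have c0 : c != 0 by rewrite mulf_neq0 ?invr_eq0.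
exists (- x * c ^+ 2); split.
- by rewrite mulf_neq0 ?oppr_eq0 ?expf_neq0.
- apply: (@nonsquare_div _ (l ^+ 2 / a) _ _ _ nsq).
  by rewrite pE qE /c; field; rewrite a0 l0.
apply/isomorphic_wequiv; apply: wequiv_trans eE _; rewrite E4E.
have := wequiv_scale p q c0; congr (wequiv _ (C _ _)).
  by rewrite pE /c; field.
by rewrite qE /c; field.
Qed.

Lemma torsion6 E : elliptic E ->
  (one_point_of_order_2_and_point_of_order E 6 <->
   exists t, [/\ t \notin [:: 0; -4; 1 / 2], ~ is_square (t ^+ 2 + 4 * t)
     & isomorphic E (E6 t)]).
Proof.
move=> ellE; split=> [/(normal_form two0 ellE)|[t [tn nsq]]]; last first.
  have t0 : t != 0 by move: tn; rewrite !inE !negb_or => /and3P[].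
  apply: one_point_isomorphic (E6E t) _ _ => //.
    by apply: (nonsquare_mul t0 _ nsq); ring.
  move=> ell; apply: (order2_mul_odd (n := 3) two0 ell) => //.
  apply: (order3_intro two0 (x := 1) (y := t) (l := t + 1)) => //; try ring.
  by apply/on_torsion_curve; ring.
case=> p [q [ell nsq eE [P oP]]].
have o3 := @point_of_order_mul _ _ _ _ two0 ell 3 2 P isT isT oP.
have [l [w [w0 _ pE qE]]] := order3_param two0 o3.
pose t := - (1 + l / w).
have eC : wequiv (C p q) (E6 t) by apply: wequiv_E6.
have nsqt : ~ is_square (t ^+ 2 + 4 * t).
  apply: (@nonsquare_div _ (w ^+ 2 * t) _ _ _ nsq).
  by rewrite pE qE /t; field.
exists t; split=> //; last first.
  by apply/isomorphic_wequiv; apply: wequiv_trans eE eC.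
rewrite (elliptic_wequiv (wequiv_trans eC (E6E t))) elliptic_torsion_curve // in ell.
(* The values 0 and -4 make [t ^+ 2 + 4 * t] zero, hence a square; [1 / 2] makes [q] vanish. *)
rewrite !inE !negb_or; apply/and3P; split; apply/eqP => tE.
- by apply: nsqt; exists 0; rewrite tE; ring.
- by apply: nsqt; exists 0; rewrite tE; ring.
by case/andP: ell => /eqP + _; apply; rewrite tE; field.
Qed.

Lemma torsion8 E : elliptic E ->
  (one_point_of_order_2_and_point_of_order E 8 <->
   exists t, [/\ t \notin [:: 0; 1; -1], ~ is_square (2 * t ^+ 2 - 1)
     & isomorphic E (E8 t)]).
Proof.
move=> ellE; split=> [/(normal_form two0 ellE)|[t [tn nsq]]]; last first.
  have [t0 t1 t2] : [/\ t != 0, t - 1 != 0 & t + 1 != 0].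
    by move: tn; rewrite !inE !negb_or => /and3P[? ? ?]; rewrite subr_eq0 addr_eq0.
  have d0 : t ^+ 2 - 1 != 0 by rewrite subr_sqr_1 mulf_neq0.
  pose p := 2 * ((t ^+ 4 + 2 * t ^+ 2 - 1) / (t ^+ 2 - 1) ^+ 2).
  apply: (@one_point_isomorphic _ _ p 1) => //.
  - by rewrite E8E; exists 1, 0, 0, 0; rewrite wpull1 oner_neq0.
  - apply: (@nonsquare_mul _ (2 ^+ 2 * t ^+ 2 / (t ^+ 2 - 1) ^+ 2) _ _ _ _ nsq).
      by rewrite !mulf_neq0 ?invr_eq0 ?expf_neq0.
    by rewrite /p; field.
  move=> ell.
  pose l := 2 * t ^+ 2 / (t ^+ 2 - 1).
  have l0 : l != 0 by rewrite !mulf_neq0 ?invr_eq0 ?expf_neq0.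
  (* This [x] solves [x ^+ 2 + 1 = (2 - 2 * l) * x], which makes the abscissa of the double equal to
     1, that of the point of order 4. *)
  pose x := (1 - t) / (1 + t); pose y := 2 * t / (1 + t) ^+ 2.
  have t2' : 1 + t != 0 by rewrite addrC.
  have onP : on_curve (C p 1) (Some (x, y)).
    by apply/on_torsion_curve; rewrite /p /x /y; field; rewrite t2' d0.
  have y0 : y != 0 by rewrite !mulf_neq0 ?invr_eq0 ?expf_neq0.
  pose k := (3 * x ^+ 2 + 2 * p * x + 1) / (2 * y).
  have y20 : 2 * y != 0 := mulf_neq0 two0 y0.
  have ek : 2 * y * k = 3 * x ^+ 2 + 2 * p * x + 1 by rewrite mulrC divfK.
  have kE : k = - (t ^+ 2 + 2 * t - 1) / (t ^+ 2 - 1).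
    by rewrite /k /p /x /y; field; rewrite ?t0 ?two0 ?t2' ?d0.
  have e2 : ec_mul (C p 1) 2 (Some (x, y)) = Some (1, l * 1).
    rewrite (double_torsion_curve two0 y0 ek) kE /p /x /y /l.
    by congr (Some (_, _)); field; rewrite t2' d0.
  have e4 : ec_mul (C p 1) 2 (Some (1, l * 1)) = Some (0, 0).
    apply: double_half => //; rewrite ?expr1n ?oner_neq0 //.
    by rewrite /p /l; field.
  have e44 : ec_mul (C p 1) 4 (Some (x, y)) = Some (0, 0).
    by rewrite (@ec_mulM _ _ _ _ two0 ell 2 2) // e2.
  exists (Some (x, y)).
  apply: (@point_of_order_prime_power _ _ _ _ two0 ell 2 2) => //; last by rewrite e44.
  by rewrite (@ec_mulM _ _ _ _ two0 ell 2 4) // e44 double_origin.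
case=> p [q [ell nsq eE [P oP]]].
have [g [L [X [g0 X0 pE qE eX]]]] := order8_param two0 ell nsq oP.
(* The duplication equation is a difference of squares, [(X ^+ 2 + 1 - 2 * X) ^+ 2 = (2 * L * X) ^+
   2]; the sign goes into [L']. *)
have [L' [eL' wE]] : exists L', L' ^+ 2 = L ^+ 2 /\ X ^+ 2 + 1 = (2 - 2 * L') * X.
  have : (X ^+ 2 + 1 - 2 * X - 2 * L * X) * (X ^+ 2 + 1 - 2 * X + 2 * L * X) = 0.
    have -> : (X ^+ 2 + 1 - 2 * X - 2 * L * X) * (X ^+ 2 + 1 - 2 * X + 2 * L * X)
      = (X ^+ 2 - 1) ^+ 2 - 4 * X * (X ^+ 2 + (L ^+ 2 - 2) * X + 1) by ring.
    by rewrite eX subrr.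
  move=> /eqP; rewrite mulf_eq0 => /orP[] /eqP h.
    by exists (- L); split; [ring|apply/eqP; rewrite -subr_eq0 -h; apply/eqP; ring].
  by exists L; split; [ring|apply/eqP; rewrite -subr_eq0 -h; apply/eqP; ring].
(* Since [X + X^-1 = 2 - 2 * L'], the pair [(L', s)] lies on the conic [s ^+ 2 = L' ^+ 2 - 2 * L'];
   [t] below is the slope of its chord through [(2, 0)]. *)
pose s := (X - X^-1) / 2.
have L2 : L' - 2 != 0.
  apply/eqP => /subr0_eq e; apply: nsq; exists 0; rewrite pE qE -eL' e; ring.
have sE : s ^+ 2 = L' ^+ 2 - 2 * L'.
  have -> : s ^+ 2 = ((X ^+ 2 + 1) ^+ 2 - 4 * X ^+ 2) / (4 * X ^+ 2).
    by rewrite /s; field; rewrite ?X0 ?two0 ?four0.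
  by rewrite wE; field; rewrite ?X0 ?two0 ?four0.
pose t := s / (L' - 2); have tE : t ^+ 2 = L' / (L' - 2).
  by rewrite expr_div_n sE; field.
have d1 : t ^+ 2 - 1 = 2 / (L' - 2) by rewrite tE; field.
have eC : wequiv (C p q) (E8 t).
  have gV : g^-1 != 0 by rewrite invr_eq0.
  rewrite E8E; have := wequiv_scale p q gV; congr (wequiv _ (C _ _)).
    by rewrite pE (exprM t 2 2) d1 tE -eL'; field; rewrite ?g0 ?two0 ?L2 ?four0.
  by rewrite qE; field.
have nsqt : ~ is_square (2 * t ^+ 2 - 1).
  apply: (@nonsquare_div _ (g ^+ 2 * L' * (L' - 2)) _ _ _ nsq).
  by rewrite pE qE tE -eL'; field.
exists t; split=> //; last first.
  by apply/isomorphic_wequiv; apply: wequiv_trans eE eC.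
have d0 : t ^+ 2 - 1 != 0 by rewrite d1 mulf_neq0 ?invr_eq0.
rewrite subr_sqr_1 mulf_eq0 negb_or subr_eq0 addr_eq0 in d0.
rewrite !inE !negb_or d0 andbT; apply/eqP => t0.
move/eqP: tE; rewrite t0 expr0n eq_sym mulf_eq0 invr_eq0 (negPf L2) orbF => /eqP L0.
by apply: nsq; exists 0; rewrite pE qE -eL' L0; ring.
Qed.

Lemma torsion12 E : elliptic E ->
  (one_point_of_order_2_and_point_of_order E 12 <->
   exists t, [/\ t \notin [:: 0; 1; -1],
     forall i : K, i ^+ 2 = -1 -> t \notin [:: i; - i],
     ~ is_square ((t ^+ 2 + 1) * (3 * t ^+ 2 - 1)),
     3 * t ^+ 2 + 1 != 0 & isomorphic E (E12 t)]).
Proof.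
move=> ellE; split=> [/(normal_form two0 ellE)|[t [tn _ nsq c0]]]; last first.
  have [t0 d0] : t != 0 /\ t ^+ 2 - 1 != 0.
    move: tn; rewrite !inE !negb_or subr_sqr_1 => /and3P[t0 t1 t2].
    by rewrite mulf_neq0 ?subr_eq0 ?addr_eq0.
  have [i0 _] : t ^+ 2 + 1 != 0 /\ 3 * t ^+ 2 - 1 != 0.
    by apply/andP; rewrite -negb_or -mulf_eq0; apply: nonsquare_neq0.
  rewrite E12E //; set m := (- 4 * _ * _ / _).
  have m0 : m != 0 by rewrite !mulf_neq0 ?oppr_eq0 ?invr_eq0 ?expf_neq0.
  apply: one_point_isomorphic (E6E m) _ _ => //.
    apply: (@nonsquare_mul _ (m * (4 * t / (t ^+ 2 - 1) ^+ 2)) _ _ _ _ nsq).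
      rewrite (mulf_neq0 m0) // !mulf_neq0 ?invr_eq0 ?expf_neq0 //.
    by rewrite /m; field.
  (* These satisfy [q = c ^+ 2] and [p = l ^+ 2 - 2 * c] on the normal form. The resulting point of
     order 4 is added to the point [(1, m)] of order 3. *)
  move=> ell; pose c := - (3 * t ^+ 2 + 1) / (t ^+ 2 - 1).
  pose l := 8 * t ^+ 3 / (t ^+ 2 - 1) ^+ 2.
  have n8 : (8 : K) != 0.
    by rewrite (_ : 8 = 2 ^+ 3); [rewrite expf_neq0|ring].
  have oR : point_of_order (C (m ^+ 2 + 2 * m - 2) (1 - 2 * m)) 4 (Some (c, l * c)).
    apply: order4_intro => //.
    - by rewrite /m /l /c; field.
    - by rewrite /m /c; field.
    - by rewrite mulf_neq0 ?oppr_eq0 ?invr_eq0.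
    by rewrite !mulf_neq0 ?invr_eq0 ?expf_neq0.
  have oQ : point_of_order (C (m ^+ 2 + 2 * m - 2) (1 - 2 * m)) 3 (Some (1, m)).
    apply: (order3_intro two0 (l := m + 1)) => //; try ring.
    by apply/on_torsion_curve; ring.
  by eexists; apply: (@point_of_order_add _ _ _ _ two0 ell 4 3 _ _ isT oR oQ).
case=> p [q [ell nsq eE [P oP]]].
have o3 := @point_of_order_mul _ _ _ _ two0 ell 3 4 P isT isT oP.
have [l [w [w0 _ pE qE]]] := order3_param two0 o3.
have o4 := @point_of_order_mul _ _ _ _ two0 ell 4 3 P isT isT oP.
have [k [x [_ pE' qE' x0 k0]]] := order4_param two0 ell nsq o4.
(* The abscissa of the point of order 4 after scaling to [w = 1]. Equating the two expressions for
   [q] gives [l] in terms of [c]; those for [p] leave the condition [kE]. *)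
pose c := x / w ^+ 2; have xE : x = c * w ^+ 2 by rewrite divfK ?expf_neq0.
have c0 : c != 0 by rewrite mulf_neq0 ?invr_eq0 ?expf_neq0.
have lE : l = w * (c ^+ 2 - 3) / 2.
  have -> : c ^+ 2 = q / w ^+ 4 by rewrite qE' xE; field.
  by rewrite qE; field; rewrite ?w0 ?two0.
have kE : k ^+ 2 = w ^+ 2 * ((c - 1) ^+ 3 * (c + 3)) / 4.
  have -> : k ^+ 2 = p + 2 * x by rewrite pE'; ring.
  by rewrite pE lE xE; field; rewrite ?two0 ?four0.
have [c1 c3] : c - 1 != 0 /\ c + 3 != 0.
  have kn := expf_neq0 2 k0; rewrite kE in kn.
  by split; apply: contraNneq kn => ->; rewrite ?expr0n /= !(mul0r, mulr0).
(* Dividing out square factors of [kE] leaves the conic [v ^+ 2 = (c - 1) * (c + 3)]; [t] is the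
   slope of its chord through [(-3, 0)]. *)
pose v := 2 * k / (w * (c - 1)).
have vE : v ^+ 2 = (c - 1) * (c + 3).
  have -> : v ^+ 2 = 4 * k ^+ 2 / (w * (c - 1)) ^+ 2 by rewrite /v; field; rewrite ?w0 ?c1.
  by rewrite kE; field; rewrite ?w0 ?c1 ?four0.
pose t := v / (c + 3); have tE : t ^+ 2 = (c - 1) / (c + 3).
  by rewrite expr_div_n vE; field.
have d1 : t ^+ 2 - 1 = - 4 / (c + 3) by rewrite tE; field.
have d0 : t ^+ 2 - 1 != 0 by rewrite d1 mulf_neq0 ?oppr_eq0 ?invr_eq0.
have nsqt : ~ is_square ((t ^+ 2 + 1) * (3 * t ^+ 2 - 1)).
  apply: (@nonsquare_div _ (w ^+ 2 * (c + 1) * (c - 1) * (c + 3) / 8 * v) _ _ _ nsq).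
  have n8 : (8 : K) != 0.
    by rewrite (_ : 8 = 2 ^+ 3); [rewrite expf_neq0|ring].
  rewrite exprMn vE tE pE qE lE; field.
  by rewrite ?c3 ?n8 ?two0 ?four0 ?n16.
have t0 : t != 0.
  by apply: contraNneq c1 => t0; rewrite -(divfK c3 (c - 1)) -tE t0 expr0n mul0r.
exists t; split=> //.
- rewrite subr_sqr_1 mulf_eq0 negb_or subr_eq0 addr_eq0 in d0.
  by rewrite !inE !negb_or t0.
- move=> i i2; rewrite !inE negb_or; apply/andP; split; apply/eqP => ti;
    by apply: nsqt; exists 0; rewrite ti ?sqrrN i2; ring.
- have -> : 3 * t ^+ 2 + 1 = 4 * c / (c + 3) by rewrite tE; field.
  by rewrite !mulf_neq0 ?invr_eq0 ?expf_neq0.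
apply/isomorphic_wequiv; apply: wequiv_trans eE _; rewrite E12E //.
have := wequiv_E6 w0 pE qE; congr (wequiv _ (E6 _)).
by rewrite d1 tE lE; field; rewrite ?c3 ?w0 ?two0 ?four0 ?n16.
Qed.

Lemma torsion10 E : elliptic E ->
  (one_point_of_order_2_and_point_of_order E 10 <->
   exists t, [/\ t \notin [:: 0; 1; -1],
     forall s : K, s ^+ 2 = 5 ->
       t \notin [:: (-1 + s) / 2; (-1 - s) / 2; 2 + s; 2 - s],
     ~ is_square (t * (t ^+ 2 + t - 1)) & isomorphic E (E10 t)]).
Proof.
move=> ellE.
(* With [t = (1 + r) / (1 - r)], the discriminant [p ^+ 2 - 4 * q] is a square times
   [t * (t ^+ 2 + t - 1)]; both directions use this. *)
have disc10 (r Y : K) : r != 0 -> r - 1 != 0 -> r + 1 != 0 ->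
    2 * Y * r = - ((r + 1) * (r ^+ 2 - 1)) ->
    (Y ^+ 2 - 2 + 2 * Y * r) ^+ 2 - 4 * (1 - 2 * Y * r) =
    ((r + 1) ^+ 2 * (1 - r) ^+ 4 / (4 * r ^+ 2 )) ^+ 2 *
     ((1 + r) / (1 - r) * (((1 + r) / (1 - r)) ^+ 2 + (1 + r) / (1 - r) - 1)).
  move=> r0 r1 r2 eY; have r1c : 1 - r != 0 by rewrite -opprB oppr_eq0.
  have YE : Y = - ((r + 1) * (r ^+ 2 - 1)) / (2 * r).
    by rewrite -eY; field; rewrite ?r0 ?two0.
  rewrite YE; field; by rewrite ?r0 ?two0 ?r1c ?four0 ?n16.
split=> [/(normal_form two0 ellE)|[t [tn _ nsq]]]; last first.
  have [t0 t1 t2] : [/\ t != 0, t - 1 != 0 & t + 1 != 0].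
    by move: tn; rewrite !inE !negb_or => /and3P[? ? ?]; rewrite subr_eq0 addr_eq0.
  pose r := (t - 1) / (t + 1).
  have r0 : r != 0 by rewrite mulf_neq0 ?invr_eq0.
  have r1 : r - 1 != 0.
    have -> : r - 1 = - 2 / (t + 1) by rewrite /r; field.
    by rewrite mulf_neq0 ?oppr_eq0 ?invr_eq0.
  have r2 : r + 1 != 0.
    have -> : r + 1 = 2 * t / (t + 1) by rewrite /r; field.
    by rewrite !mulf_neq0 ?invr_eq0.
  have r1c : 1 - r != 0 by rewrite -opprB oppr_eq0.
  have rr : r ^+ 2 != 1 by rewrite -subr_eq0 subr_sqr_1 mulf_neq0.
  pose Y := - ((r + 1) * (r ^+ 2 - 1)) / (2 * r).
  have eY : 2 * Y * r = - ((r + 1) * (r ^+ 2 - 1)).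
    by rewrite /Y; field; rewrite ?r0 ?two0.
  have tE : t = (1 + r) / (1 - r).
    have -> : 1 - r = 2 / (t + 1) by rewrite /r; field.
    by rewrite /r; field; rewrite ?t2 ?two0.
  have := E10E r0 rr eY; rewrite -tE => eW.
  apply: one_point_isomorphic eW _ _ => //.
    have e := disc10 r Y r0 r1 r2 eY; rewrite -tE in e.
    apply: (nonsquare_mul _ e nsq).
    by rewrite !mulf_neq0 ?invr_eq0 ?expf_neq0 // mulf_neq0 ?expf_neq0.
  move=> ell; apply: (order2_mul_odd (n := 5) two0 ell) => //.
  exact: (order5_intro two0 ell r0 rr eY).
case=> p [q [ell nsq eE [P oP]]].
have o5 := @point_of_order_mul _ _ _ _ two0 ell 5 2 P isT isT oP.
case eQ : (ec_mul _ 2 P) o5 => [[x y]|] o5; last by have [_ _ _ /(_ 1%N isT)] := o5.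
(* The abscissa is a square, so scaling by [w^-1] moves it to 1. *)
have [w w0 xE] := order5_square two0 ell o5.
have wV : w^-1 != 0 by rewrite invr_eq0.
have eC := wequiv_scale p q wV.
have ellC := ell; rewrite (elliptic_wequiv eC) in ellC.
have := order_scale two0 wV ell o5.
have -> : w^-1 ^+ 2 * x = 1 by rewrite xE; field.
move=> /(order5_param two0 ellC)[r [Y [r0 rr eY pE qE]]].
have [r1 r2] : r - 1 != 0 /\ r + 1 != 0.
  by apply/andP; rewrite -negb_or -mulf_eq0 -subr_sqr_1 subr_eq0.
have r1c : 1 - r != 0 by rewrite -opprB oppr_eq0.
have eW := E10E r0 rr eY; rewrite -pE -qE in eW.
have eD := disc10 _ _ r0 r1 r2 eY; rewrite -pE -qE in eD.
set t := (1 + r) / (1 - r) in eW eD.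
have nsqt : ~ is_square (t * (t ^+ 2 + t - 1)).
  apply: (nonsquare_div eD).
  have e : (p * w^-1 ^+ 2) ^+ 2 - 4 * (q * w^-1 ^+ 4) = (w^-1 ^+ 2) ^+ 2 * (p ^+ 2 - 4 * q).
    by field.
  exact: (nonsquare_mul (expf_neq0 2 wV) e nsq).
exists t; split=> //; last first.
- apply/isomorphic_wequiv; apply: wequiv_trans eE _.
  by apply: wequiv_trans eC _; apply: wequiv_sym.
(* The excluded values involving square roots of 5 are the roots of [t ^+ 2 + t - 1], where the
   nonsquare would be 0, and of [t ^+ 2 - 4 * t - 1], where [q] would vanish. *)
- have not_root : t ^+ 2 + t - 1 != 0.
    by apply/eqP => h; apply: nsqt; exists 0; rewrite h; ring.
  have not_root' : t ^+ 2 - 4 * t - 1 != 0.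
    have := ellC; rewrite elliptic_torsion_curve // => /andP[+ _]; rewrite qE.
    apply: contraNneq => h; rewrite eY.
    have -> : 1 - - ((r + 1) * (r ^+ 2 - 1)) =
      (t ^+ 2 - 4 * t - 1) * ((1 - r) ^+ 2 * r / 4).
      by rewrite /t; field; rewrite ?r1c ?four0.
    by rewrite h mul0r.
  move=> s s5; rewrite !inE !negb_or; apply/and4P; split.
  + apply: contraNneq not_root => ->; apply/eqP.
    by rewrite -[RHS](mul0r (4^-1)) -(subrr 5) -{1}s5; field; rewrite ?two0 ?four0.
  + apply: contraNneq not_root => ->; apply/eqP.
    by rewrite -[RHS](mul0r (4^-1)) -(subrr 5) -{1}s5; field; rewrite ?two0 ?four0.
  + by apply: contraNneq not_root' => ->; apply/eqP; rewrite -(subrr 5) -{1}s5; ring.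
  by apply: contraNneq not_root' => ->; apply/eqP; rewrite -(subrr 5) -{1}s5; ring.
rewrite !inE !negb_or; apply/and3P; split.
- by rewrite mulf_neq0 ?invr_eq0 // addrC.
- rewrite -subr_eq0 (_ : t - 1 = 2 * r / (1 - r)); last by rewrite /t; field.
  by rewrite !mulf_neq0 ?invr_eq0.
rewrite -addr_eq0 (_ : t + 1 = 2 / (1 - r)); last by rewrite /t; field.
by rewrite mulf_neq0 ?invr_eq0.
Qed.

End Families.

Theorem theorem1p1 (K : fieldType) (charK : 2%N \notin [pchar K])
    (E : weierstrass K) (ellE : elliptic E) :
  [/\ forall a : K, a != 0 ->
        (one_point_of_order_2_and_point_of_order E 4 <->
         exists b : K,
           [/\ b != 0, ~ is_square (a ^+ 2 + 4 * b)
             & isomorphic E (E4 a b)]),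
      one_point_of_order_2_and_point_of_order E 8 <->
        (exists t : K,
           [/\ t \notin [:: 0; 1; -1],
               ~ is_square (2 * t ^+ 2 - 1)
             & isomorphic E (E8 t)]),
      one_point_of_order_2_and_point_of_order E 6 <->
        (exists t : K,
           [/\ t \notin [:: 0; -4; 1 / 2],
               ~ is_square (t ^+ 2 + 4 * t)
             & isomorphic E (E6 t)]),
      (* i ranges over the square roots of -1 lying in K *)
      one_point_of_order_2_and_point_of_order E 12 <->
        (exists t : K,
           [/\ t \notin [:: 0; 1; -1],
               forall i : K, i ^+ 2 = -1 -> t \notin [:: i; - i],
               ~ is_square ((t ^+ 2 + 1) * (3 * t ^+ 2 - 1)),
               3 * t ^+ 2 + 1 != 0
             & isomorphic E (E12 t)])
      & (* s ranges over the square roots of 5 lying in K *)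
      one_point_of_order_2_and_point_of_order E 10 <->
        (exists t : K,
           [/\ t \notin [:: 0; 1; -1],
               forall s : K, s ^+ 2 = 5 ->
                 t \notin [:: (-1 + s) / 2; (-1 - s) / 2; 2 + s; 2 - s],
               ~ is_square (t * (t ^+ 2 + t - 1))
             & isomorphic E (E10 t)])].
Proof.
split; [by move=> a; apply: torsion4 | exact: torsion8 | exact: torsion6
  | exact: torsion12 | exact: torsion10].
Qed.
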